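(* Let $M$ be a closed orientable smooth $n$-manifold and $\mathcal M$ the space of smooth Riemannian metrics on $M$. Consider the connection on $\mathcal M$ with covariant derivative $$\overline\nabla_ab=d_ab-\tfrac12(aB+bA)+\tfrac18\big(\mathrm{tr}(A)b+\mathrm{tr}(B)a\big).$$ Then: 1) The curvature tensor of $\overline\nabla$ is $$\overline R(a,b)c=-\tfrac14\,g\,[[A,B],C]-\tfrac1{64}\big(\mathrm{tr}(A)b-\mathrm{tr}(B)a\big)\mathrm{tr}(C).$$ 2) The geodesic of $\overline\nabla$ on $\mathcal M$ going out from $g\in\mathcal M$ in direction $A_0=\frac{4\beta}{n}I+B$ with $\mathrm{tr}(B)=0$ (i.e. with initial velocity $gA_0$) is $$g_t=\begin{cases}(\beta t+1)^{4/n}\,g\,\exp\!\big(\tfrac1\beta\ln(\beta t+1)\,B\big),&\beta\neq0,\\ g\,\exp(Bt),&\beta=0.\end{cases}$$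
   Context: $S_2$ is the Fréchet space of smooth symmetric 2-forms on $M$; $\mathcal M\subset S_2$ is the open cone of positive definite ones, $T_g\mathcal M=S_2$. For $a,b,c\in S_2$, $g\in\mathcal M$: $A=g^{-1}a$, $B=g^{-1}b$, $C=g^{-1}c$ (raising the first index with $g$); $aB$ is the 2-form $a_{ik}B^k_j$; $gE$ is $g_{ik}E^k_j$. $d_ab=\frac{d}{dt}|_{t=0}b(g+ta)$. $\overline R(a,b)c=\overline\nabla_a\overline\nabla_bc-\overline\nabla_b\overline\nabla_ac-\overline\nabla_{[a,b]}c$. In 2), $\beta$ is a smooth function on $M$, $B$ is a traceless $g$-symmetric endomorphism of $TM$, $I$ the identity, and the formula is understood pointwise on $M$ for $t$ with $\beta t+1>0$ everywhere. Geodesics are curves with $\overline\nabla_{g_t'}g_t'=0$. *)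

(* Defs.v *)
From HB Require Import structures.
From mathcomp Require Import all_boot all_order all_algebra.
From mathcomp Require Import all_classical all_reals all_analysis.
Set Implicit Arguments.
Unset Strict Implicit.
Unset Printing Implicit Defensive.
Import Order.TTheory GRing.Theory Num.Theory.
Import numFieldNormedType.Exports.
Local Open Scope classical_set_scope.
Local Open Scope ring_scope.

(* Matrices lack the join of their topological and module structures. *)
HB.instance Definition _ (R : realType) m n := GRing.Lmodule.on 'M[R]_(m, n).

(* The tangent bundle of [E]; an alias of [E * E], because the library's
   instance on products is only declared for locally convex spaces. *)
Definition tangent (R : realType) (E : preTopologicalLmodType R) : Type :=
  (E * E)%type.

HB.instance Definition _ (R : realType) (E : preTopologicalLmodType R) :=
  Topological.copy (tangent E) (E * E)%type.
HB.instance Definition _ (R : realType) (E : preTopologicalLmodType R) :=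
  GRing.Lmodule.copy (tangent E) (E * E)%type.

Definition diff_quotient (R : realType) (E F : lmodType R) (f : E -> F)
  (x v : E) : R -> F := fun h => h^-1 *: (f (h *: v + x) - f x).

(* The Michal-Bastiani definition of a map of class C^k between topological
   vector spaces.  [f] is of class C^k on the open set [U]: for k > 0, its directional
   derivatives form a map of class C^(k-1) on [U * E].  For [E] and [F] of
   finite dimension this is the usual notion. *)
Fixpoint Ck (R : realType) (k : nat) (E F : preTopologicalLmodType R)
    (U : set E) (f : E -> F) : Prop :=
  (forall x, U x -> {for x, continuous f}) /\
  match k with
  | 0 => True
  | k'.+1 => exists df : tangent E -> F,
      (forall x v, U x -> diff_quotient f x v @ 0^' --> df (x, v)) /\
      Ck k' [set xv : tangent E | U xv.1] df
  end.

Definition smooth_on (R : realType) (E F : preTopologicalLmodType R)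
  (U : set E) (f : E -> F) : Prop := forall k, Ck k U f.

Section CkTheory.
Context {R : realType}.
Implicit Types E F : preTopologicalLmodType R.

Lemma Ck_continuous k E F (U : set E) (f : E -> F) x :
  Ck k U f -> U x -> {for x, continuous f}.
Proof. by case: k => [|k] [+ _]; exact. Qed.

Lemma CkS k E F (U : set E) (f : E -> F) : Ck k.+1 U f -> Ck k U f.
Proof.
elim: k E U f => [|k IHk] E U f; first by case.
case=> fc [df [fdf dfk]]; split=> //; exists df; split=> //; exact: IHk.
Qed.

Lemma Ck_precomp k E E' F (U : set E) (U' : set E') (L : E' -> E)
    (f : E -> F) :
  continuous L -> (forall h v x, L (h *: v + x) = h *: L v + L x) ->
  (forall x, U' x -> U (L x)) -> Ck k U f -> Ck k U' (f \o L).
Proof.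
elim: k E E' U U' L f => [|k IHk] E E' U U' L f Lc Ll LU fk.
  split=> // x U'x; apply: continuous_comp; first exact: Lc.
  exact: (Ck_continuous fk (LU _ U'x)).
split=> [x U'x|].
  apply: continuous_comp; first exact: Lc.
  exact: (Ck_continuous fk (LU _ U'x)).
case: fk => _ [df [fdf dfk]].
exists (df \o (fun z : tangent E' => (L z.1, L z.2) : tangent E)); split.
  move=> x v U'x; rewrite [X in X @ _ --> _](_ : _ = diff_quotient f (L x) (L v)).
    exact: fdf (LU _ U'x).
  by apply/funext => h; rewrite /diff_quotient /= Ll.
apply: (IHk _ _ [set xv : tangent E | U xv.1]) => //.
- move=> z; apply: cvg_pair => /=.
    by apply: (continuous_comp (f := fst)); [exact: cvg_fst|exact: Lc].
  by apply: (continuous_comp (f := snd)); [exact: cvg_snd|exact: Lc].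
- by move=> h v x; rewrite /= !Ll.
- by move=> x /= /LU.
Qed.

Lemma Ck_fst k E F (U : set E) (f : E -> F) :
  Ck k U f -> Ck k [set xv : tangent E | U xv.1] (fun z => f z.1).
Proof.
by apply: (Ck_precomp (L := fun z : tangent E => z.1)) => // z; exact: cvg_fst.
Qed.

Lemma Ck_cst k E (V : normedModType R) (U : set E) (c : V) : Ck k U (cst c).
Proof.
elim: k E U c => [|k IHk] E U c; (split; first by move=> x _; exact: cvg_cst).
  by [].
exists (cst 0); split=> // x v _.
rewrite [X in X @ _ --> _](_ : _ = cst 0); first exact: cvg_cst.
by apply/funext => h; rewrite /diff_quotient /= subrr scaler0.
Qed.

Lemma CkD k E (V : normedModType R) (U : set E) (f g : E -> V) :
  Ck k U f -> Ck k U g -> Ck k U (f \+ g).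
Proof.
elim: k E U f g => [|k IHk] E U f g fk gk.
  split=> // x Ux.
  by apply: cvgD; [exact: (Ck_continuous fk)|exact: (Ck_continuous gk)].
split=> [x Ux|].
  by apply: cvgD; [exact: (Ck_continuous fk)|exact: (Ck_continuous gk)].
case: fk gk => _ [df [fdf dfk]] [_ [dg [gdg dgk]]].
exists (df \+ dg); split; last exact: IHk.
move=> x v Ux; rewrite [X in X @ _ --> _](_ : _ =
    diff_quotient f x v \+ diff_quotient g x v).
  by apply: cvgD; [exact: fdf|exact: gdg].
by apply/funext => h; rewrite /diff_quotient /= opprD addrACA scalerDr.
Qed.

Lemma CkZ k E (V : normedModType R) (U : set E) (c : R) (f : E -> V) :
  Ck k U f -> Ck k U (fun x => c *: f x).
Proof.
elim: k E U f => [|k IHk] E U f fk.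
  split; last exact: I.
  by move=> x Ux; apply: cvgZl_tmp; exact: (Ck_continuous fk).
split; first by move=> x Ux; apply: cvgZl_tmp; exact: (Ck_continuous fk).
case: fk => _ [df [fdf dfk]]; exists (fun z => c *: df z); split; last exact: IHk.
move=> x v Ux; rewrite [X in X @ _ --> _](_ : _ = c \*: diff_quotient f x v).
  by apply: cvgZl_tmp; exact: fdf.
by apply/funext => h; rewrite /diff_quotient /= -scalerBr !scalerA mulrC.
Qed.

Lemma Ck_postcomp k E (V W : normedModType R) (U : set E) (L : {linear V -> W})
    (f : E -> V) : continuous L -> Ck k U f -> Ck k U (L \o f).
Proof.
move=> Lc; elim: k E U f => [|k IHk] E U f fk.
  split=> // x Ux.
  by apply: continuous_comp; [exact: (Ck_continuous fk)|exact: Lc].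
split=> [x Ux|].
  by apply: continuous_comp; [exact: (Ck_continuous fk)|exact: Lc].
case: fk => _ [df [fdf dfk]]; exists (L \o df); split; last exact: IHk.
move=> x v Ux; rewrite [X in X @ _ --> _](_ : _ = L \o diff_quotient f x v).
  by apply: continuous_cvg; [exact: Lc|exact: fdf].
by apply/funext => h; rewrite /diff_quotient /= linearZ (raddfB L).
Qed.

End CkTheory.

Section MatrixCvg.
Context {R : realType} {T : Type} {F : set_system T} {FF : Filter F}.

Lemma cvg_mx m n (f : T -> 'M[R]_(m, n)) (A : 'M[R]_(m, n)) :
  (forall i j, f x i j @[x --> F] --> A i j) -> f @ F --> A.
Proof.
move=> fA B [P AP PB]; rewrite /= /fmap /=.
have : \forall x \near F, forall i, forall j, P i j (f x i j).
  by apply: filter_forall => i; apply: filter_forall => j; exact: fA (AP i j).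
by apply: filterS => x Px; exact: PB.
Qed.

Lemma cvg_coord m n (f : T -> 'M[R]_(m, n)) (A : 'M[R]_(m, n)) i j :
  f @ F --> A -> f x i j @[x --> F] --> A i j.
Proof.
move=> fA; exact: (cvg_comp f (fun M : 'M[R]_(m, n) => M i j) fA
  (@coord_continuous R m n i j A)).
Qed.

Lemma cvg_mulmx m n p (f : T -> 'M[R]_(m, n)) (g : T -> 'M[R]_(n, p))
    (A : 'M[R]_(m, n)) (B : 'M[R]_(n, p)) :
  f @ F --> A -> g @ F --> B -> f x *m g x @[x --> F] --> A *m B.
Proof.
move=> fA gB; apply: cvg_mx => i j.
under eq_fun do rewrite mxE; rewrite mxE.
apply: cvg_big => [|k _]; first exact: add_continuous.
by apply: cvgM; exact: cvg_coord.
Qed.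

Lemma cvg_det n (f : T -> 'M[R]_n) (A : 'M[R]_n) :
  f @ F --> A -> \det (f x) @[x --> F] --> \det A.
Proof.
move=> fA; apply: cvg_big => [|s _]; first exact: add_continuous.
apply: cvgM; first exact: cvg_cst.
by apply: cvg_big => [|i _]; [exact: mul_continuous|exact: cvg_coord].
Qed.

End MatrixCvg.

Lemma cvg_invmx (R : realType) (T : Type) (F : set_system T) {FF : Filter F}
    n (f : T -> 'M[R]_n) (A : 'M[R]_n) :
  A \in unitmx -> f @ F --> A -> invmx (f x) @[x --> F] --> invmx A.
Proof.
move=> Au fA.
have detA : \det (f x) @[x --> F] --> \det A.
  exact: cvg_det.
have dA0 : \det A != 0.
  by rewrite -unitfE -unitmxE.
rewrite [invmx A]/invmx Au.
apply: (cvg_trans (G := (\det (f x))^-1 *: \adj (f x) @[x --> F])).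
  apply: near_eq_cvg.
  have /detA : nbhs (\det A) [set y : R | y != 0].
    by apply: open_nbhs_nbhs; split => //; exact: open_neq.
  rewrite nbhs_simpl /= => nz; apply: filterS nz => x /= dx.
  by rewrite /invmx unitmxE unitfE dx.
apply: cvgZ; first exact: (cvgV dA0 detA).
apply: cvg_mx => i j; under eq_fun do rewrite mxE; rewrite mxE.
apply: cvgM; first exact: cvg_cst.
apply: cvg_det; apply: cvg_mx => k l.
under eq_fun do rewrite !mxE; rewrite !mxE; exact: cvg_coord.
Qed.

Section CkMatrix.
Context {R : realType}.
Implicit Types E : preTopologicalLmodType R.

Lemma continuous_mulmx E m n p (f : E -> 'M[R]_(m, n)) (g : E -> 'M[R]_(n, p))
    x :
  {for x, continuous f} -> {for x, continuous g} ->
  {for x, continuous (fun x => f x *m g x)}.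
Proof. exact: (@cvg_mulmx R E (nbhs x) _ m n p f g (f x) (g x)). Qed.

Lemma continuous_invmx E n (f : E -> 'M[R]_n) x :
  f x \in unitmx -> {for x, continuous f} ->
  {for x, continuous (fun x => invmx (f x))}.
Proof. exact: (@cvg_invmx R E (nbhs x) _ n f (f x)). Qed.

Lemma cvg_line (E : lmodType R) (V : normedModType R) (f : E -> V)
    (x v : E) (l : V) :
  diff_quotient f x v @ 0^' --> l -> f (h *: v + x) @[h --> 0^'] --> f x.
Proof.
move=> fl; rewrite -[X in _ --> X](addr0 (f x)) -[X in _ + X](scale0r l).
apply: (cvg_trans (G := f x + h *: diff_quotient f x v h @[h --> 0^'])).
  apply: near_eq_cvg; near=> h; rewrite /diff_quotient scalerA divff.
    by rewrite scale1r addrC subrK.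
  by near: h; exact: nbhs_dnbhs_neq.
apply: cvgD; first exact: cvg_cst.
by apply: cvgZ => //; exact: nbhs_dnbhs.
Unshelve. all: by end_near. Qed.

Lemma Ck_mulmx k E m n p (U : set E) (f : E -> 'M[R]_(m, n))
    (g : E -> 'M[R]_(n, p)) :
  Ck k U f -> Ck k U g -> Ck k U (fun x => f x *m g x).
Proof.
elim: k E U f g => [|k IHk] E U f g fk gk.
  split; last exact: I.
  by move=> x Ux; apply: continuous_mulmx; apply: Ck_continuous Ux; eassumption.
split; first by move=> x Ux; apply: continuous_mulmx;
  apply: Ck_continuous Ux; eassumption.
have fst_f := Ck_fst (CkS fk); have fst_g := Ck_fst (CkS gk).
case: fk gk => fc [df [fdf dfk]] [gc [dg [gdg dgk]]].
exists ((fun z => df z *m g z.1) \+ (fun z => f z.1 *m dg z)); split; last first.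
  by apply: CkD; apply: IHk.
move=> x v Ux /=; apply: (cvg_trans (G := diff_quotient f x v h *m g (h *: v + x)
    + f x *m diff_quotient g x v h @[h --> 0^'])); last first.
  apply: cvgD; apply: cvg_mulmx; [exact: fdf| |exact: cvg_cst|exact: gdg].
  exact: cvg_line (gdg x v Ux).
apply: near_eq_cvg; near=> h.
rewrite /diff_quotient -scalemxAl -scalemxAr -scalerDr mulmxBl mulmxBr.
by rewrite addrA subrK.
Unshelve. all: by end_near. Qed.

Lemma Ck_invmx k E n (U : set E) (f : E -> 'M[R]_n) :
  (forall x, U x -> f x \in unitmx) -> Ck k U f -> Ck k U (fun x => invmx (f x)).
Proof.
elim: k E U f => [|k IHk] E U f fU fk.
  split; last exact: I.
  move=> x Ux; exact: continuous_invmx (fU x Ux) (Ck_continuous fk Ux).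
split; first by move=> x Ux;
  exact: continuous_invmx (fU x Ux) (Ck_continuous fk Ux).
have fst_f : Ck k [set z : tangent E | U z.1] (fun z => invmx (f z.1)).
  exact: (Ck_fst (IHk _ _ _ fU (CkS fk))).
case: fk => fc [df [fdf dfk]].
exists (fun z => (- 1)%:M *m (invmx (f z.1) *m df z *m invmx (f z.1))); split.
  move=> x v Ux /=; have fx := cvg_line (fdf x v Ux).
  have := fU x Ux; rewrite unitmxE unitfE => dfx0.
  apply: (cvg_trans (G := (- 1)%:M *m (invmx (f (h *: v + x)) *m
      diff_quotient f x v h *m invmx (f x)) @[h --> 0^'])); last first.
    apply: cvg_mulmx; first exact: cvg_cst.
    apply: cvg_mulmx; last exact: cvg_cst.
    apply: cvg_mulmx; last exact: fdf.
    by apply: cvg_invmx => //; exact: fU.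
  have /(cvg_det fx) nz : nbhs (\det (f x)) [set y : R | y != 0].
    by apply: open_nbhs_nbhs; split => //; exact: open_neq.
  apply: near_eq_cvg; move: nz; rewrite nbhs_simpl /=; apply: filterS => h /=.
  rewrite -unitfE -unitmxE => fhU.
  rewrite /diff_quotient -scalemxAr -scalemxAl -scalemxAr mulmxBr mulmxBl.
  rewrite mulVmx// mul1mx -mulmxA mulmxV ?fU// mulmx1.
  by rewrite mul_scalar_mx scaleN1r opprB.
apply: Ck_mulmx; first exact: Ck_cst.
by apply: Ck_mulmx => //; exact: Ck_mulmx.
Unshelve. all: by end_near. Qed.

Definition trace_mx n (A : 'M[R]_n) : 'M[R]_n := (\tr A)%:M.

Lemma trace_mx_is_linear n : linear (@trace_mx n).
Proof.
by move=> c A B; rewrite /trace_mx linearP /= raddfD /= -scale_scalar_mx.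
Qed.

HB.instance Definition _ n :=
  GRing.isLinear.Build R 'M[R]_n 'M[R]_n *:%R (@trace_mx n)
    (@trace_mx_is_linear n).

Lemma continuous_trace_mx n : continuous (@trace_mx n).
Proof.
move=> A; apply: (@cvg_mx R _ (nbhs A)) => i j; under eq_fun do rewrite mxE; rewrite mxE.
apply: cvgMn; apply: cvg_big => [|k _].
  exact: add_continuous.
exact: coord_continuous.
Qed.

Lemma Ck_trace k E n (U : set E) (f : E -> 'M[R]_n) :
  Ck k U f -> Ck k U (fun x => trace_mx (f x)).
Proof. by move=> fk; apply: Ck_postcomp fk; exact: continuous_trace_mx. Qed.

End CkMatrix.

(* Charts of an n-manifold without boundary. [cinv] is only meaningful on the
   image [coords] of the chart. *)
Record chart (R : realType) (n : nat) (T : topologicalType) := Chart {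
  dom : set T;
  cmap : T -> 'rV[R]_n;
  cinv : 'rV[R]_n -> T;
  dom_open : open dom;
  coords_open : open (cmap @` dom);
  cmapK : forall x, dom x -> cinv (cmap x) = x;
  cmap_continuous : forall x, dom x -> {for x, continuous cmap};
  cinv_continuous : forall p, (cmap @` dom) p -> {for p, continuous cinv}
}.

Section Charts.
Context {R : realType} {n : nat} {T : topologicalType}.
Implicit Types c : chart R n T.

Definition coords c : set 'rV[R]_n := cmap c @` dom c.

Definition overlap c c' : set 'rV[R]_n := cmap c @` (dom c `&` dom c').

Definition transition c c' : 'rV[R]_n -> 'rV[R]_n := cmap c' \o cinv c.

Definition compatible c c' := smooth_on (overlap c c') (transition c c').

End Charts.

Record manifold (R : realType) (n : nat) (T : topologicalType) := Manifold {
  chart_index : Type;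
  atlas : chart_index -> chart R n T;
  atlas_cover : forall x, exists i, dom (atlas i) x;
  atlas_smooth : forall i j, compatible (atlas i) (atlas j)
}.

Arguments atlas {R n T} m i.

(* Second countability follows, as [T] is compact and locally Euclidean; the
   absence of boundary is built into charts. *)
Definition closed_manifold R n T (M : manifold R n T) : Prop :=
  hausdorff_space T /\ compact [set: T].

(* Some atlas of the smooth structure of [M] is oriented. *)
Definition orientable R n T (M : manifold R n T) : Prop :=
  exists A : set (chart R n T),
    [/\ forall x, exists2 c, A c & dom c x,
        forall c i, A c -> compatible c (atlas M i) /\ compatible (atlas M i) c &
        forall c c', A c -> A c' -> compatible c c' /\
          forall p, overlap c c' p -> 0 < \det ('J (transition c c') p)].

Section Tensors.
Context {R : realType} {n : nat} {T : topologicalType}.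
Variable M : manifold R n T.

(* A tensor field of type (0,2) or (1,1) is given by its components in the
   charts of the atlas, as matrices which depend on the coordinates:
   [h i p k l] is the component [h_kl], resp. [h^k_l], at the point of
   coordinates [p] in the chart [i].  The components are 0 off the image of the
   chart, so that equal tensors are equal functions. *)
Local Notation components := (chart_index M -> 'rV[R]_n -> 'M[R]_n).

(* The library's Jacobian acts on row vectors: [('J f p) k l] is the derivative
   of the [l]-th component of [f] in the [k]-th direction. *)
Definition jac i j p : 'M[R]_n := 'J (transition (atlas M i) (atlas M j)) p.

Record is_sym2 (h : components) : Prop := IsSym2 {
  sym2_smooth : forall i, smooth_on (coords (atlas M i)) (h i);
  sym2_sym : forall i p, (h i p)^T = h i p;
  sym2_tensor : forall i j p, overlap (atlas M i) (atlas M j) p ->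
    h i p = jac i j p *m
      h j (transition (atlas M i) (atlas M j) p) *m (jac i j p)^T;
  sym2_off : forall i p, ~ coords (atlas M i) p -> h i p = 0
}.

Record is_endomorphism (B : components) : Prop := IsEndomorphism {
  endo_smooth : forall i, smooth_on (coords (atlas M i)) (B i);
  endo_tensor : forall i j p, overlap (atlas M i) (atlas M j) p ->
    (jac i j p)^T *m B i p =
      B j (transition (atlas M i) (atlas M j) p) *m (jac i j p)^T;
  endo_off : forall i p, ~ coords (atlas M i) p -> B i p = 0
}.

Definition smooth_function (f : T -> R) : Prop :=
  forall i, smooth_on (coords (atlas M i)) (f \o cinv (atlas M i) : _ -> R^o).

Definition sym2_pred : {pred components} := fun h => `[< is_sym2 h >].

Record S2 := MkS2 { comp :> components; compP : comp \in sym2_pred }.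

HB.instance Definition _ := [isSub for comp].
HB.instance Definition _ := [Choice of S2 by <:].

Lemma S2_sym2 (h : S2) : is_sym2 h.
Proof. exact/asboolP/compP. Qed.

Lemma sym2_submod_closed : submod_closed sym2_pred.
Proof.
split.
  apply/asboolP; split=> [i k|i p|i j p _|//]; first exact: Ck_cst.
    exact: trmx0.
  by rewrite mulmx0 mul0mx.
move=> c h1 h2 /asboolP[s1 y1 t1 o1] /asboolP[s2 y2 t2 o2].
apply/asboolP; split.
- move=> i k; apply: CkD; last exact: s2.
  rewrite (_ : (c *: h1) i = (fun p => c%:M *m h1 i p)).
    by apply: Ck_mulmx; [exact: Ck_cst|exact: s1].
  by apply/funext => p; rewrite mul_scalar_mx.
- move=> i p; rewrite [(_ + _) i p]/(c *: h1 i p + h2 i p).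
  by rewrite linearP /= y1 y2.
- move=> i j p ijp; rewrite [(_ + _) i p]/(c *: h1 i p + h2 i p).
  rewrite [(_ + _) j _]/(c *: h1 j _ + h2 j _) mulmxDr mulmxDl.
  rewrite -scalemxAr -scalemxAl; by rewrite -t1// -t2.
- move=> i p ip; rewrite [LHS]/(c *: h1 i p + h2 i p).
  by rewrite o1// o2//; exact: etrans (addr0 _) (scaler0 _ _).
Qed.

HB.instance Definition _ :=
  GRing.isSubmodClosed.Build R components sym2_pred sym2_submod_closed.
HB.instance Definition _ := [SubChoice_isSubLmodule of S2 by <:].

End Tensors.


HB.instance Definition _ R n T (M : manifold R n T) :=
  isPointed.Build (S2 M) 0.

Definition partials (R : realType) (n : nat) (ks : seq 'I_n)
    (f : 'rV[R]_n -> 'M[R]_n) : 'rV[R]_n -> 'M[R]_n :=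
  foldr (fun k u p => 'D_(delta_mx 0 k) u p) f ks.

(* The C^oo topology: uniform convergence, on the compact subsets of the
   charts, of the components and of all their partial derivatives. *)
HB.instance Definition _ R n T (M : manifold R n T) :=
  Topological.copy (S2 M)
    (sup_topology (fun q : chart_index M * seq 'I_n => Topological.class
      (initial_topology (fun h : S2 M => partials q.2 (h q.1) :
        {family [set K | compact K /\ K `<=` coords (atlas M q.1)],
          'rV[R]_n -> 'M[R]_n})))).

Section Metrics.
Context {R : realType} {n : nat} {T : topologicalType} {M : manifold R n T}.
Local Notation components := (chart_index M -> 'rV[R]_n -> 'M[R]_n).

Definition metrics : set (S2 M) := [set g | forall i p,
  coords (atlas M i) p -> forall v : 'rV[R]_n, v != 0 ->
  0 < (v *m g i p *m v^T) 0 0].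

Definition raise (g a : components) : components :=
  fun i p => invmx (g i p) *m a i p.

Definition christoffel_comp (g a b : components) : components := fun i p =>
  let A := raise g a i p in let B := raise g b i p in
  - 2^-1 *: (a i p *m B + b i p *m A) +
  8^-1 *: (\tr A *: b i p + \tr B *: a i p).

Lemma overlap_coords i j p : overlap (atlas M i) (atlas M j) p ->
  coords (atlas M i) p /\
  coords (atlas M j) (transition (atlas M i) (atlas M j) p).
Proof.
move=> [x [xi xj] <-]; split; exists x => //=.
by rewrite /transition /= cmapK.
Qed.

Lemma metrics_unitmx (g : S2 M) i p :
  metrics g -> coords (atlas M i) p -> g i p \in unitmx.
Proof.
move=> gM ip; rewrite -row_free_unit; apply/inj_row_free => v vg0.
apply: contraTeq isT => v0.
by have := gM i p ip v v0; rewrite vg0 mul0mx mxE ltxx.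
Qed.

Lemma jac_unitmx (g : S2 M) i j p : metrics g ->
  overlap (atlas M i) (atlas M j) p -> jac (M := M) i j p \in unitmx.
Proof.
move=> gM ijp; have [ip _] := overlap_coords ijp.
have := metrics_unitmx gM ip; rewrite (sym2_tensor (S2_sym2 g) ijp).
by rewrite !unitmx_mul => /andP[/andP[]].
Qed.

Lemma raise_tensor (g a : S2 M) i j p : metrics g ->
  overlap (atlas M i) (atlas M j) p ->
  (jac i j p)^T *m raise g a i p =
    raise g a j (transition (atlas M i) (atlas M j) p) *m (jac i j p)^T.
Proof.
move=> gM ijp; have [ip jp] := overlap_coords ijp.
have Ju := jac_unitmx gM ijp.
have gi := metrics_unitmx gM ip; have gj := metrics_unitmx gM jp.
rewrite /raise; move: gi.
rewrite (sym2_tensor (S2_sym2 a) ijp) (sym2_tensor (S2_sym2 g) ijp) => gi.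
set J := jac i j p in Ju gi *; set gq := g j _ in gj gi *.
set aq := a j _.
apply: (can_inj (mulKmx gj)); apply: (can_inj (mulKmx Ju)).
rewrite !mulmxA mulmxV ?gi// mul1mx.
by rewrite -(mulmxA J gq) mulmxV// mulmx1.
Qed.

Lemma christoffel_comp_sym2 (g a b : S2 M) :
  metrics g -> is_sym2 (christoffel_comp g a b).
Proof.
move=> gM; have [sg yg tg og] := S2_sym2 g.
have [sa ya ta oa] := S2_sym2 a; have [sb yb tb ob] := S2_sym2 b.
have raise_smooth (c : S2 M) i k : Ck k (coords (atlas M i)) (raise g c i).
  apply: Ck_mulmx; last exact: sym2_smooth (S2_sym2 c) i k.
  by apply: Ck_invmx; [move=> p; exact: metrics_unitmx|exact: sg].
split.
- move=> i k; rewrite (_ : christoffel_comp g a b i = (fun p =>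
      - 2^-1 *: (a i p *m raise g b i p + b i p *m raise g a i p)) \+
      (fun p => 8^-1 *: (trace_mx (raise g a i p) *m b i p
                       + trace_mx (raise g b i p) *m a i p))); last first.
    by apply/funext => p; rewrite /= /trace_mx !mul_scalar_mx.
  by apply: CkD; apply: CkZ; apply: CkD; apply: Ck_mulmx;
    solve [exact: sa|exact: sb|exact: raise_smooth
          |apply: Ck_trace; exact: raise_smooth].
- move=> i p; rewrite /christoffel_comp /raise.
  rewrite !(linearD, linearZ) /= !(linearD, linearZ) /= !trmx_mul trmx_inv.
  rewrite yg ya yb -!mulmxA.
  congr (_ + _); first exact: addrC.
  by rewrite !scalerA ![8^-1 * _]mulrC.
- move=> i j p ijp; rewrite /christoffel_comp.
  have Ju := jac_unitmx gM ijp.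
  have trE (c : S2 M) : \tr (raise g c i p) =
      \tr (raise g c j (transition (atlas M i) (atlas M j) p)).
    have JTu : (jac i j p)^T \in unitmx by rewrite unitmx_tr.
    rewrite -[in RHS](mulmxK JTu (raise g c j _)) -raise_tensor//.
    by rewrite [RHS]mxtrace_mulC mulmxA mulVmx// mul1mx.
  rewrite !trE (ta _ _ _ ijp) (tb _ _ _ ijp).
  rewrite -!mulmxA !raise_tensor// !mulmxA.
  by rewrite !(mulmxDr, mulmxDl, =^~scalemxAr, =^~scalemxAl, mulmxA).
- move=> i p ip; rewrite /christoffel_comp oa// ob//.
  by rewrite !mul0mx !scaler0 !addr0 !scaler0 addr0.
Qed.

Definition christoffel_S2 (g a b : S2 M) (gM : metrics g) : S2 M :=
  MkS2 (asboolT (christoffel_comp_sym2 a b gM)).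

(* The zeroth order part of the connection, an element of [S2] when [g] is a
   metric; the value 0 at other [g] is never used. *)
Definition christoffel (g a b : S2 M) : S2 M :=
  if pselect (metrics g) is left gM then christoffel_S2 a b gM else 0.

Lemma christoffelE (g a b : S2 M) i p : metrics g ->
  christoffel g a b i p =
    - 2^-1 *: (a i p *m raise g b i p + b i p *m raise g a i p) +
    8^-1 *: (\tr (raise g a i p) *: b i p + \tr (raise g b i p) *: a i p).
Proof. by rewrite /christoffel => gM; case: pselect. Qed.

(* [dderiv b g a] is d_a b at g, a limit in the topology of [S2]. *)
Definition dderiv (E : lmodType R) (f : E -> S2 M) (x v : E) : S2 M :=
  lim (diff_quotient f x v @ 0^').

(* Vector fields on the open cone of metrics are functions on [S2], of which
   only the restriction to [metrics] matters. *)
Definition smooth_field (a : S2 M -> S2 M) : Prop := smooth_on metrics a.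

Definition nabla (a b : S2 M -> S2 M) : S2 M -> S2 M :=
  fun g => dderiv b g (a g) + christoffel g (a g) (b g).

Definition lie_bracket (a b : S2 M -> S2 M) : S2 M -> S2 M :=
  fun g => dderiv b g (a g) - dderiv a g (b g).

Definition curvature (a b c : S2 M -> S2 M) : S2 M -> S2 M := fun g =>
  nabla a (nabla b c) g - nabla b (nabla a c) g - nabla (lie_bracket a b) c g.

Definition velocity (gamma : R^o -> S2 M) (t : R^o) : S2 M :=
  dderiv gamma t 1.

(* Along a curve, the derivative of the velocity in the direction of the
   velocity is the second derivative. *)
Definition geodesic_on (J : set R) (gamma : R^o -> S2 M) : Prop :=
  [/\ smooth_on (J : set R^o) gamma,
      forall t, J t -> metrics (gamma t) &
      forall t, J t -> velocity (velocity gamma) t +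
        christoffel (gamma t) (velocity gamma t) (velocity gamma t) = 0].

End Metrics.

Definition commutator (R : realType) n (A B : 'M[R]_n) : 'M[R]_n :=
  A *m B - B *m A.

Definition mxexp (R : realType) n (A : 'M[R]_n) : 'M[R]_n :=
  limn (series (fun k => k`!%:R^-1 *: A ^+ k)).

Section ExplicitGeodesic.
Context {R : realType} {n : nat} {T : topologicalType} {M : manifold R n T}.
Variables (g : S2 M) (beta : T -> R)
  (B : chart_index M -> 'rV[R]_n -> 'M[R]_n).

Definition initial_direction i p : 'M[R]_n :=
  (4 * beta (cinv (atlas M i) p) / n%:R)%:M + B i p.

Definition geodesic_formula (t : R) i p : 'M[R]_n :=
  let b := beta (cinv (atlas M i) p) in
  if b == 0 then g i p *m mxexp (t *: B i p)
  else (b * t + 1) `^ (4 / n%:R) *: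
    (g i p *m mxexp ((b^-1 * ln (b * t + 1)) *: B i p)).

Definition geodesic_domain : set R := [set t | forall x, 0 < beta x * t + 1].

Definition geodesic_from (J : set R) (gamma : R^o -> S2 M) : Prop :=
  [/\ geodesic_on J gamma, gamma 0 = g &
      forall i p, velocity gamma 0 i p = g i p *m initial_direction i p].

End ExplicitGeodesic.

(* Main.v *)
Require Import Defs.
From HB Require Import structures.
From mathcomp Require Import all_boot all_order all_algebra.
From mathcomp Require Import all_classical all_reals all_analysis.
From mathcomp Require Import ring lra.
Set Implicit Arguments.
Unset Strict Implicit.
Unset Printing Implicit Defensive.
Import Order.TTheory GRing.Theory Num.Theory.
Import numFieldNormedType.Exports.
Local Open Scope classical_set_scope.
Local Open Scope ring_scope.

(** Write [A = g^-1 a] for the endomorphism of a 2-form [a].  The zeroth order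
    part of the connection is [g Gamma(A, B)] with
    [Gamma(A, B) = - (A B + B A) / 2 + (tr A B + tr B A) / 8], which involves no
    derivative along the manifold; this is what makes both parts pointwise.

    Curvature.  In [R(a, b) c] the second derivatives of [c] cancel by symmetry,
    and so do the first derivatives of the fields, those of [a] and [b] against the
    bracket.
    What remains is [d Gamma] alternated in [a] and [b], plus the commutator of
    [Gamma(A, .)] and [Gamma(B, .)].  The derivative of [Gamma] comes from
    [d (g^-1) = - g^-1 a g^-1], so the claim is an identity between
    noncommutative polynomials with traces ([curvature_endo]).  The analysis
    consists in justifying these derivatives in the topology of [S2].  That
    topology is described by [S2_cvgP]: maps into [S2] converge if and only if
    all partial derivatives of the components converge jointly in the parameter
    and the point.  With it, the mean value theorem gives joint convergence of
    the difference quotients of C^1 maps ([C1_cvg_S2]), hence additivity of the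
    derivative, symmetry of the second one, and the chain rule in
    [nabla_quotient_cvg].  Compactness of the manifold enters through
    [metrics_open].

    Geodesics.  At a point of the manifold the geodesic equation is
    [x'' = x' x^-1 x' - tr (x^-1 x') x' / 4] for a curve [x] of matrices, so
    [W = x^-1 x'] satisfies [W' = - tr W W / 4].  Its trace [tau] solves the
    Riccati equation [tau' = - tau^2 / 4], whose solution with [tau(0) = 4 b] is
    [4 b / (1 + b t)]; then [(1 + b t) W] is constant, and [x' = x W] integrates
    to an exponential.  This computation gives uniqueness ([flow_uniq]) and shows
    that the formula solves the equation ([flow_geodesic]).  For existence the
    pointwise solutions must form a smooth curve in [S2].  The cases
    [beta = 0] and [beta <> 0] of the formula are therefore expressed by one
    function which is smooth in [beta] and [t] ([log_time]), and
    [joint_field_smooth] turns smoothness in time and place together into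
    smoothness of the curve.  Positivity holds because [x] is congruent to [g] up
    to a positive factor ([flow_posdef]). *)

(** * Smoothness of the matrix exponential *)

Section MatrixExponential.
Context {R : realType}.

Lemma norm_entry m n (A : 'M[R]_(m, n)) i j : `|A i j| <= `|A|.
Proof.
rewrite [leRHS]mx_normrE.
by apply/bigmax_geP; right => /=; exists (i, j).
Qed.

Lemma norm_mx_le m n (A : 'M[R]_(m, n)) (x : R) : 0 <= x ->
  (forall i j, `|A i j| <= x) -> `|A| <= x.
Proof.
move=> x0 Ax; rewrite [leLHS]mx_normrE.
by apply/bigmax_leP; split => //= i _; exact: Ax.
Qed.

Lemma norm_mulmx m n p (A : 'M[R]_(m, n)) (B : 'M[R]_(n, p)) :
  `|A *m B| <= n%:R * `|A| * `|B|.
Proof.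
apply: norm_mx_le => [|i j]; first by rewrite !mulr_ge0.
rewrite mxE (le_trans (ler_norm_sum _ _ _))//.
rewrite (le_trans (ler_sum (G := fun=> `|A| * `|B|) _ _))//.
  by move=> k _; rewrite normrM ler_pM// norm_entry.
by rewrite sumr_const card_ord -[leLHS]mulr_natl mulrA.
Qed.

Lemma expmxS n (A : 'M[R]_n) k : A ^+ k.+1 = A *m A ^+ k.
Proof. exact: exprS. Qed.

Lemma norm_expmx n (A : 'M[R]_n) k : `|A ^+ k| <= (n%:R * `|A|) ^+ k.
Proof.
elim: k => [|k IHk].
  rewrite !expr0; apply: norm_mx_le => // i j; rewrite mxE.
  by case: eqP; rewrite ?normr1// normr0.
by rewrite !exprS (le_trans (norm_mulmx _ _))// ler_wpM2l// mulr_ge0.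
Qed.

Definition exp_term n (A : 'M[R]_n) k : 'M[R]_n := k`!%:R^-1 *: A ^+ k.

Lemma sum_exp_coeff_le (x : R) N : 0 <= x ->
  \sum_(0 <= k < N) k`!%:R^-1 * x ^+ k <= expR x.
Proof.
move=> x0; rewrite (eq_bigr (exp_coeff x)); last first.
  by move=> k _; rewrite /exp_coeff /= mulrC.
apply: (@nondecreasing_cvgn_le R (series (exp_coeff x))).
  by apply: nondecreasing_series => k _ _; exact: exp_coeff_ge0.
exact: is_cvg_series_exp_coeff.
Qed.

Lemma mxexp_cvg n (A : 'M[R]_n) : series (exp_term A) @ \oo --> mxexp A.
Proof.
suff : cvgn (series (exp_term A)) by [].
apply: normed_cvg; apply: nondecreasing_is_cvgn.
  by apply: nondecreasing_series => k _ _; exact: normr_ge0.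
exists (expR (n%:R * `|A|)) => _ [N _ <-].
apply: le_trans (sum_exp_coeff_le N _); last by rewrite mulr_ge0.
apply: ler_sum => k _ /=; rewrite normrZ ger0_norm// ler_wpM2l//.
exact: norm_expmx.
Qed.

Lemma mxexp_uniq n (A L : 'M[R]_n) : series (exp_term A) @ \oo --> L ->
  mxexp A = L.
Proof. by move=> AL; apply: norm_cvg_unique AL; exact: mxexp_cvg. Qed.

(** By telescoping [A^(k+1) - B^(k+1) = A (A^k - B^k) + (A - B) B^k]. *)
Lemma norm_expmxB n (A B : 'M[R]_n) (r : R) k :
  n%:R * `|A| <= r -> n%:R * `|B| <= r ->
  `|A ^+ k.+1 - B ^+ k.+1| <= k.+1%:R * (n%:R * `|A - B|) * r ^+ k.
Proof.
move=> Ar Br.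
have nB0 : 0 <= n%:R * `|A - B| by rewrite mulr_ge0.
have r0 : 0 <= r by rewrite (le_trans _ Ar)// mulr_ge0.
case: n A B Ar Br nB0 => [|n] A B Ar Br nB0.
  rewrite [_ - _]flatmx0 normr0 mul0r mulr0 mul0r //.
elim: k => [|k IHk].
  by rewrite !expr1 expr0 mulr1 mul1r ler_peMl// ler1n.
have -> : A ^+ k.+2 - B ^+ k.+2 =
    A *m (A ^+ k.+1 - B ^+ k.+1) + (A - B) *m B ^+ k.+1.
  by rewrite mulmxBr mulmxBl addrA subrK -!expmxS.
rewrite (le_trans (ler_normD _ _))// -(natr1 k.+1) mulrDl mulrDl lerD//.
  rewrite (le_trans (norm_mulmx _ _))// (exprS r) mulrCA ler_pM// ?mulr_ge0.
rewrite (le_trans (norm_mulmx _ _))// mul1r ler_wpM2l//.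
rewrite (le_trans (norm_expmx _ _))// lerXn2r// nnegrE// mulr_ge0.
Qed.

(** The estimate of [norm_expmxB], summed over the exponential series, bounds the
    Lipschitz constant of the exponential on each ball. *)
Lemma norm_mxexpB n (A B : 'M[R]_n) (r : R) :
  n%:R * `|A| <= r -> n%:R * `|B| <= r ->
  `|mxexp A - mxexp B| <= n%:R * `|A - B| * expR r.
Proof.
move=> Ar Br.
have r0 : 0 <= r by rewrite (le_trans _ Ar)// mulr_ge0.
have AB : series (exp_term A) N - series (exp_term B) N @[N --> \oo]
    --> mxexp A - mxexp B by apply: cvgB; exact: mxexp_cvg.
have /cvg_norm nAB := AB.
rewrite -(cvg_lim _ nAB)//; apply: limr_le; first by apply/cvg_ex; eexists; exact: nAB.
apply: nearW => N; rewrite -sumrB; case: N => [|N].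
  by rewrite big_geq// normr0 mulr_ge0// ?mulr_ge0// expR_ge0.
rewrite big_nat_recl// [X in X + _](_ : _ = 0) ?add0r; last first.
  by rewrite /exp_term !expr0 subrr.
rewrite (le_trans (ler_norm_sum _ _ _))//.
apply: (@le_trans _ _ (\sum_(0 <= k < N) n%:R * `|A - B| * (k`!%:R^-1 * r ^+ k))).
  apply: ler_sum => k _; rewrite /exp_term -scalerBr normrZ ger0_norm//.
  rewrite (le_trans (ler_wpM2l _ (norm_expmxB k Ar Br)))//.
  rewrite factS natrM invfM.
  have k0 : 1 + k%:R != 0 :> R by rewrite nat1r pnatr_eq0.
  rewrite le_eqVlt; apply/orP; left; apply/eqP.
  have f0 : k`!%:R != 0 :> R by rewrite pnatr_eq0 -lt0n fact_gt0.
  by field; rewrite f0 k0.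
rewrite -mulr_sumr ler_wpM2l ?mulr_ge0//; exact: sum_exp_coeff_le.
Qed.

Lemma continuous_mxexp n : continuous (@mxexp R n).
Proof.
move=> A; have FA : Filter (nbhs A) := nbhs_filter A.
apply/(@cvgrPdist_lt R _ _ (nbhs A) FA) => e e0.
pose r := n%:R * (`|A| + 1).
have r1 : n%:R * `|A| <= r by rewrite ler_wpM2l// lerDl.
near=> B.
have Br : n%:R * `|B| <= r.
  rewrite ler_wpM2l// -(subrK A B) (le_trans (ler_normD _ _))// addrC lerD2l.
  rewrite distrC ltW//; near: B; apply: cvgr_dist_lt => //; exact: cvg_id.
rewrite (le_lt_trans (norm_mxexpB r1 Br))//.
have K0 : 0 < n%:R * expR r + 1.
  by rewrite ltr_wpDl// mulr_ge0// expR_ge0.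
have ABd : `|A - B| < e / (n%:R * expR r + 1).
  near: B; apply: cvgr_dist_lt; [exact: cvg_id|exact: divr_gt0].
rewrite ltr_pdivlMr// in ABd; apply: le_lt_trans ABd.
rewrite mulrAC mulrC ler_wpM2l// lerDl//.
Unshelve. all: by end_near. Qed.

Definition ur_incl n : 'M[R]_(n, n + n) := row_mx 1%:M 0.
Definition ur_proj n : 'M[R]_(n + n, n) := col_mx 0 1%:M.

Lemma ursubmxE n (A : 'M[R]_(n + n)) :
  ursubmx A = ur_incl n *m A *m ur_proj n.
Proof.
rewrite -{2}[A]submxK /ur_incl /ur_proj mul_row_block mul_row_col.
by rewrite !mul1mx !mul0mx !addr0 mulmx0 add0r mulmx1.
Qed.

(** The upper right block of the exponential of this matrix is the divided
    difference of the exponential between [X] and [Y] in the direction [V]; at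
    [Y = X] it is the derivative at [X] in the direction [V]. *)
Definition upper_block n (X V Y : 'M[R]_n) : 'M[R]_(n + n) := block_mx X V 0 Y.

Lemma upper_blockE n (X V Y : 'M[R]_n) : upper_block X V Y =
  (ur_incl n)^T *m X *m ur_incl n + (ur_incl n)^T *m V *m (ur_proj n)^T
  + ur_proj n *m Y *m (ur_proj n)^T.
Proof.
rewrite /upper_block /ur_incl /ur_proj !tr_row_mx !tr_col_mx !trmx1 !trmx0.
rewrite -!mulmxA (mul_mx_row X) (mul_mx_row V) (mul_mx_row Y) !mul_col_row !mul1mx !mul0mx !mulmx1 !mulmx0.
by rewrite !add_block_mx !addr0 !add0r.
Qed.

(** The upper right block of a power of [upper_block X V Y], which is
    [X^(k-1) V + X^(k-2) V Y + ... + V Y^(k-1)]. *)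
Fixpoint ur_power n (X V Y : 'M[R]_n) k : 'M[R]_n :=
  if k is k'.+1 then X *m ur_power X V Y k' + V *m Y ^+ k' else 0.

Lemma upper_blockX n (X V Y : 'M[R]_n) k :
  upper_block X V Y ^+ k = upper_block (X ^+ k) (ur_power X V Y k) (Y ^+ k).
Proof.
elim: k => [|k IHk]; first by rewrite !expr0 /= /upper_block -scalar_mx_block.
rewrite !expmxS IHk /upper_block mulmx_block !mulmx0 !mul0mx !addr0 add0r.
by [].
Qed.

Lemma ur_power_diff n (X V Y : 'M[R]_n) (h : R) k : h *: V = Y - X ->
  h *: ur_power X V Y k = Y ^+ k - X ^+ k.
Proof.
move=> hV; elim: k => [|k IHk]; first by rewrite /= scaler0 !expr0 subrr.
rewrite /= scalerDr scalemxAr scalemxAl IHk hV mulmxBr mulmxBl -!expmxS.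
by rewrite addrC addrA subrK.
Qed.

Lemma ursubmx_mxexp_cvg n (X V Y : 'M[R]_n) :
  series (fun k => k`!%:R^-1 *: ur_power X V Y k) @ \oo -->
    ursubmx (mxexp (upper_block X V Y)).
Proof.
rewrite ursubmxE; set L := ur_incl n; set P := ur_proj n.
have : L *m series (exp_term (upper_block X V Y)) N *m P @[N --> \oo] -->
    L *m mxexp (upper_block X V Y) *m P.
  by apply: cvg_mulmx; [apply: cvg_mulmx; [exact: cvg_cst|exact: mxexp_cvg]
                       |exact: cvg_cst].
apply: cvg_trans; apply: near_eq_cvg; apply: nearW => N; rewrite /series /=.
rewrite mulmx_sumr mulmx_suml; apply: eq_bigr => k _.
by rewrite /exp_term upper_blockX -scalemxAr -scalemxAl -ursubmxE block_mxKur.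
Qed.

Lemma ursubmx_mxexp_diff n (X V Y : 'M[R]_n) (h : R) : h *: V = Y - X ->
  h *: ursubmx (mxexp (upper_block X V Y)) = mxexp Y - mxexp X.
Proof.
move=> hV.
have YX : series (exp_term Y) N - series (exp_term X) N @[N --> \oo]
    --> mxexp Y - mxexp X by apply: cvgB; exact: mxexp_cvg.
apply: norm_cvg_unique YX; have := @ursubmx_mxexp_cvg _ X V Y.
move/(cvgZl_tmp (k := h)); apply: cvg_trans; apply: near_eq_cvg.
apply: nearW => N; rewrite /series /= scaler_sumr -sumrB.
by apply: eq_bigr => k _; rewrite -scalerBr -(ur_power_diff _ hV) !scalerA mulrC.
Qed.

Lemma cvg_upper_block (T : Type) (F : set_system T) {FF : Filter F} n
    (f g e : T -> 'M[R]_n) (X V Y : 'M[R]_n) :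
  f @ F --> X -> g @ F --> V -> e @ F --> Y ->
  upper_block (f x) (g x) (e x) @[x --> F] --> upper_block X V Y.
Proof.
move=> fX gV eY; rewrite upper_blockE; under eq_fun do rewrite upper_blockE.
have cvg_sandwich m (P : 'M[R]_(m, n)) (Q : 'M[R]_(n, m)) (u : T -> 'M[R]_n) W :
    u @ F --> W -> P *m u x *m Q @[x --> F] --> P *m W *m Q.
  by move=> uW; apply: cvg_mulmx; [apply: cvg_mulmx => //; exact: cvg_cst|exact: cvg_cst].
by apply: cvgD; [apply: cvgD|]; exact: cvg_sandwich.
Qed.

Lemma cvg_ursubmx (T : Type) (F : set_system T) {FF : Filter F} n
    (f : T -> 'M[R]_(n + n)) (A : 'M[R]_(n + n)) :
  f @ F --> A -> ursubmx (f x) @[x --> F] --> ursubmx A.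
Proof.
move=> fA; rewrite ursubmxE; under eq_fun do rewrite ursubmxE.
by apply: cvg_mulmx; [apply: cvg_mulmx => //; exact: cvg_cst|exact: cvg_cst].
Qed.

Lemma cvg_mxexp (T : Type) (F : set_system T) {FF : Filter F} n
    (f : T -> 'M[R]_n) (A : 'M[R]_n) :
  f @ F --> A -> mxexp (f x) @[x --> F] --> mxexp A.
Proof. by move=> fA; apply: cvg_comp fA _; exact: continuous_mxexp. Qed.

(** By [ursubmx_mxexp_diff] the difference quotient of the exponential is itself a
    block of an exponential, so the limit only needs continuity. *)
Lemma mxexp_diff_quotient (E : lmodType R) n (f : E -> 'M[R]_n) (x v : E) (l : 'M[R]_n) :
  diff_quotient f x v @ 0^' --> l ->
  diff_quotient (fun y => mxexp (f y)) x v @ 0^' -->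
    ursubmx (mxexp (upper_block (f x) l (f x))).
Proof.
move=> fl; apply: (cvg_trans (G := ursubmx (mxexp (upper_block (f x)
   (diff_quotient f x v h) (f (h *: v + x)))) @[h --> 0^'])); last first.
  apply: cvg_ursubmx; apply: cvg_mxexp; apply: cvg_upper_block => //.
    exact: cvg_cst.
  exact: cvg_line fl.
apply: near_eq_cvg; near=> h.
have h0 : h != 0 by near: h; exact: nbhs_dnbhs_neq.
rewrite {2}/diff_quotient.
rewrite -(@ursubmx_mxexp_diff _ (f x) (diff_quotient f x v h) _ h).
  by rewrite scalerA mulVf// scale1r.
by rewrite scalerA divff// scale1r.
Unshelve. all: by end_near. Qed.

(** The derivative of [mxexp (f x)] is a block of the exponential of a larger
    matrix, built linearly from [f] and its derivative.  An induction on [k], for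
    matrices of all sizes, therefore needs no other input than continuity. *)
Lemma Ck_mxexp k (E : preTopologicalLmodType R) n (U : set E) (f : E -> 'M[R]_n) :
  Ck k U f -> Ck k U (fun x => mxexp (f x)).
Proof.
elim: k E n U f => [|k IHk] E n U f fk.
  split; last exact: I.
  by move=> x Ux; apply: (@cvg_mxexp _ (nbhs x)); exact: (Ck_continuous fk Ux).
have fst_f := Ck_fst (CkS fk).
split=> [x Ux|].
  by apply: (@cvg_mxexp _ (nbhs x)); exact: (Ck_continuous fk Ux).
case: fk => fc [df [fdf dfk]].
exists (fun z => ursubmx (mxexp (upper_block (f z.1) (df z) (f z.1)))); split.
  by move=> x v Ux; apply: mxexp_diff_quotient; exact: fdf.
rewrite (_ : (fun z => _) = (fun z => ur_incl n *m
    mxexp (upper_block (f z.1) (df z) (f z.1)) *m ur_proj n)); last first.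
  by apply/funext => z; rewrite ursubmxE.
apply: Ck_mulmx; last exact: Ck_cst.
apply: Ck_mulmx; first exact: Ck_cst.
apply: IHk; rewrite (_ : (fun z => _) = (((fun z => (ur_incl n)^T *m f z.1 *m ur_incl n)
   \+ (fun z => (ur_incl n)^T *m df z *m (ur_proj n)^T))
  \+ (fun z => ur_proj n *m f z.1 *m (ur_proj n)^T))); last first.
  by apply/funext => z; rewrite upper_blockE.
by apply: CkD; [apply: CkD|]; apply: Ck_mulmx; solve
  [exact: Ck_cst|apply: Ck_mulmx => //; exact: Ck_cst].
Qed.

End MatrixExponential.

(** * Derivatives along a line and one-parameter groups *)

Section LineDerivatives.
Context {R : realType}.

Lemma cvg_rw (X : Type) (V : topologicalType) (F : set_system X) {FF : Filter F}
    (f g : X -> V) (a b : V) :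
  f @ F --> a -> f =1 g -> a = b -> g @ F --> b.
Proof. by move=> fa /funext <- <-. Qed.

Lemma diff_quotient_cst (E V : lmodType R) (c : V) (x v : E) :
  diff_quotient (fun _ : E => c) x v = cst 0.
Proof. by apply/funext => h; rewrite /diff_quotient subrr scaler0. Qed.

Lemma diff_quotient_mulmx (E : lmodType R) m n p (f : E -> 'M[R]_(m, n))
    (g : E -> 'M[R]_(n, p)) x v
    (df : 'M[R]_(m, n)) (dg : 'M[R]_(n, p)) :
  diff_quotient f x v @ 0^' --> df -> diff_quotient g x v @ 0^' --> dg ->
  diff_quotient (fun y => f y *m g y) x v @ 0^' --> df *m g x + f x *m dg.
Proof.
move=> fdf gdg; apply: (cvg_trans (G := diff_quotient f x v h *m g (h *: v + x)
    + f x *m diff_quotient g x v h @[h --> 0^'])); last first.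
  apply: cvgD; apply: cvg_mulmx; [exact: fdf| |exact: cvg_cst|exact: gdg].
  exact: cvg_line gdg.
apply: near_eq_cvg; near=> h.
rewrite /diff_quotient -scalemxAl -scalemxAr -scalerDr mulmxBl mulmxBr.
by rewrite addrA subrK.
Unshelve. all: by end_near. Qed.

Lemma is_derive_diff_quotient (V : normedModType R) (f : R^o -> V) (t : R) (l : V) :
  diff_quotient f t 1 @ 0^' --> l -> is_derive t (1 : R^o) f l.
Proof.
move=> fl; apply: DeriveDef; first by apply/cvg_ex; exists l.
exact: (cvg_lim _ fl).
Qed.

Lemma diff_quotient_is_derive (V : normedModType R) (f : R^o -> V) (t : R) (l : V) :
  is_derive t (1 : R^o) f l -> diff_quotient f t 1 @ 0^' --> l.
Proof. by case=> fd <-; exact: fd. Qed.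

Lemma diff_quotient_entry (E : lmodType R) m n (f : E -> 'M[R]_(m, n)) x v
    (l : 'M[R]_(m, n)) i j :
  diff_quotient f x v @ 0^' --> l ->
  diff_quotient (fun y => f y i j : R^o) x v @ 0^' --> l i j.
Proof.
move=> fl; apply: (cvg_rw (cvg_coord (i := i) (j := j) fl)) => // h.
by rewrite /diff_quotient !mxE.
Qed.

Lemma mean_value_interval (J : set R) (f df : R^o -> R^o) a b :
  is_interval J -> J a -> J b ->
  (forall t, J t -> diff_quotient f t 1 @ 0^' --> df t) ->
  exists2 c, (a <= c <= b) || (b <= c <= a) & f b - f a = df c * (b - a).
Proof.
move=> Jint Ja Jb fdf.
wlog ab : a b Ja Jb / a <= b => [wlg|].
  have [|/ltW] := leP a b => ab; first exact: wlg.
  have [c cab E] := wlg b a Jb Ja ab; exists c; first by rewrite orbC.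
  by rewrite -opprB E -[b - a]opprB mulrN.
have Jab t : t \in `[a, b] -> J t.
  by rewrite in_itv /= => abt; exact: (Jint a b).
have fd t : t \in `[a, b] -> is_derive t (1 : R) f (df t).
  by move=> /Jab Jt; apply: is_derive_diff_quotient; exact: fdf.
have fd' t : t \in `]a, b[ -> is_derive t (1 : R) f (df t).
  by move=> tab; apply: fd; exact: subset_itv_oo_cc tab.
have fc : {within `[a, b], continuous f}.
  by apply: derivable_within_continuous => t tab; have [] := fd t tab.
have [c cab ->] := MVT_segment ab fd' fc; exists c => //.
by move: cab; rewrite in_itv /= => ->.
Qed.

Lemma derive0_cst (J : set R) m n (f : R^o -> 'M[R]_(m, n)) a b :
  is_interval J -> J a -> J b ->
  (forall t, J t -> diff_quotient f t 1 @ 0^' --> (0 : 'M[R]_(m, n))) ->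
  f a = f b.
Proof.
move=> Jint Ja Jb f0; apply/matrixP => i j; apply/eqP; rewrite eq_sym -subr_eq0.
have fd t : J t -> diff_quotient (fun y => f y i j : R^o) t 1 @ 0^' --> (0 : R^o).
  by move=> Jt; have := diff_quotient_entry (i := i) (j := j) (f0 t Jt); rewrite mxE.
by have [c _ ->] := mean_value_interval (df := fun=> 0) Jint Ja Jb fd; rewrite mul0r.
Qed.

End LineDerivatives.

Section ExponentialAlgebra.
Context {R : realType}.

Lemma expmx_intertwine m n (P : 'M[R]_(m, n)) (X : 'M[R]_n) (Y : 'M[R]_m) k :
  P *m X = Y *m P -> P *m X ^+ k = Y ^+ k *m P.
Proof.
move=> PX; elim: k => [|k IHk]; first by rewrite !expr0 mulmx1 mul1mx.
by rewrite (expmxS X) (expmxS Y) mulmxA PX -mulmxA IHk mulmxA.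
Qed.

(** Transports an exponential through a change of coordinates, or from an
    endomorphism to its transpose. *)
Lemma mxexp_intertwine m n (P : 'M[R]_(m, n)) (X : 'M[R]_n) (Y : 'M[R]_m) :
  P *m X = Y *m P -> P *m mxexp X = mxexp Y *m P.
Proof.
move=> PX; have YP : series (exp_term Y) N *m P @[N --> \oo] --> mxexp Y *m P.
  by apply: cvg_mulmx; [exact: mxexp_cvg|exact: cvg_cst].
apply: norm_cvg_unique YP; apply: (cvg_trans (G := P *m series (exp_term X) N @[N --> \oo])).
  apply: near_eq_cvg; apply: nearW => N; rewrite /series /= mulmx_sumr mulmx_suml.
  apply: eq_bigr => k _; rewrite /exp_term -scalemxAl -scalemxAr; congr (_ *: _).
  exact: expmx_intertwine.
by apply: cvg_mulmx; [exact: cvg_cst|exact: mxexp_cvg].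
Qed.

Lemma mxexp0 n : mxexp (0 : 'M[R]_n) = 1%:M.
Proof.
apply: mxexp_uniq; apply: (cvg_trans (G := (1%:M : 'M[R]_n) @[N --> \oo])); last exact: cvg_cst.
apply: near_eq_cvg; near=> N.
have N0 : (0 < N)%N by near: N; exists 1%N.
rewrite -(prednK N0); rewrite /series /= big_nat_recl// big1_seq => [|k _].
  by rewrite /exp_term expr0 fact0 invr1 scale1r addr0.
by rewrite /exp_term expmxS mul0mx scaler0.
Unshelve. all: by end_near. Qed.

Lemma mxexp_tr n (X : 'M[R]_n) : (mxexp X)^T = mxexp X^T.
Proof.
apply/esym/mxexp_uniq.
apply: (cvg_trans (G := (series (exp_term X) N)^T @[N --> \oo])).
  apply: near_eq_cvg; apply: nearW => N; rewrite /series /= linear_sum.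
  apply: eq_bigr => k _; rewrite /exp_term linearZ /=; congr (_ *: _).
  elim: k => [|k IHk]; first by rewrite !expr0 trmx1.
  by rewrite expmxS trmx_mul IHk [RHS]exprSr.
apply: cvg_mx => i j; under eq_fun do rewrite mxE; rewrite mxE.
exact: cvg_coord (@mxexp_cvg _ _ X).
Qed.

(** When [V] commutes with [X], the upper right block of the [k]-th power is
    [k X^(k-1) V], and the block of the exponential is the usual derivative. *)
Lemma ursubmx_mxexp_comm n (X V : 'M[R]_n) : V *m X = X *m V ->
  ursubmx (mxexp (upper_block X V X)) = V *m mxexp X.
Proof.
move=> VX; have := @ursubmx_mxexp_cvg _ _ X V X.
rewrite -(cvg_shiftS (series _)) => S; apply: norm_cvg_unique S _.
apply: (cvg_trans (G := V *m series (exp_term X) N @[N --> \oo])); last first.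
  by apply: cvg_mulmx; [exact: cvg_cst|exact: mxexp_cvg].
have urE k : ur_power X V X k.+1 = k.+1%:R *: (V *m X ^+ k).
  elim: k => [|k IHk]; first by rewrite /= mulmx0 add0r scale1r.
  rewrite [LHS]/(_ *m ur_power X V X k.+1 + _) IHk -scalemxAr mulmxA -VX -mulmxA -expmxS.
  by rewrite -(natr1 k.+1) scalerDl scale1r.
apply: near_eq_cvg; apply: nearW => N; rewrite /series /= big_nat_recl//= scaler0 add0r.
rewrite mulmx_sumr; apply: eq_bigr => k _.
rewrite /exp_term -[X *m ur_power X V X k + _]/(ur_power X V X k.+1) urE scalerA -scalemxAr; congr (_ *: _).
rewrite factS natrM invfM mulrC mulrA mulfV ?mul1r// pnatr_eq0//.
Qed.

Lemma mxexp_line_diff n (A : 'M[R]_n) (f : R^o -> R^o) (t : R) (l : R) :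
  diff_quotient f t 1 @ 0^' --> (l : R^o) ->
  diff_quotient (fun s => mxexp (f s *: A)) t 1 @ 0^' -->
    l *: (A *m mxexp (f t *: A)).
Proof.
move=> fl.
have fA : diff_quotient (fun s : R^o => f s *: A) t 1 @ 0^' --> l *: A.
  apply: cvg_trans (cvgZr_tmp (a := A) fl); apply: near_eq_cvg; apply: nearW => h.
  by rewrite /diff_quotient -scalerBl scalerA.
apply: (cvg_rw (mxexp_diff_quotient fA)) => //; rewrite ursubmx_mxexp_comm.
  by rewrite -scalemxAl.
by rewrite -!scalemxAl -!scalemxAr !scalerA mulrC.
Qed.

Lemma diff_quotient_lin (c t : R) :
  diff_quotient (fun s : R^o => c * s : R^o) t 1 @ 0^' --> (c : R^o).
Proof.
apply: cvg_trans (@cvg_cst _ (c : R^o) _ 0^' _); apply: near_eq_cvg; near=> h.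
have h0 : h != 0 by near: h; exact: nbhs_dnbhs_neq.
rewrite /diff_quotient -mulrBr addrK /GRing.scale /= mulr1 mulrCA mulVf ?mulr1//.
Unshelve. all: by end_near. Qed.

Lemma mxexpN n (A : 'M[R]_n) : mxexp (- A) *m mxexp A = 1%:M.
Proof.
pose f (s : R^o) := mxexp ((-1 * s) *: A) *m mxexp ((1 * s) *: A).
have : f 0 = f 1.
  apply: (@derive0_cst R setT) => // t _.
  apply: (cvg_rw (diff_quotient_mulmx (mxexp_line_diff (A := A) (@diff_quotient_lin (-1) t))
    (mxexp_line_diff (A := A) (@diff_quotient_lin 1 t)))) => //.
  rewrite scaleN1r scale1r mulNmx mulmxA.
  rewrite (@mxexp_intertwine _ _ A ((-1 * t) *: A) ((-1 * t) *: A)) ?addNr//.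
  by rewrite -scalemxAr -scalemxAl.
by rewrite /f !mulr0 !scale0r mxexp0 mul1mx !mulr1 scaleN1r scale1r.
Qed.

Lemma mxexp_unit n (A : 'M[R]_n) : mxexp A \in unitmx.
Proof. by have [] := mulmx1_unit (mxexpN A). Qed.

Lemma invmx_mxexp n (A : 'M[R]_n) : invmx (mxexp A) = mxexp (- A).
Proof.
by rewrite -[RHS](mulmxK (mxexp_unit A)) mxexpN mul1mx.
Qed.

Lemma mxexp_double n (A : 'M[R]_n) : mxexp (2 *: A) = mxexp A *m mxexp A.
Proof.
pose e (c : R) (s : R^o) : 'M[R]_n := mxexp ((c * s) *: A).
(* [exp (- 2 s A) (exp (s A))^2] is constant. *)
pose f (s : R^o) := e (-2) s *m (e 1 s *m e 1 s).
have eA c s : A *m e c s = e c s *m A.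
  by apply: mxexp_intertwine; rewrite -scalemxAr -scalemxAl.
have : f 0 = f 1.
  apply: (@derive0_cst R setT) => // t _.
  have de c : diff_quotient (e c) t 1 @ 0^' --> c *: (A *m e c t).
    exact: mxexp_line_diff (@diff_quotient_lin c t).
  apply: (cvg_rw (diff_quotient_mulmx (de (-2)) (diff_quotient_mulmx (de 1) (de 1)))) => //.
  move: (e (-2) t) (e 1 t) (eA (-2) t) (eA 1 t) => X Y AX AY.
  rewrite scaleNr scale1r scaler_nat mulNmx mulr2n mulmxDl (mulmxA Y A Y) -AY.
  by rewrite mulmxDr !mulmxA -AX addNr.
rewrite /f /e !mulr0 !scale0r mxexp0 !mul1mx !mulr1 scale1r scaleNr => /esym H.
by rewrite -[RHS](mulKmx (mxexp_unit (- (2 *: A)))) H mulmx1 invmx_mxexp opprK.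
Qed.

End ExponentialAlgebra.

(** * Maps of class C^k and locally uniform convergence *)

(** An alias of [E * F], as [tangent] is of [E * E], which is a topological module
    for all topological modules [E] and [F], locally convex or not. *)
Definition space_prod (R : realType) (E F : preTopologicalLmodType R) : Type :=
  (E * F)%type.

HB.instance Definition _ (R : realType) (E F : preTopologicalLmodType R) :=
  Topological.copy (space_prod E F) (E * F)%type.
HB.instance Definition _ (R : realType) (E F : preTopologicalLmodType R) :=
  GRing.Lmodule.copy (space_prod E F) (E * F)%type.

Section TopologicalProduct.
Context {R : realType} (E F : topologicalLmodType R).
Local Notation P := (space_prod E F).

Lemma space_prod_add_continuous : continuous (fun z : P * P => z.1 + z.2).
Proof.
move=> z; have coord_add (V : topologicalLmodType R) (f : P -> V) : continuous f ->
    (forall x y, f (x + y) = f x + f y) ->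
    {for z, continuous (fun z : P * P => f (z.1 + z.2))}.
  move=> fc fD; have fz : (fun z => (f z.1, f z.2)) @ z --> (f z.1, f z.2).
    have f1 : f x.1 @[x --> z] --> f z.1.
      by apply: (continuous_comp (f := fst)); [exact: cvg_fst|exact: fc].
    have f2 : f x.2 @[x --> z] --> f z.2.
      by apply: (continuous_comp (f := snd)); [exact: cvg_snd|exact: fc].
    exact: cvg_pair f1 f2.
  by apply: (cvg_rw (cvg_comp _ _ fz (@add_continuous V (f z.1, f z.2)))) => [x|] /=.
have h1 : {for z, continuous (fun z : P * P => (z.1 + z.2).1)}.
  by apply: (coord_add E fst) => // x; exact: cvg_fst.
have h2 : {for z, continuous (fun z : P * P => (z.1 + z.2).2)}.
  by apply: (coord_add F snd) => // x; exact: cvg_snd.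
exact: cvg_pair h1 h2.
Qed.

HB.instance Definition _ :=
  PreTopologicalNmodule_isTopologicalNmodule.Build P space_prod_add_continuous.

Lemma space_prod_scale_continuous : continuous (fun z : R^o * P => z.1 *: z.2).
Proof.
move=> z; have coord_scale (V : topologicalLmodType R) (f : P -> V) : continuous f ->
    (forall h x, f (h *: x) = h *: f x) ->
    {for z, continuous (fun z : R^o * P => f (z.1 *: z.2))}.
  move=> fc fD; have fz : (fun z => (z.1, f z.2)) @ z --> (z.1, f z.2).
    have f1 : x.1 @[x --> z] --> z.1 by exact: cvg_fst.
    have f2 : f x.2 @[x --> z] --> f z.2.
      by apply: (continuous_comp (f := snd)); [exact: cvg_snd|exact: fc].
    exact: cvg_pair f1 f2.
  by apply: (cvg_rw (cvg_comp _ _ fz (@scale_continuous R V (z.1, f z.2)))) => [x|] /=.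
have h1 : {for z, continuous (fun z : R^o * P => (z.1 *: z.2).1)}.
  by apply: (coord_scale E fst) => // x; exact: cvg_fst.
have h2 : {for z, continuous (fun z : R^o * P => (z.1 *: z.2).2)}.
  by apply: (coord_scale F snd) => // x; exact: cvg_snd.
exact: cvg_pair h1 h2.
Qed.

HB.instance Definition _ :=
  TopologicalNmodule_isTopologicalLmodule.Build R P space_prod_scale_continuous.

End TopologicalProduct.

Section TopologicalTangent.
Context {R : realType} (E : topologicalLmodType R).

Lemma tangent_add_continuous :
  continuous (fun z : tangent E * tangent E => z.1 + z.2).
Proof. exact: (@space_prod_add_continuous R E E). Qed.

HB.instance Definition _ :=
  PreTopologicalNmodule_isTopologicalNmodule.Build (tangent E)
    tangent_add_continuous.

Lemma tangent_scale_continuous :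
  continuous (fun z : R^o * tangent E => z.1 *: z.2).
Proof. exact: (@space_prod_scale_continuous R E E). Qed.

HB.instance Definition _ :=
  TopologicalNmodule_isTopologicalLmodule.Build R (tangent E)
    tangent_scale_continuous.

End TopologicalTangent.

Section TopologicalLmodCvg.
Context {R : realType} {E : topologicalLmodType R}.
Context {T : Type} {F : set_system T} {FF : Filter F}.

Lemma cvg_add (f g : T -> E) (a b : E) :
  f @ F --> a -> g @ F --> b -> f x + g x @[x --> F] --> a + b.
Proof.
move=> fa gb; exact: cvg_comp (cvg_pair fa gb) (@add_continuous E (a, b)).
Qed.

Lemma cvg_scale (h : T -> R) (f : T -> E) (r : R) (a : E) :
  h @ F --> r -> f @ F --> a -> h x *: f x @[x --> F] --> r *: a.
Proof.
move=> hr fa; exact: cvg_comp (cvg_pair hr fa) (@scale_continuous R E (r, a)).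
Qed.

Lemma cvg_sub (f g : T -> E) (a b : E) :
  f @ F --> a -> g @ F --> b -> f x - g x @[x --> F] --> a - b.
Proof.
move=> fa gb; apply: cvg_add => //.
rewrite -scaleN1r; under eq_fun do rewrite -scaleN1r.
by apply: cvg_scale => //; exact: cvg_cst.
Qed.

End TopologicalLmodCvg.

Lemma cvg_segment (R : realType) (E : topologicalLmodType R) (x v : E) :
  h *: v + x @[h --> 0^'] --> x.
Proof.
rewrite -[X in _ --> X]add0r -(scale0r v).
apply: cvg_add; last exact: cvg_cst.
by apply: cvg_scale; [exact: nbhs_dnbhs|exact: cvg_cst].
Qed.

Section CkLocal.
Context {R : realType}.

Lemma Ck_ext k (E : topologicalLmodType R) (F : preTopologicalLmodType R)
    (U : set E) (f g : E -> F) :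
  open U -> (forall x, U x -> f x = g x) -> Ck k U f -> Ck k U g.
Proof.
move=> Uo fg fk.
have gc x : U x -> {for x, continuous g}.
  move=> Ux; have := Ck_continuous fk Ux; rewrite /prop_for /continuous_at (fg x Ux).
  apply: cvg_trans; apply: near_eq_cvg.
  by apply: filterS (open_nbhs_nbhs (conj Uo Ux)) => y; exact: fg.
case: k fk => [|k] [_ fk]; split => //.
case: fk => df [fdf dfk]; exists df; split => // x v Ux.
apply: cvg_trans (fdf x v Ux); apply: near_eq_cvg.
have nU : \forall h \near 0^', U (h *: v + x).
  exact: (@cvg_segment _ _ x v U (open_nbhs_nbhs (conj Uo Ux))).
by apply: filterS nU => h /= hU; rewrite /diff_quotient !fg.
Qed.

(** [L0] is the linear part of the affine map [L]. *)
Lemma Ck_precomp_affine k (E E' F : preTopologicalLmodType R) (U : set E)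
    (U' : set E') (L L0 : E' -> E) (f : E -> F) :
  continuous L -> continuous L0 ->
  (forall h v x, L (h *: v + x) = h *: L0 v + L x) ->
  (forall h v x, L0 (h *: v + x) = h *: L0 v + L0 x) ->
  (forall x, U' x -> U (L x)) -> Ck k U f -> Ck k U' (f \o L).
Proof.
elim: k E E' U U' L L0 f => [|k IHk] E E' U U' L L0 f Lc L0c Ll L0l LU fk.
  split=> // x U'x; apply: continuous_comp; first exact: Lc.
  exact: (Ck_continuous fk (LU _ U'x)).
split=> [x U'x|].
  apply: continuous_comp; first exact: Lc.
  exact: (Ck_continuous fk (LU _ U'x)).
case: fk => _ [df [fdf dfk]].
exists (df \o (fun z : tangent E' => (L z.1, L0 z.2) : tangent E)); split.
  move=> x v U'x; rewrite [X in X @ _ --> _](_ : _ = diff_quotient f (L x) (L0 v)).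
    exact: fdf (LU _ U'x).
  by apply/funext => h; rewrite /diff_quotient /= Ll.
apply: (IHk _ _ [set xv : tangent E | U xv.1] _ _
    (fun z : tangent E' => (L0 z.1, L0 z.2) : tangent E)) => //.
- move=> z; apply: cvg_pair => /=.
    by apply: (continuous_comp (f := fst)); [exact: cvg_fst|exact: Lc].
  by apply: (continuous_comp (f := snd)); [exact: cvg_snd|exact: L0c].
- move=> z; apply: cvg_pair => /=.
    by apply: (continuous_comp (f := fst)); [exact: cvg_fst|exact: L0c].
  by apply: (continuous_comp (f := snd)); [exact: cvg_snd|exact: L0c].
- by move=> h v x; rewrite /= Ll L0l.
- by move=> h v x; rewrite /= !L0l.
- by move=> x /= /LU.
Qed.

Lemma Ck_direction k (E : preTopologicalLmodType R) (F : preTopologicalLmodType R)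
    (U : set E) (df : tangent E -> F) (v : E) :
  Ck k [set z : tangent E | U z.1] df -> Ck k U (fun x => df (x, v)).
Proof.
apply: (Ck_precomp_affine (L := fun x => (x, v) : tangent E)
  (L0 := fun x => (x, 0) : tangent E)) => //.
- move=> x; apply: cvg_pair => /=; [exact: cvg_id|exact: cvg_cst].
- move=> x; apply: cvg_pair => /=; [exact: cvg_id|exact: cvg_cst].
- by move=> h w x; congr pair; rewrite /= ?scaler0 ?add0r.
- by move=> h w x; congr pair; rewrite /= ?scaler0 ?add0r.
Qed.

(** The directional derivative for an arbitrary source space; for a source of row
    vectors it is the usual ['D_v f x]. *)
Definition dird (E : lmodType R) m n (f : E -> 'M[R]_(m, n)) (v : E) (x : E) :
  'M[R]_(m, n) := lim (diff_quotient f x v @ 0^').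

Lemma dirdE (E : lmodType R) m n (f : E -> 'M[R]_(m, n)) x v (l : 'M[R]_(m, n)) :
  diff_quotient f x v @ 0^' --> l -> dird f v x = l.
Proof. by move=> fl; exact: (cvg_lim _ fl). Qed.

Lemma Ck_dird k (E : topologicalLmodType R) m n (U : set E) (f : E -> 'M[R]_(m, n)) v :
  open U -> Ck k.+1 U f -> Ck k U (dird f v).
Proof.
move=> Uo [_ [df [fdf dfk]]]; apply: (Ck_ext (f := fun x => df (x, v))) => //.
  by move=> x Ux; apply/esym/dirdE; exact: fdf.
exact: Ck_direction.
Qed.

Lemma Ck_dird_cvg k (E : preTopologicalLmodType R) m n (U : set E)
    (f : E -> 'M[R]_(m, n)) x v :
  Ck k.+1 U f -> U x -> diff_quotient f x v @ 0^' --> dird f v x.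
Proof.
move=> [_ [df [fdf dfk]]] Ux.
by rewrite (dirdE (fdf x v Ux)); exact: fdf.
Qed.

Lemma diff_quotient_derive m n p (f : 'rV[R]_p -> 'M[R]_(m, n)) x v
    (l : 'M[R]_(m, n)) :
  diff_quotient f x v @ 0^' --> l -> 'D_v f x = l.
Proof. exact: dirdE. Qed.

Lemma Ck_derive k m n p (U : set 'rV[R]_p) (f : 'rV[R]_p -> 'M[R]_(m, n)) v :
  open U -> Ck k.+1 U f -> Ck k U ('D_v f).
Proof. exact: Ck_dird. Qed.

Lemma Ck_derivable k m n p (U : set 'rV[R]_p) (f : 'rV[R]_p -> 'M[R]_(m, n)) x v :
  Ck k.+1 U f -> U x -> diff_quotient f x v @ 0^' --> 'D_v f x.
Proof. exact: Ck_dird_cvg. Qed.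

Lemma smooth_partials n ks (U : set 'rV[R]_n) (f : 'rV[R]_n -> 'M[R]_n) :
  open U -> smooth_on U f -> smooth_on U (partials ks f).
Proof.
move=> Uo fs; elim: ks => [//|k ks IHks] j /=.
exact: Ck_derive (IHks j.+1).
Qed.

Lemma dird_ext (E : topologicalLmodType R) m n (U : set E) (f g : E -> 'M[R]_(m, n)) x v :
  open U -> (forall x, U x -> f x = g x) -> U x -> dird f v x = dird g v x.
Proof.
move=> Uo fg Ux; rewrite /dird; congr (lim _); apply/seteqP.
have nU : \forall h \near 0^', U (h *: v + x).
  exact: (@cvg_segment _ _ x v U (open_nbhs_nbhs (conj Uo Ux))).
by split; (apply: near_eq_cvg; apply: filterS nU => h /= hU; rewrite /diff_quotient !fg).
Qed.

Lemma derive_ext m n p (U : set 'rV[R]_p) (f g : 'rV[R]_p -> 'M[R]_(m, n)) x v :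
  open U -> (forall x, U x -> f x = g x) -> U x -> 'D_v f x = 'D_v g x.
Proof. exact: dird_ext. Qed.

Lemma partials_ext n ks (U : set 'rV[R]_n) (f g : 'rV[R]_n -> 'M[R]_n) x :
  open U -> (forall x, U x -> f x = g x) -> U x -> partials ks f x = partials ks g x.
Proof.
move=> Uo fg; elim: ks x => [|k ks IHks] x Ux /=; first exact: fg.
by apply: derive_ext Ux => // y; exact: IHks.
Qed.

End CkLocal.

Lemma filter_prodC (S T : Type) (F : set_system S) (G : set_system T)
    (P : S -> T -> Prop) :
  (\forall x \near F & y \near G, P x y) -> \forall y \near G & x \near F, P x y.
Proof. by case=> -[A B] [FA GB] AB; exists (B, A) => // -[y x] [By Ax]; exact: (AB (x, y)). Qed.

Lemma near_fst (S T : Type) (F : set_system S) (G : set_system T)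
    {FG : Filter G} (P : set S) :
  (\forall x \near F, P x) -> \forall z \near filter_prod F G, P z.1.
Proof. by move=> FP; exists (P, setT); [split=> //; exact: filterT|case=> x y []]. Qed.

Lemma near_snd (S T : Type) (F : set_system S) (G : set_system T)
    {FF : Filter F} (P : set T) :
  (\forall x \near G, P x) -> \forall z \near filter_prod F G, P z.2.
Proof. by move=> GP; exists (setT, P); [split=> //; exact: filterT|case=> x y []]. Qed.

Section LocallyUniform.
Context {R : realType} {n : nat}.

Lemma compact_nbhd (U : set 'rV[R]_n) p : open U -> U p ->
  exists2 K : set 'rV[R]_n, nbhs p K & compact K /\ K `<=` U.
Proof.
move=> Uo Up; have /nbhs_closedballP[e eU] := open_nbhs_nbhs (conj Uo Up).
exists (closed_ball p e%:num); first exact: filterS (@subset_closed_ball _ _ _ _) (nbhsx_ballx p e%:num _).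
split=> //; apply: bounded_closed_compact; last exact: closed_ball_closed.
exists (`|p| + e%:num); split; first exact: num_real.
move=> M pM q; rewrite closed_ballE//= /closed_ball_ /= => pq.
rewrite (le_trans _ (ltW pM))// -(subrK p q) addrC (le_trans (ler_normD _ _))//.
by rewrite lerD2l distrC.
Qed.

(** Locally uniform convergence to a continuous limit is the same as continuous
    convergence, [u h p -> l p0] jointly as [h] runs along the filter and [p]
    tends to [p0].  This replaces the compact sets by a statement about limits,
    which composes with algebraic operations. *)
Lemma cvg_family_compactP (m : nat) (T : Type) (F : set_system T) {FF : Filter F}
    (U : set 'rV[R]_n) (u : T -> 'rV[R]_n -> 'M[R]_m) (l : 'rV[R]_n -> 'M[R]_m) :
  open U -> (forall p, U p -> {for p, continuous l}) ->
  {family [set K | compact K /\ K `<=` U], u @ F --> l} <->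
  (forall p0, U p0 -> u z.1 z.2 @[z --> filter_prod F (nbhs p0)] --> l p0).
Proof.
move=> Uo lc; split.
  move=> /fam_cvgP ul p0 Up0; have [K Kp0 [Kc KU]] := compact_nbhd Uo Up0.
  apply/cvgrPdist_lt => e e0; have e20 : 0 < e / 2 by rewrite divr_gt0.
  have uK : \forall h \near F, forall p, K p -> `|l p - u h p| < e / 2.
    apply: (ul K (conj Kc KU) [set f : 'rV[R]_n -> 'M[R]_m | forall p, K p -> `|l p - f p| < e / 2]).
    apply/uniform_nbhs.
    exists [set z | `|z.1 - z.2| < e / 2]; split; last by move=> h /=; exact.
    rewrite -entourage_from_ballE; exists (e / 2) => //= -[x y] /=.
    by rewrite mx_norm_ball.
  have /cvgrPdist_lt /(_ _ e20) lp := lc _ Up0.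
  near=> z; rewrite (splitr e) -(subrK (l z.2) (l p0)) -addrA.
  rewrite (le_lt_trans (ler_normD _ _))// ltrD//.
    by near: z; exact: near_snd lp.
  have Kz : K z.2 by near: z; exact: near_snd Kp0.
  by move: (z.2) Kz; near: z; exact: (near_fst (P := fun x => forall p, K p -> `|l p - u x p| < e / 2)) uK.
move=> ul; apply/fam_cvgP => K [Kc KU] P /uniform_nbhs[E [entE EP]].
apply: filterS EP _ => /=.
move: entE; rewrite -entourage_from_ballE => -[e /= e0 eE].
suff : \forall h \near F, forall p, K p -> `|l p - u h p| < e.
  apply: filterS => h hK p Kp; apply: eE => /=.
  by rewrite mx_norm_ball; exact: hK.
have e20 : 0 < e / 2 by rewrite divr_gt0.
have cov := iffLR (compact_near_coveringP K) Kc.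
apply: (cov T F (fun h p => `|l p - u h p| < e) FF) => p Kp.
suff H : \forall h \near F & q \near nbhs p, `|l q - u h q| < e by exact: (filter_prodC H).
have /cvgrPdist_lt /(_ _ e20) lp := lc _ (KU _ Kp).
have /cvgrPdist_lt /(_ _ e20) up := ul _ (KU _ Kp).
have lp' := near_snd (FF := FF) lp.
near=> z; rewrite /= (splitr e) -(subrK (l p) (l z.2)) -addrA.
rewrite (le_lt_trans (ler_normD _ _))// ltrD//; last by near: z.
by rewrite distrC; near: z.
Unshelve. all: by end_near. Qed.

End LocallyUniform.

(** * The topology of the space of symmetric 2-forms *)

Lemma cvg_initial (S : choiceType) (T : topologicalType) (f : S -> T)
    (F : set_system S) {FF : Filter F} (s : S) :
  F --> (s : initial_topology f) <-> f @ F --> f s.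
Proof.
split=> [Fs|fF]; first exact: cvg_trans (cvg_app f Fs) (@initial_continuous _ _ f s).
move=> A [_ [[B Bo <-] Bs BA]].
by apply: filterS BA _; apply: fF; exact: (open_nbhs_nbhs (conj Bo Bs)).
Qed.

Section PartialsLinear.
Context {R : realType} {n : nat}.
Implicit Types (U : set 'rV[R]_n) (f g : 'rV[R]_n -> 'M[R]_n).

Lemma smooth_continuous U f x : smooth_on U f -> U x -> {for x, continuous f}.
Proof. by move=> fs; exact: Ck_continuous (fs 0). Qed.

Lemma derive_lin U f g c x (v : 'rV[R]_n) : smooth_on U f -> smooth_on U g -> U x ->
  'D_v (fun y => c *: f y + g y) x = c *: 'D_v f x + 'D_v g x.
Proof.
move=> fs gs Ux; apply: diff_quotient_derive.
have fl := Ck_derivable (v := v) (fs 1%N) Ux.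
have gl := Ck_derivable (v := v) (gs 1%N) Ux.
apply: (cvg_rw (cvgD (cvgZl_tmp (k := c) fl) gl)) => // h /=.
rewrite [LHS]/(c *: diff_quotient f x v h + diff_quotient g x v h).
rewrite /diff_quotient scalerA mulrC -scalerA scalerBr opprD addrACA.
by rewrite [in RHS]scalerDr.
Qed.

Lemma partials_lin ks U f g c x : open U -> smooth_on U f -> smooth_on U g -> U x ->
  partials ks (fun y => c *: f y + g y) x = c *: partials ks f x + partials ks g x.
Proof.
move=> Uo fs gs; elim: ks x => [//|k ks IHks] x Ux /=.
rewrite -(@derive_lin U)//; [|exact: smooth_partials|exact: smooth_partials].
by apply: derive_ext Ux.
Qed.

End PartialsLinear.

Section S2Topology.
Context {R : realType} {n : nat} {T : topologicalType} {M : manifold R n T}.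

Lemma S2_scale (c : R) (u : S2 M) i p : (c *: u) i p = c *: u i p.
Proof. by []. Qed.

Lemma S2_add (u v : S2 M) i p : (u + v) i p = u i p + v i p.
Proof. by []. Qed.

Lemma S2_opp (u : S2 M) i p : (- u) i p = - u i p.
Proof. by []. Qed.

Lemma S2_0 i p : (0 : S2 M) i p = 0.
Proof. by []. Qed.

Lemma S2_ext (u v : S2 M) : (forall i p, u i p = v i p) -> u = v.
Proof.
by move=> uv; apply/val_inj/funext => i; apply/funext => p; exact: uv.
Qed.

Lemma coords_openP i : open (coords (atlas M i)).
Proof. exact: coords_open. Qed.

Lemma partials_S2_lin ks (c : R) (u v : S2 M) i p : coords (atlas M i) p ->
  partials ks ((c *: u + v) i) p = c *: partials ks (u i) p + partials ks (v i) p.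
Proof.
have us := @sym2_smooth _ _ _ _ _ (S2_sym2 u) i.
have vs := @sym2_smooth _ _ _ _ _ (S2_sym2 v) i.
exact: (partials_lin ks c (@coords_openP i) us vs).
Qed.

Lemma partials_S2_continuous ks (u : S2 M) i p : coords (atlas M i) p ->
  {for p, continuous (partials ks (u i))}.
Proof.
apply: smooth_continuous; apply: smooth_partials; first exact: coords_openP.
exact: (sym2_smooth (S2_sym2 u)).
Qed.

(** The working form of the C^oo topology, in terms of limits of matrices. *)
Lemma S2_cvgP (X : Type) (F : set_system X) {FF : Filter F} (u : X -> S2 M) (l : S2 M) :
  u @ F --> l <-> (forall i ks p0, coords (atlas M i) p0 ->
    partials ks (u z.1 i) z.2 @[z --> filter_prod F (nbhs p0)] --> partials ks (l i) p0).
Proof.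
have sup := @cvg_sup (S2 M) _ (fun q : chart_index M * seq 'I_n => Topological.class
      (initial_topology (fun h : S2 M => partials q.2 (h q.1) :
        {family [set K | compact K /\ K `<=` coords (atlas M q.1)],
          'rV[R]_n -> 'M[R]_n}))) (u @ F) l _.
have famP i ks := cvg_family_compactP (fun x => partials ks (u x i))
  (@coords_openP i) (fun p ip => @partials_S2_continuous ks l i p ip).
split.
  move=> /sup ul i ks p0 ip0; have /cvg_initial ful := ul (i, ks).
  exact: (iffLR (famP F FF i ks) ful p0 ip0).
move=> ul; apply/sup => -[i ks]; apply/cvg_initial.
exact: (iffRL (famP F FF i ks) (ul i ks)).
Qed.

Lemma near_coords (X : Type) (F : set_system X) {FF : Filter F} i p0 :
  coords (atlas M i) p0 ->
  \forall z \near filter_prod F (nbhs p0), coords (atlas M i) z.2.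
Proof.
move=> ip0; apply: near_snd.
have := @coords_openP i; rewrite openE; exact.
Qed.

(** The point of evaluation may move along with the field. *)
Lemma S2_eval_cvg (X : Type) (F : set_system X) {FF : Filter F} (u : X -> S2 M)
    (l : S2 M) i ks (p : X -> 'rV[R]_n) p0 :
  coords (atlas M i) p0 -> u @ F --> l -> p @ F --> p0 ->
  partials ks (u x i) (p x) @[x --> F] --> partials ks (l i) p0.
Proof.
move=> ip0 /S2_cvgP /(_ i ks p0 ip0) ul pp0.
exact: cvg_comp (cvg_pair (cvg_id (F := F)) pp0) ul.
Qed.

Lemma S2_point_cvg (X : Type) (F : set_system X) {FF : Filter F} (u : X -> S2 M)
    (l : S2 M) i p : u @ F --> l -> u x i p @[x --> F] --> l i p.
Proof.
move=> ul; have [ip|ip] := pselect (coords (atlas M i) p).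
  exact: (S2_eval_cvg (ks := [::]) ip ul (cvg_cst p)).
rewrite (sym2_off (S2_sym2 l) ip); apply: (cvg_rw (cvg_cst 0)) => // x.
by rewrite (sym2_off (S2_sym2 (u x)) ip).
Qed.

Lemma partials_S2_0 ks i p : coords (atlas M i) p -> partials ks ((0 : S2 M) i) p = 0.
Proof.
move=> ip; have := partials_S2_lin ks (-1) 0 0 ip.
by rewrite scaler0 addr0 scaleN1r addNr.
Qed.

Lemma partials_S2_scale ks (c : R) (u : S2 M) i p : coords (atlas M i) p ->
  partials ks ((c *: u) i) p = c *: partials ks (u i) p.
Proof. by move=> ip; rewrite -[c *: u]addr0 partials_S2_lin// partials_S2_0// addr0. Qed.

Lemma partials_S2_add ks (u v : S2 M) i p : coords (atlas M i) p ->
  partials ks ((u + v) i) p = partials ks (u i) p + partials ks (v i) p.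
Proof. by move=> ip; rewrite -[in LHS](scale1r u) partials_S2_lin// scale1r. Qed.

Section ArithmeticCvg.
Context (X : Type) (F : set_system X) {FF : Filter F}.

Lemma S2_cvg_add (u v : X -> S2 M) a b :
  u @ F --> a -> v @ F --> b -> u x + v x @[x --> F] --> a + b.
Proof.
move=> /S2_cvgP ua /S2_cvgP vb; apply/S2_cvgP => i ks p0 ip0.
rewrite partials_S2_add//; apply: cvg_trans (cvgD (ua i ks p0 ip0) (vb i ks p0 ip0)).
apply: near_eq_cvg; apply: filterS (near_coords ip0) => w iw /=.
by rewrite partials_S2_add.
Qed.

Lemma S2_cvg_scale (h : X -> R) (u : X -> S2 M) (r : R) a :
  h @ F --> r -> u @ F --> a -> h x *: u x @[x --> F] --> r *: a.
Proof.
move=> hr /S2_cvgP ua; apply/S2_cvgP => i ks p0 ip0.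
have hr' : h z.1 @[z --> filter_prod F (nbhs p0)] --> r by exact: cvg_comp cvg_fst hr.
rewrite partials_S2_scale//; apply: cvg_trans (cvgZ hr' (ua i ks p0 ip0)).
apply: near_eq_cvg; apply: filterS (near_coords ip0) => w iw /=.
by rewrite partials_S2_scale.
Qed.

End ArithmeticCvg.

Lemma S2_add_continuous : continuous (fun z : S2 M * S2 M => z.1 + z.2).
Proof. by move=> z; apply: S2_cvg_add; [exact: cvg_fst|exact: cvg_snd]. Qed.

HB.instance Definition _ :=
  PreTopologicalNmodule_isTopologicalNmodule.Build (S2 M) S2_add_continuous.

Lemma S2_scale_continuous : continuous (fun z : R^o * S2 M => z.1 *: z.2).
Proof. by move=> z; apply: S2_cvg_scale; [exact: cvg_fst|exact: cvg_snd]. Qed.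

HB.instance Definition _ :=
  TopologicalNmodule_isTopologicalLmodule.Build R (S2 M) S2_scale_continuous.

Lemma S2_hausdorff : hausdorff_space (S2 M).
Proof.
move=> u v uv; apply: S2_ext => i p; apply: (@norm_hausdorff R 'M[R]_n) => A B uA vB.
have ev (w : S2 M) : x i p @[x --> w] --> w i p by exact: S2_point_cvg (cvg_id (F := nbhs w)).
have [x [Ax Bx]] := uv _ _ (ev u A uA) (ev v B vB).
by exists (x i p).
Qed.

Lemma dderivE (E : lmodType R) (f : E -> S2 M) x v l :
  diff_quotient f x v @ 0^' --> l -> dderiv f x v = l.
Proof. by move=> fl; exact: (cvg_lim S2_hausdorff fl). Qed.

End S2Topology.

(** * The mean value theorem for maps into function spaces *)

Section MeanValue.
Context {R : realType}.

Lemma mean_value_segment (f df : R^o -> R^o) (h : R) :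
  (forall s, `|s| <= `|h| -> diff_quotient f s 1 @ 0^' --> df s) ->
  exists2 s, `|s| <= `|h| & f h - f 0 = h * df s.
Proof.
move=> fd; pose J := [set s : R | `|s| <= `|h|].
have Jint : is_interval J.
  move=> x y; rewrite /J /= !ler_norml => /andP[x1 _] /andP[_ y2] z /andP[xz zy].
  by rewrite ler_norml (le_trans x1)//= (le_trans zy).
have J0 : J 0 by rewrite /J /= normr0.
have Jh : J h by rewrite /J /=.
have [c cP E] := mean_value_interval Jint J0 Jh fd; exists c.
  by case/orP: cP => cP; [exact: (Jint 0 h)|exact: (Jint h 0)].
by rewrite E subr0 mulrC.
Qed.

Record functional (V : preTopologicalLmodType R) (Lam : V -> R) : Prop := Functional {
  functional_continuous : continuous Lam;
  functional_lin : forall c x y, Lam (c *: x + y) = c * Lam x + Lam y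
}.

Lemma functionalB (V : preTopologicalLmodType R) (Lam : V -> R) c x y :
  functional Lam -> Lam (c *: (x - y)) = c * (Lam x - Lam y).
Proof.
move=> [_ lin].
have lin0 : Lam 0 = 0.
  by have := lin (-1) 0 0; rewrite scaler0 addr0 mulN1r addNr.
have linZ a u : Lam (a *: u) = a * Lam u.
  by rewrite -[a *: u]addr0 lin lin0 addr0.
by rewrite linZ -[x]scale1r lin mul1r scale1r -scaleN1r linZ mulN1r.
Qed.

(** The mean value theorem holds for scalar functions only, hence the composition
    with a functional. *)
Lemma mean_value_functional (E : lmodType R) (V : preTopologicalLmodType R)
    (U : set E) (f : E -> V) (df : E * E -> V) (Lam : V -> R) y w h :
  functional Lam ->
  (forall x v, U x -> diff_quotient f x v @ 0^' --> df (x, v)) ->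
  (forall s, `|s| <= `|h| -> U (s *: w + y)) ->
  exists2 s, `|s| <= `|h| &
    Lam (f (h *: w + y)) - Lam (f y) = h * Lam (df (s *: w + y, w)).
Proof.
move=> LamF fdf Us.
have [s|s sh fE] := @mean_value_segment (fun s => Lam (f (s *: w + y)))
    (fun s => Lam (df (s *: w + y, w))) h.
  move=> sh.
  have LamC : {for df (s *: w + y, w), continuous Lam}.
    by case: LamF => + _; exact.
  apply: (cvg_rw (cvg_comp _ _ (fdf _ w (Us s sh)) LamC)) => // r /=.
  rewrite /diff_quotient functionalB//; congr (_ * (Lam (f _) - _)).
  by rewrite [r *: 1]mulr1 scalerDl addrA.
by exists s => //; rewrite -fE scale0r add0r.
Qed.

Lemma near_segment_in (E : topologicalLmodType R) (X : Type) (F : set_system X)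
    {FF : Filter F} (U : set E) (x v : E) (y w : X -> E) (h : X -> R) :
  open U -> U x -> y @ F --> x -> w @ F --> v -> h @ F --> 0 ->
  \forall t \near F, forall s, `|s| <= `|h t| -> U (s *: w t + y t).
Proof.
move=> Uo Ux yx wv h0.
have c : z.2 *: w z.1 + y z.1 @[z --> filter_prod F (nbhs (0 : R))] --> x.
  rewrite -[X in _ --> X]add0r -(scale0r v); apply: cvg_add; first apply: cvg_scale.
  - exact: cvg_snd.
  - exact: cvg_comp cvg_fst wv.
  - exact: cvg_comp cvg_fst yx.
have [[A B] /= [FA /nbhs_ballP[e /= e0 eB]] AB] := c _ (open_nbhs_nbhs (conj Uo Ux)).
have he : \forall t \near F, `|h t| < e.
  by move/cvgrPdist_lt : h0 => /(_ _ e0); apply: filterS => t; rewrite sub0r normrN.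
near=> t => s st; apply: (AB (t, s)); split => /=; first by near: t.
apply: eB; rewrite /ball /= sub0r normrN (le_lt_trans st)//.
by near: t.
Unshelve. all: by end_near. Qed.

(** The functional may depend on the parameter [t].  This is what is needed in a
    function space: the functionals are the evaluations at points near [p0], and
    convergence in the space is uniform in these points. *)
Lemma mean_value_cvg (E : topologicalLmodType R) (V : preTopologicalLmodType R)
    (U : set E) (f : E -> V) (df : tangent E -> V) (X : Type) (F : set_system X)
    {FF : Filter F} (Lam : X -> V -> R) (y w : X -> E) (h : X -> R) x v (l : R) :
  open U -> U x ->
  (forall x v, U x -> diff_quotient f x v @ 0^' --> df (x, v)) ->
  {for ((x, v) : tangent E), continuous df} ->
  y @ F --> x -> w @ F --> v -> h @ F --> 0 ->
  (\forall t \near F, functional (Lam t)) ->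
  (forall z : X -> V, z @ F --> df (x, v) -> Lam t (z t) @[t --> F] --> l) ->
  (\forall t \near F, h t != 0) ->
  (h t)^-1 * (Lam t (f (h t *: w t + y t)) - Lam t (f (y t))) @[t --> F] --> l.
Proof.
move=> Uo Ux fdf dfc yx wv h0 LamF Laml hn0.
pose P t s := `|s| <= `|h t| /\ Lam t (f (h t *: w t + y t)) - Lam t (f (y t)) =
  h t * Lam t (df (s *: w t + y t, w t)).
(* A choice of the intermediate point for each [t]; it tends to 0 with [h]. *)
pose s t := if pselect (exists s, P t s) is left ex then projT1 (cid ex) else 0.
have sh t : `|s t| <= `|h t|.
  by rewrite /s; case: pselect => [ex|_]; [case: (cid ex) => ? []|rewrite normr0].
have s0 : s @ F --> 0.
  apply/cvgrPdist_lt => e e0; move/cvgrPdist_lt : h0 => /(_ _ e0).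
  by apply: filterS => t; rewrite !sub0r !normrN; exact: le_lt_trans.
have zl : df (s t *: w t + y t, w t) @[t --> F] --> df (x, v).
  have c1 : s t *: w t + y t @[t --> F] --> x.
    rewrite -[X in _ --> X]add0r -(scale0r v).
    by apply: cvg_add => //; exact: cvg_scale.
  exact: cvg_comp (cvg_pair c1 wv) dfc.
apply: cvg_trans (Laml _ zl); apply: near_eq_cvg.
have seg := near_segment_in (FF := FF) Uo Ux yx wv h0.
near=> t.
have ht : h t != 0 by near: t.
have exs : exists s, P t s.
  have Lt : functional (Lam t) by near: t.
  have Ut : forall s, `|s| <= `|h t| -> U (s *: w t + y t) by near: t.
  by have [s' ? ?] := mean_value_functional Lt fdf Ut; exists s'.
have [_ ->] : P t (s t) by rewrite /s; case: pselect => // ex; case: (cid ex).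
by rewrite mulKf.
Unshelve. all: by end_near. Qed.

Lemma entry_functional m n (i : 'I_m) (j : 'I_n) :
  functional (fun A : 'M[R]_(m, n) => A i j).
Proof.
split; first exact: coord_continuous.
by move=> c x y; rewrite !mxE.
Qed.

(** The difference quotients of a C^1 map converge jointly in the base point, the
    direction and the step. *)
Lemma C1_cvg_mx (E : topologicalLmodType R) m n (U : set E) (f : E -> 'M[R]_(m, n))
    (df : tangent E -> 'M[R]_(m, n)) (X : Type) (F : set_system X)
    {FF : Filter F} (y w : X -> E) (h : X -> R) x v :
  open U -> U x ->
  (forall x v, U x -> diff_quotient f x v @ 0^' --> df (x, v)) ->
  {for ((x, v) : tangent E), continuous df} ->
  y @ F --> x -> w @ F --> v -> h @ F --> 0 ->
  (\forall t \near F, h t != 0) ->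
  (h t)^-1 *: (f (h t *: w t + y t) - f (y t)) @[t --> F] --> df (x, v).
Proof.
move=> Uo Ux fdf dfc yx wv h0 hn0; apply: cvg_mx => i j.
have := @mean_value_cvg E _ U f df X F FF (fun _ A => A i j) y w h x v (df (x, v) i j)
  Uo Ux fdf dfc yx wv h0.
move=> H; apply: (cvg_rw (H _ _ hn0)) => [|z zl|t|//].
- by apply: nearW => t; exact: entry_functional.
- exact: cvg_coord.
- by rewrite !mxE.
Qed.

End MeanValue.

Section MeanValueS2.
Context {R : realType} {n : nat} {T : topologicalType} {M : manifold R n T}.

Lemma partials_functional ks i p (k l : 'I_n) : coords (atlas M i) p ->
  functional (fun u : S2 M => partials ks (u i) p k l).
Proof.
move=> ip; split=> [u|c u v]; last by rewrite partials_S2_lin// !mxE.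
apply: cvg_coord; exact: (S2_eval_cvg ip (cvg_id (F := nbhs u)) (cvg_cst p)).
Qed.

(** The analogue of [C1_cvg_mx] in [S2], where there is no norm: by [S2_cvgP] it is
    enough to treat the functionals [u |-> (partials ks (u i) p) k l], uniformly in
    the point [p]. *)
Lemma C1_cvg_S2 (E : topologicalLmodType R) (U : set E) (f : E -> S2 M)
    (df : tangent E -> S2 M) (X : Type) (F : set_system X)
    {FF : Filter F} (y w : X -> E) (h : X -> R) x v :
  open U -> U x ->
  (forall x v, U x -> diff_quotient f x v @ 0^' --> df (x, v)) ->
  {for ((x, v) : tangent E), continuous df} ->
  y @ F --> x -> w @ F --> v -> h @ F --> 0 ->
  (\forall t \near F, h t != 0) ->
  (h t)^-1 *: (f (h t *: w t + y t) - f (y t)) @[t --> F] --> df (x, v).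
Proof.
move=> Uo Ux fdf dfc yx wv h0 hn0; apply/S2_cvgP => i ks p0 ip0.
apply: cvg_mx => k l.
have fst_cvg (V : topologicalType) (a : X -> V) (b : V) : a @ F --> b ->
    a z.1 @[z --> filter_prod F (nbhs p0)] --> b.
  by move=> ab; exact: cvg_comp cvg_fst ab.
have ips := @near_coords _ _ _ M _ F FF _ _ ip0.
have H := @mean_value_cvg _ E _ U f df _ (filter_prod F (nbhs p0)) _
  (fun z u => partials ks (u i) z.2 k l) (y \o fst) (w \o fst) (h \o fst) x v
  (partials ks (df (x, v) i) p0 k l) Uo Ux fdf dfc (fst_cvg _ _ _ yx) (fst_cvg _ _ _ wv)
  (fst_cvg _ _ _ h0).
apply: cvg_trans (H _ _ _ (near_fst hn0)).
- apply: near_eq_cvg; apply: filterS ips => z iz /=.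
  by rewrite -(functionalB _ _ _ (partials_functional ks k l iz)).
- by apply: filterS ips => z iz; exact: partials_functional.
- by move=> z zl; apply: cvg_coord; exact: S2_eval_cvg ip0 zl cvg_snd.
Qed.

End MeanValueS2.

(** * Linearity of the derivative and symmetry of the second derivative *)

Lemma cvg_dnbhs0 (R : realType) : (fun h : R => h) @ (0 : R)^' --> (0 : R).
Proof. exact: nbhs_dnbhs. Qed.

Lemma near_dnbhs0 (R : realType) : \forall h \near (0 : R)^', h != 0.
Proof. exact: nbhs_dnbhs_neq. Qed.

Section SecondDerivative.
Context {R : realType} {E V : topologicalLmodType R}.
Variables (U : set E) (f : E -> V) (df : tangent E -> V).
Hypothesis Uo : open U.
Hypothesis fdf : forall x v, U x -> diff_quotient f x v @ 0^' --> df (x, v).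
Variable ddf : tangent (tangent E) -> V.
Hypothesis dfddf : forall (z w : tangent E), U z.1 -> diff_quotient df z w @ 0^' --> ddf (z, w).

Lemma open_tangent : open [set z : tangent E | U z.1].
Proof. by apply: (@open_comp _ _ (fst : tangent E -> E)) => // z _; exact: cvg_fst. Qed.

Definition second_difference (x v w : E) (h : R) : V :=
  (f (h *: w + (h *: v + x)) - f (h *: v + x)) - (f (h *: w + x) - f x).

(** The classical proof of Schwarz's theorem: the second difference is symmetric in
    [v] and [w], and the mean value theorem in the direction [v] turns it into a
    difference quotient of [df] in the direction [w]. *)
Lemma second_difference_cvg (Lam : V -> R) x v w : functional Lam -> U x ->
  {for (((x, v), (w, 0)) : tangent (tangent E)), continuous ddf} ->
  h^-1 * (h^-1 * Lam (second_difference x v w h)) @[h --> 0^'] -->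
    Lam (ddf ((x, v), (w, 0))).
Proof.
move=> LamF Ux ddfc.
(* The mean value theorem is applied to [g h], with a chosen intermediate point
   [s h], in the direction [v]. *)
pose g h y := f (h *: w + y) - f y.
pose dg h (z : E * E) := df (h *: w + z.1, z.2) - df z.
pose P h s := `|s| <= `|h| /\ Lam (g h (h *: v + x)) - Lam (g h x) =
  h * Lam (dg h (s *: v + x, v)).
pose s h := if pselect (exists s, P h s) is left ex then projT1 (cid ex) else 0.
have sh h : `|s h| <= `|h|.
  by rewrite /s; case: pselect => [ex|_]; [case: (cid ex) => ? []|rewrite normr0].
have s0 : s h @[h --> 0^'] --> 0.
  apply/cvgrPdist_lt => e e0; move/cvgrPdist_lt : (@cvg_dnbhs0 R) => /(_ _ e0).
  by apply: filterS => t; rewrite !sub0r !normrN; exact: le_lt_trans.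
have c1 : s t *: v + x @[t --> 0^'] --> x.
  rewrite -[X in _ --> X]add0r -(scale0r v).
  by apply: cvg_add; [apply: cvg_scale => //; exact: cvg_cst|exact: cvg_cst].
have cy : (s t *: v + x, v) @[t --> 0^'] --> ((x, v) : tangent E).
  by apply: cvg_pair => //; exact: cvg_cst.
have cw : (fun=> (w, 0)) @ (0 : R)^' --> ((w, 0) : tangent E) by exact: cvg_cst.
have [LamC _] := LamF.
have H : t^-1 * (Lam (df (t *: ((w, 0) : tangent E) + (s t *: v + x, v)))
    - Lam (df (s t *: v + x, v))) @[t --> 0^'] --> Lam (ddf ((x, v), (w, 0))).
  apply: (@mean_value_cvg R (tangent E) V [set z : tangent E | U z.1] df ddf R 0^' _
    (fun=> Lam) (fun t => (s t *: v + x, v)) (fun=> (w, 0)) id (x, v) (w, 0)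
    _ open_tangent Ux dfddf ddfc cy cw (@cvg_dnbhs0 R) _ _ (@near_dnbhs0 R)).
    exact: nearW.
  by move=> z zl; exact: (cvg_comp _ _ zl (LamC _)).
apply: cvg_trans H; apply: near_eq_cvg.
have cx : (fun _ : R => x) @ (0 : R)^' --> x by exact: cvg_cst.
have cv : (fun _ : R => v) @ (0 : R)^' --> v by exact: cvg_cst.
have seg1 : \forall h \near (0 : R)^', forall s, `|s| <= `|h| -> U (s *: v + x).
  exact: near_segment_in Uo Ux cx cv (@cvg_dnbhs0 R).
have seg2 : \forall h \near (0 : R)^',
    forall s, `|s| <= `|h| -> U (s *: v + (h *: w + x)).
  exact: near_segment_in Uo Ux (@cvg_segment _ _ x w) cv (@cvg_dnbhs0 R).
near=> h.
have exs : exists s, P h s.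
  have U1 : forall s, `|s| <= `|h| -> U (s *: v + x) by near: h.
  have U2 : forall s, `|s| <= `|h| -> U (s *: v + (h *: w + x)) by near: h.
  have [|t th|s' ? ?] := @mean_value_functional R E (V)
      [set y | U y /\ U (h *: w + y)] (g h) (dg h) Lam x v h LamF.
  - move=> y u [Uy Uwy]; apply: (cvg_rw (cvg_sub (@fdf _ u Uwy) (@fdf _ u Uy))) => // r.
    rewrite /diff_quotient /g -scalerBr; congr (_ *: _).
    rewrite !opprB [h *: w + (r *: u + y)]addrCA [LHS]addrACA [RHS]addrACA.
    by congr (_ + _); exact: addrC.
  - by split; [exact: U1|rewrite addrCA; exact: U2].
  - by exists s'.
have [_ PE] : P h (s h) by rewrite /s; case: pselect => // ex; case: (cid ex).
have h0 : h != 0 by near: h; exact: near_dnbhs0.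
have LB a b : Lam (a - b) = Lam a - Lam b.
  by rewrite -[a - b]scale1r functionalB// mul1r.
rewrite /= [second_difference _ _ _ _]/(g h (h *: v + x) - g h x) LB PE mulKf//.
rewrite -LB /dg; congr (_ * Lam (df _ - _)).
by congr pair; rewrite /= ?scaler0 ?add0r.
Unshelve. all: by end_near. Qed.

Lemma functional_second_derivative_sym (Lam : V -> R) x v w : functional Lam -> U x ->
  {for (((x, v), (w, 0)) : tangent (tangent E)), continuous ddf} ->
  {for (((x, w), (v, 0)) : tangent (tangent E)), continuous ddf} ->
  Lam (ddf ((x, v), (w, 0))) = Lam (ddf ((x, w), (v, 0))).
Proof.
move=> LamF Ux c1 c2.
have L1 := second_difference_cvg LamF Ux c1.
have L2 := second_difference_cvg LamF Ux c2.
have vw h : second_difference x v w h = second_difference x w v h.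
  rewrite /second_difference [h *: v + (h *: w + x)]addrCA !opprB.
  by rewrite [LHS]addrACA [RHS]addrACA; congr (_ + _); exact: addrC.
have L2' : h^-1 * (h^-1 * Lam (second_difference x v w h)) @[h --> 0^'] -->
    Lam (ddf (x, w, (v, 0))).
  by under eq_fun do rewrite vw; exact: L2.
exact: (norm_cvg_unique L1 L2').
Qed.

End SecondDerivative.

Section Derivative.
Context {R : realType} {n : nat} {T : topologicalType} {M : manifold R n T}.
Context {E : topologicalLmodType R}.
Variables (U : set E) (f : E -> S2 M) (df : tangent E -> S2 M).
Hypothesis Uo : open U.
Hypothesis fdf : forall x v, U x -> diff_quotient f x v @ 0^' --> df (x, v).

Lemma S2_lim_uniq (X : Type) (F : set_system X) {FF : ProperFilter F}
  (u : X -> S2 M) (a b : S2 M) : u @ F --> a -> u @ F --> b -> a = b.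
Proof. by move=> ua ub; exact: (cvg_unique S2_hausdorff ua ub). Qed.

(** The increment along [h (v + w)] is the increment along [h w] followed by that
    along [h v] from a moving base point, where [C1_cvg_S2] applies. *)
Lemma derivativeD x v w : U x -> {for ((x, v) : tangent E), continuous df} ->
  df (x, v + w) = df (x, v) + df (x, w).
Proof.
move=> Ux dfc; have yx := @cvg_segment R E x w.
have H : h^-1 *: (f (h *: v + (h *: w + x)) - f (h *: w + x)) @[h --> 0^'] --> df (x, v).
  exact: (C1_cvg_S2 Uo Ux fdf dfc yx (cvg_cst v) (@cvg_dnbhs0 R) (@near_dnbhs0 R)).
have H2 : diff_quotient f x (v + w) @ 0^' --> df (x, v) + df (x, w).
  apply: (cvg_rw (cvg_add H (@fdf x w Ux))) => // h.
  by rewrite /diff_quotient -[LHS]scalerDr [X in _ *: X]addrA subrK (scalerDr h v w) -(addrA (h *: v)).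
exact: (S2_lim_uniq (@fdf x (v + w) Ux) H2).
Qed.

Lemma derivativeZ x v c : U x -> df (x, c *: v) = c *: df (x, v).
Proof.
move=> Ux; have [->|c0] := eqVneq c 0.
  have H : diff_quotient f x (0 *: v) @ 0^' --> 0 *: df (x, v).
    rewrite [X in _ --> X]scale0r; apply: (cvg_rw (cvg_cst 0)) => // h.
    by rewrite /diff_quotient scale0r scaler0 add0r subrr scaler0.
  exact: (S2_lim_uniq (@fdf x (0 *: v) Ux) H).
have ch : c * h @[h --> 0^'] --> 0^'.
  move=> A [e /= e0 eA]; exists (e / `|c|) => /=; first by rewrite divr_gt0// normr_gt0.
  move=> h; rewrite /ball /= sub0r normrN => he h0; apply: eA.
    by rewrite /ball /= sub0r normrN normrM mulrC -ltr_pdivlMr// normr_gt0.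
  by rewrite mulf_neq0.
have H : diff_quotient f x (c *: v) @ 0^' --> c *: df (x, v).
  have cc : (fun=> c) @ (0 : R)^' --> c by exact: cvg_cst.
  apply: (cvg_rw (cvg_scale cc (cvg_comp _ _ ch (@fdf x v Ux)))) => // h /=.
  rewrite /diff_quotient scalerA invfM mulrA mulfV// mul1r.
  by rewrite scalerA mulrC.
exact: (S2_lim_uniq (@fdf x (c *: v) Ux) H).
Qed.

Lemma second_derivative_sym (ddf : tangent (tangent E) -> S2 M) x v w :
  (forall z w : tangent E, U z.1 -> diff_quotient df z w @ 0^' --> ddf (z, w)) -> U x ->
  {for (((x, v), (w, 0)) : tangent (tangent E)), continuous ddf} ->
  {for (((x, w), (v, 0)) : tangent (tangent E)), continuous ddf} ->
  ddf ((x, v), (w, 0)) = ddf ((x, w), (v, 0)).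
Proof.
move=> dfddf Ux c1 c2; apply: S2_ext => i p.
have [ip|ip] := pselect (coords (atlas M i) p); last first.
  by rewrite !(sym2_off (S2_sym2 _) ip).
apply/matrixP => k l; have LamF := @partials_functional R n T M [::] i p k l ip.
exact: (functional_second_derivative_sym Uo fdf dfddf LamF Ux c1 c2).
Qed.

End Derivative.

(** * The cone of metrics is open *)

Section PositiveDefinite.
Context {R : realType} {n : nat}.

Definition posdef (A : 'M[R]_n) := forall v : 'rV[R]_n, v != 0 ->
  0 < (v *m A *m v^T) 0 0.

Lemma posdef_congr (J A : 'M[R]_n) : J \in unitmx -> posdef A ->
  posdef (J *m A *m J^T).
Proof.
move=> Ju Ap v v0.
have vJ0 : v *m J != 0.
  by apply: contra_neq v0 => vJ; rewrite -(mulmxK Ju v) vJ mul0mx.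
by have := Ap _ vJ0; rewrite trmx_mul !mulmxA.
Qed.

(** The quadratic form is positive on the unit sphere, which is compact; by
    homogeneity this is enough. *)
Lemma posdef_near (A : 'M[R]_n) : posdef A -> \forall B \near A, posdef B.
Proof.
move=> Ap; pose S := [set v : 'rV[R]_n | `|v| = 1].
have Sc : compact S.
  apply: bounded_closed_compact.
    by exists 1; split; [exact: num_real|move=> x x1 v /= ->; exact: ltW].
  rewrite (_ : S = (@Num.norm R 'rV[R]_n) @^-1` [set 1]) //.
  by apply: closed_comp; [move=> v _; exact: norm_continuous|exact: closed_eq].
have cov := iffLR (compact_near_coveringP S) Sc.
have SB : \forall B \near A, forall v, S v -> 0 < (v *m B *m v^T) 0 0.
  apply: (cov 'M[R]_n (nbhs A) (fun B v => 0 < (v *m B *m v^T) 0 0) _) => v Sv.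
  have v0 : v != 0 by apply/eqP => v0; move: Sv; rewrite /S /= v0 normr0 => /eqP; rewrite eq_sym oner_eq0.
  have c : (z.1 *m z.2 *m z.1^T) 0 0 @[z --> filter_prod (nbhs v) (nbhs A)] --> (v *m A *m v^T) 0 0.
    apply: cvg_coord; apply: cvg_mulmx; first by apply: cvg_mulmx; [exact: cvg_fst|exact: cvg_snd].
    apply: cvg_mx => i j; under eq_fun do rewrite mxE; rewrite mxE; apply: cvg_coord; exact: cvg_fst.
  exact: c _ (open_nbhs_nbhs (conj (@open_gt R 0) (Ap v v0))).
apply: filterS SB => B SB v v0.
have nv : `|v| != 0 by rewrite normr_eq0.
have Sv : S (`|v|^-1 *: v) by rewrite /S /= normrZ normfV normr_id mulVf.
have := SB _ Sv; rewrite [(_ *: v)^T]linearZ /= -scalemxAr -!scalemxAl scalerA mxE.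
by rewrite pmulr_rgt0// mulr_gt0// invr_gt0 normr_gt0.
Qed.

End PositiveDefinite.

Section MetricsOpen.
Context {R : realType} {n : nat} {T : topologicalType} {M : manifold R n T}.

Lemma overlap_point i j x : dom (atlas M i) x -> dom (atlas M j) x ->
  overlap (atlas M i) (atlas M j) (cmap (atlas M i) x) /\
  transition (atlas M i) (atlas M j) (cmap (atlas M i) x) = cmap (atlas M j) x.
Proof.
move=> ix jx; split; first by exists x.
by rewrite /transition /= cmapK.
Qed.

(** Positivity in one chart around a point implies it in all the others by the
    tensor law, so one chart is enough near each point, and the manifold is
    compact. *)
Lemma metrics_nbhs (g : S2 M) : closed_manifold M -> metrics g -> nbhs g metrics.
Proof.
move=> [_ Tc] gM.
have cov := iffLR (compact_near_coveringP _) Tc.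
suff : \forall g' \near g, forall x : T, [set: T] x -> forall i, dom (atlas M i) x ->
    posdef ((g' : S2 M) i (cmap (atlas M i) x)).
  apply: filterS => g' g'P i _ [x ix <-]; exact: g'P.
apply: (cov (S2 M) (nbhs g) (fun (g' : S2 M) x => forall i, dom (atlas M i) x ->
    posdef (g' i (cmap (atlas M i) x))) _) => x0 _.
have [j jx0] := atlas_cover M x0.
have gx : (z.2 : S2 M) j (cmap (atlas M j) z.1) @[z --> filter_prod (nbhs x0) (nbhs g)]
    --> g j (cmap (atlas M j) x0).
  have jc : coords (atlas M j) (cmap (atlas M j) x0) by exists x0.
  have c2 : z.2 @[z --> filter_prod (nbhs x0) (nbhs g)] --> g by exact: cvg_snd.
  have c1 : cmap (atlas M j) z.1 @[z --> filter_prod (nbhs x0) (nbhs g)]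
      --> cmap (atlas M j) x0.
    have cm : cmap (atlas M j) x @[x --> x0] --> cmap (atlas M j) x0.
      exact: cmap_continuous.
    exact: (cvg_comp _ _ cvg_fst cm).
  exact: (S2_eval_cvg (ks := [::]) jc c2 c1).
have gj : posdef (g j (cmap (atlas M j) x0)) by apply: gM; exists x0.
have pd := gx _ (posdef_near gj).
have jd : \forall z \near filter_prod (nbhs x0) (nbhs g), dom (atlas M j) z.1.
  by apply: near_fst; exact: (open_nbhs_nbhs (conj (dom_open (atlas M j)) jx0)).
near=> z => /= i iz.
have jz : dom (atlas M j) z.1 by near: z.
have [ov tr] := overlap_point iz jz.
rewrite (sym2_tensor (S2_sym2 z.2) ov) tr; apply: posdef_congr.
  exact: jac_unitmx gM ov.
by near: z.
Unshelve. all: by end_near. Qed.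

Lemma metrics_open : closed_manifold M -> open (@metrics _ _ _ M).
Proof. by move=> Mc; rewrite openE => g gM; exact: metrics_nbhs. Qed.

End MetricsOpen.

(** * Smooth convergence of matrix fields *)

Lemma diff_quotient_invmx (R : realType) (E : lmodType R) q (f : E -> 'M[R]_q) x v (df : 'M[R]_q) :
  f x \in unitmx ->
  diff_quotient f x v @ 0^' --> df ->
  diff_quotient (fun y => invmx (f y)) x v @ 0^' -->
    (-1 : R) *: (invmx (f x) *m df *m invmx (f x)).
Proof.
move=> fxu fdf; have fx := cvg_line fdf.
have := fxu; rewrite unitmxE unitfE => dfx0.
have H : (-1 : R) *: (invmx (f (h *: v + x)) *m diff_quotient f x v h *m invmx (f x))
    @[h --> 0^'] --> (-1 : R) *: (invmx (f x) *m df *m invmx (f x)).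
  apply: cvgZl_tmp; apply: cvg_mulmx; last exact: cvg_cst.
  by apply: cvg_mulmx; [exact: cvg_invmx|exact: fdf].
apply: cvg_trans H; apply: near_eq_cvg.
have /(cvg_det fx) nz : nbhs (\det (f x)) [set y : R | y != 0].
  by apply: open_nbhs_nbhs; split => //; exact: open_neq.
move: nz; rewrite nbhs_simpl /=; apply: filterS => h /=.
rewrite -unitfE -unitmxE => fhU.
rewrite /diff_quotient -scalemxAr -scalemxAl mulmxBr mulmxBl.
rewrite mulVmx// mul1mx -mulmxA mulmxV// mulmx1.
by rewrite scalerA mulN1r scaleNr -scalerN opprB.
Qed.

Section SmoothConvergence.
Context {R : realType} {n : nat} (U : set 'rV[R]_n) (Uo : open U).
Context {X : Type} {F : set_system X} {FF : Filter F}.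
Implicit Types (u v : X -> 'rV[R]_n -> 'M[R]_n) (f l : 'rV[R]_n -> 'M[R]_n).

Let D (k : 'I_n) f := 'D_(delta_mx 0 k) f.

(** Convergence of all partial derivatives of order at most [m].  The truncation
    at [m] is for the inductions on the order in the Leibniz rules below. *)
Definition Cm_cvg m u l := forall ks p0, (size ks <= m)%N -> U p0 ->
  partials ks (u z.1) z.2 @[z --> filter_prod F (nbhs p0)] --> partials ks l p0.

(** What the topology of [S2] says about one chart, for fields of matrices which
    need not be symmetric or come from tensors, such as [g^-1]. *)
Definition smooth_cvg u l := [/\ \forall x \near F, smooth_on U (u x),
  smooth_on U l & forall m, Cm_cvg m u l].

Lemma near_in p0 : U p0 -> \forall z \near filter_prod F (nbhs p0), U z.2.
Proof. by move=> Up0; apply: near_snd; exact: (open_nbhs_nbhs (conj Uo Up0)). Qed.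

Lemma partials_rcons ks k f : partials (rcons ks k) f = partials ks (D k f).
Proof. by rewrite /partials foldr_rcons. Qed.

(** Splits off the innermost derivative, so that the algebraic rules for a single
    derivative apply to the fields themselves. *)
Lemma Cm_cvgS m u l : Cm_cvg m.+1 u l <->
  Cm_cvg 0 u l /\ forall k, Cm_cvg m (fun x => D k (u x)) (D k l).
Proof.
split=> [ul|[u0 uD]].
  split=> [ks p0|k ks p0 ksm Up0]; first by case: ks => // _; exact: (ul [::]).
  rewrite -partials_rcons; under eq_fun do rewrite -partials_rcons.
  by apply: ul => //; rewrite size_rcons.
move=> ks p0; case/lastP: ks => [|ks k]; first by move=> _; exact: (u0 [::]).
rewrite size_rcons ltnS => ksm Up0.
by rewrite partials_rcons; under eq_fun do rewrite partials_rcons; exact: uD.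
Qed.

Lemma Cm_cvg_le m m' u l : (m <= m')%N -> Cm_cvg m' u l -> Cm_cvg m u l.
Proof. by move=> mm ul ks p0 ksm; apply: ul; exact: leq_trans mm. Qed.

Lemma Cm_cvg_ext m u v l l' :
  (\forall x \near F, forall p, U p -> u x p = v x p) -> (forall p, U p -> l p = l' p) ->
  Cm_cvg m u l -> Cm_cvg m v l'.
Proof.
move=> uv ll ul ks p0 ksm Up0; rewrite -(partials_ext ks Uo ll Up0).
apply: cvg_trans (ul ks p0 ksm Up0); apply: near_eq_cvg.
have Uz := near_in Up0.
have uvz : \forall z \near filter_prod F (nbhs p0), forall p, U p -> u z.1 p = v z.1 p.
  exact: near_fst uv.
near=> z; apply: (partials_ext ks Uo); first by near: z.
by near: z.
Unshelve. all: by end_near. Qed.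

Lemma Cm_cvg_lin m u v l l' (c : R) :
  (\forall x \near F, smooth_on U (u x)) -> smooth_on U l ->
  (\forall x \near F, smooth_on U (v x)) -> smooth_on U l' ->
  Cm_cvg m u l -> Cm_cvg m v l' ->
  Cm_cvg m (fun x p => c *: u x p + v x p) (fun p => c *: l p + l' p).
Proof.
move=> us ls vs ls' ul vl ks p0 ksm Up0; rewrite (partials_lin ks c Uo)//.
apply: cvg_trans (cvgD (cvgZl_tmp (k := c) (ul ks p0 ksm Up0)) (vl ks p0 ksm Up0)).
apply: near_eq_cvg.
have Uz := near_in Up0.
have usz : \forall z \near filter_prod F (nbhs p0), smooth_on U (u z.1) by exact: near_fst us.
have vsz : \forall z \near filter_prod F (nbhs p0), smooth_on U (v z.1) by exact: near_fst vs.
near=> z; rewrite (partials_lin ks c Uo)//; by near: z.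
Unshelve. all: by end_near. Qed.

Lemma smooth_derive k f : smooth_on U f -> smooth_on U (D k f).
Proof. by move=> fs j; exact: (Ck_derive _ Uo (fs j.+1)). Qed.

Lemma smooth_mulmx f l : smooth_on U f -> smooth_on U l ->
  smooth_on U (fun p => f p *m l p).
Proof. by move=> fs ls j; exact: Ck_mulmx. Qed.

Lemma smooth_lin (c : R) f l : smooth_on U f -> smooth_on U l ->
  smooth_on U (fun p => c *: f p + l p).
Proof. by move=> fs ls j; apply: CkD => //; exact: CkZ. Qed.

Lemma derive_mulmx k f l p : smooth_on U f -> smooth_on U l -> U p ->
  D k (fun p => f p *m l p) p = D k f p *m l p + f p *m D k l p.
Proof.
move=> fs ls Up; apply: diff_quotient_derive.
by apply: diff_quotient_mulmx; [exact: (Ck_derivable (fs 1%N))|exact: (Ck_derivable (ls 1%N))].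
Qed.

(** By induction on the order with the Leibniz rule. *)
Lemma Cm_cvg_mulmx m u v l l' :
  (\forall x \near F, smooth_on U (u x)) -> smooth_on U l ->
  (\forall x \near F, smooth_on U (v x)) -> smooth_on U l' ->
  Cm_cvg m u l -> Cm_cvg m v l' ->
  Cm_cvg m (fun x p => u x p *m v x p) (fun p => l p *m l' p).
Proof.
elim: m u v l l' => [|m IHm] u v l l' us ls vs ls' ul vl.
  move=> ks p0; case: ks => // _ Up0 /=.
  exact: cvg_mulmx (ul [::] p0 _ Up0) (vl [::] p0 _ Up0).
apply/Cm_cvgS; split.
  move=> ks p0; case: ks => // _ Up0 /=.
  exact: cvg_mulmx (ul [::] p0 _ Up0) (vl [::] p0 _ Up0).
move=> k; have [_ /(_ k) uD] := iffLR (Cm_cvgS _ _ _) ul.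
have [_ /(_ k) vD] := iffLR (Cm_cvgS _ _ _) vl.
have u0 := Cm_cvg_le (leqnSn m) ul; have v0 := Cm_cvg_le (leqnSn m) vl.
have uDs : \forall x \near F, smooth_on U (D k (u x)).
  by apply: filterS us => x; exact: smooth_derive.
have vDs : \forall x \near F, smooth_on U (D k (v x)).
  by apply: filterS vs => x; exact: smooth_derive.
have lDs := smooth_derive k ls; have lDs' := smooth_derive k ls'.
apply: (Cm_cvg_ext (u := fun x p => 1 *: (D k (u x) p *m v x p) + u x p *m D k (v x) p)
  (l := fun p => 1 *: (D k l p *m l' p) + l p *m D k l' p)).
- near=> x => p Up; rewrite derive_mulmx//; first by rewrite scale1r.
    by near: x.
  by near: x.
- by move=> p Up; rewrite derive_mulmx// scale1r.
- have s1 : \forall x \near F, smooth_on U (fun p => D k (u x) p *m v x p).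
    by near=> x; apply: smooth_mulmx; near: x.
  have s2 : \forall x \near F, smooth_on U (fun p => u x p *m D k (v x) p).
    by near=> x; apply: smooth_mulmx; near: x.
  have s3 := smooth_mulmx lDs ls'; have s4 := smooth_mulmx ls lDs'.
  have c1 := IHm _ _ _ _ uDs lDs vs ls' uD v0.
  have c2 := IHm _ _ _ _ us ls vDs lDs' u0 vD.
  exact: (Cm_cvg_lin (c := 1) s1 s3 s2 s4 c1 c2).
Unshelve. all: by end_near. Qed.

Lemma smooth_invmx f : (forall p, U p -> f p \in unitmx) -> smooth_on U f ->
  smooth_on U (fun p => invmx (f p)).
Proof. by move=> fU fs j; exact: Ck_invmx. Qed.

Lemma derive_invmx k f p : (forall p, U p -> f p \in unitmx) -> smooth_on U f -> U p ->
  D k (fun p => invmx (f p)) p = (-1 : R) *: (invmx (f p) *m D k f p *m invmx (f p)) + 0.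
Proof.
move=> fU fs Up; rewrite addr0; apply: diff_quotient_derive.
by apply: diff_quotient_invmx; [exact: fU|exact: (Ck_derivable (fs 1%N))].
Qed.

Lemma Cm_cvg_cst m (f : 'rV[R]_n -> 'M[R]_n) : smooth_on U f -> Cm_cvg m (fun _ => f) f.
Proof.
move=> fs ks p0 _ Up0.
have c : partials ks f x @[x --> p0] --> partials ks f p0.
  exact: smooth_continuous (smooth_partials ks Uo fs) Up0.
exact: (cvg_comp _ _ cvg_snd c).
Qed.

Lemma smooth_cst (c : 'M[R]_n) : smooth_on U (fun _ => c).
Proof. by move=> j; exact: Ck_cst. Qed.

(** By induction on the order with [d (u^-1) = - u^-1 (d u) u^-1]. *)
Lemma Cm_cvg_invmx m u l :
  (\forall x \near F, smooth_on U (u x)) -> smooth_on U l ->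
  (\forall x \near F, forall p, U p -> u x p \in unitmx) ->
  (forall p, U p -> l p \in unitmx) ->
  Cm_cvg m u l -> Cm_cvg m (fun x p => invmx (u x p)) (fun p => invmx (l p)).
Proof.
move=> us ls uU lU; elim: m => [|m IHm] ul.
  move=> ks p0; case: ks => // _ Up0 /=.
  exact: cvg_invmx (lU _ Up0) (ul [::] p0 _ Up0).
apply/Cm_cvgS; split.
  move=> ks p0; case: ks => // _ Up0 /=.
  exact: cvg_invmx (lU _ Up0) (ul [::] p0 _ Up0).
move=> k; have [_ /(_ k) uD] := iffLR (Cm_cvgS _ _ _) ul.
have uV := IHm (Cm_cvg_le (leqnSn m) ul).
have uDs : \forall x \near F, smooth_on U (D k (u x)).
  by apply: filterS us => x; exact: smooth_derive.
have lDs := smooth_derive k ls.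
have lVs := smooth_invmx lU ls.
have uVs : \forall x \near F, smooth_on U (fun p => invmx (u x p)).
  by near=> x; apply: smooth_invmx; near: x.
have uVDs : \forall x \near F, smooth_on U (fun p => invmx (u x p) *m D k (u x) p).
  by near=> x; apply: smooth_mulmx; near: x.
have zs := smooth_cst 0.
apply: (Cm_cvg_ext (u := fun x p => (-1 : R) *: (invmx (u x p) *m D k (u x) p *m invmx (u x p)) + 0)
  (l := fun p => (-1 : R) *: (invmx (l p) *m D k l p *m invmx (l p)) + 0)).
- near=> x => p Up; rewrite derive_invmx//; by near: x.
- by move=> p Up; rewrite derive_invmx.
- have s1 : \forall x \near F,
      smooth_on U (fun p => invmx (u x p) *m D k (u x) p *m invmx (u x p)).
    by near=> x; apply: smooth_mulmx; near: x.
  have ls1 := smooth_mulmx lVs lDs; have ls2 := smooth_mulmx ls1 lVs.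
  have zs' : \forall x \near F, smooth_on U (fun _ => 0 : 'M[R]_n) by exact: nearW.
  have c1 := Cm_cvg_mulmx uVs lVs uDs lDs uV uD.
  have c2 := Cm_cvg_mulmx uVDs ls1 uVs lVs c1 uV.
  exact: (Cm_cvg_lin s1 ls2 zs' zs c2 (Cm_cvg_cst zs)).
Unshelve. all: by end_near. Qed.

Lemma smooth_trace f : smooth_on U f -> smooth_on U (fun p => trace_mx (f p)).
Proof. by move=> fs j; exact: Ck_trace. Qed.

Lemma derive_trace k f p : smooth_on U f -> U p ->
  D k (fun p => trace_mx (f p)) p = trace_mx (D k f p).
Proof.
move=> fs Up; apply: diff_quotient_derive.
have H := Ck_derivable (v := delta_mx 0 k) (fs 1%N) Up.
apply: (cvg_rw (cvg_comp _ _ H (@continuous_trace_mx R n _))) => // h /=.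
by rewrite /diff_quotient linearZ (raddfB (@trace_mx R n)).
Qed.

Lemma Cm_cvg_trace m u l :
  (\forall x \near F, smooth_on U (u x)) -> smooth_on U l ->
  Cm_cvg m u l -> Cm_cvg m (fun x p => trace_mx (u x p)) (fun p => trace_mx (l p)).
Proof.
elim: m u l => [|m IHm] u l us ls ul.
  move=> ks p0; case: ks => // _ Up0 /=.
  exact: cvg_comp _ _ (ul [::] p0 _ Up0) (@continuous_trace_mx R n _).
apply/Cm_cvgS; split.
  move=> ks p0; case: ks => // _ Up0 /=.
  exact: cvg_comp _ _ (ul [::] p0 _ Up0) (@continuous_trace_mx R n _).
move=> k; have [_ /(_ k) uD] := iffLR (Cm_cvgS _ _ _) ul.
apply: (Cm_cvg_ext (u := fun x p => trace_mx (D k (u x) p)) (l := fun p => trace_mx (D k l p))).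
- by near=> x => p Up; rewrite derive_trace//; near: x.
- by move=> p Up; rewrite derive_trace.
- apply: IHm => //; last exact: smooth_derive.
  by apply: filterS us => x; exact: smooth_derive.
Unshelve. all: by end_near. Qed.

Lemma smooth_cvg_ext u v l :
  (\forall x \near F, forall p, U p -> u x p = v x p) -> smooth_cvg u l -> smooth_cvg v l.
Proof.
move=> uv [us ls ul]; split=> //; last by move=> m; exact: Cm_cvg_ext (ul m).
by near=> x => k; apply: (Ck_ext (f := u x)) => //; [near: x|move: k; near: x].
Unshelve. all: by end_near. Qed.

Lemma smooth_cvg_cst f : smooth_on U f -> smooth_cvg (fun _ => f) f.
Proof. by move=> fs; split=> // [|m]; [exact: nearW|exact: Cm_cvg_cst]. Qed.

Lemma smooth_cvg_lin (c : R) u v l l' : smooth_cvg u l -> smooth_cvg v l' ->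
  smooth_cvg (fun x p => c *: u x p + v x p) (fun p => c *: l p + l' p).
Proof.
move=> [us ls ul] [vs ls' vl]; split.
- by near=> x; apply: smooth_lin; near: x.
- exact: smooth_lin.
- by move=> m; exact: Cm_cvg_lin.
Unshelve. all: by end_near. Qed.

Lemma smooth_cvg_mulmx u v l l' : smooth_cvg u l -> smooth_cvg v l' ->
  smooth_cvg (fun x p => u x p *m v x p) (fun p => l p *m l' p).
Proof.
move=> [us ls ul] [vs ls' vl]; split.
- by near=> x; apply: smooth_mulmx; near: x.
- exact: smooth_mulmx.
- by move=> m; exact: Cm_cvg_mulmx.
Unshelve. all: by end_near. Qed.

Lemma smooth_cvg_trace u l : smooth_cvg u l ->
  smooth_cvg (fun x p => trace_mx (u x p)) (fun p => trace_mx (l p)).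
Proof.
move=> [us ls ul]; split.
- by apply: filterS us => x; exact: smooth_trace.
- exact: smooth_trace.
- by move=> m; exact: Cm_cvg_trace.
Qed.

Lemma smooth_cvg_invmx u l :
  (\forall x \near F, forall p, U p -> u x p \in unitmx) ->
  (forall p, U p -> l p \in unitmx) -> smooth_cvg u l ->
  smooth_cvg (fun x p => invmx (u x p)) (fun p => invmx (l p)).
Proof.
move=> uU lU [us ls ul]; split.
- by near=> x; apply: smooth_invmx; near: x.
- exact: smooth_invmx.
- by move=> m; exact: Cm_cvg_invmx.
Unshelve. all: by end_near. Qed.

End SmoothConvergence.

(** * The derivative of the Christoffel term *)

(** Matrix identities that hold in every associative algebra: both sides are
    expanded into monomials, which are then handled entrywise as scalars. *)
Ltac expand_mx := rewrite ?(mulmxDl, mulmxDr, mulmxBl, mulmxBr, mulNmx, mulmxN,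
  =^~ scalemxAl, =^~ scalemxAr, mulmxA, mxtraceD, mxtraceZ, raddfN, mulmx0, mul0mx, mxtrace0)/=.
Ltac monomials := repeat match goal with
  | |- context [@mulmx ?S ?m ?n ?p ?A ?B] =>
      let x := fresh "m" in set x := (@mulmx S m n p A B); clearbody x
  end;
  repeat match goal with
  | |- context [@mxtrace ?S ?n ?A] =>
      let x := fresh "t" in set x := (@mxtrace S n A); clearbody x
  end.
Ltac mx_algebra := do !expand_mx; monomials;
  apply/matrixP => ? ?; rewrite !mxE; by field.

Section LimitTensor.
Context {R : realType} {n : nat} {T : topologicalType} {M : manifold R n T}.

Lemma smooth_cvg_S2 (X : Type) (F : set_system X) {FF : Filter F} (u : X -> S2 M)
    (l : S2 M) i : u @ F --> l ->
  smooth_cvg (coords (atlas M i)) (F := F) (fun x => u x i) (l i).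
Proof.
move=> /S2_cvgP ul; split.
- by apply: nearW => x; exact: (sym2_smooth (S2_sym2 (u x))).
- exact: (sym2_smooth (S2_sym2 l)).
- by move=> m ks p0 _ ip0; exact: ul.
Qed.

Lemma smooth_cvg_point (U : set 'rV[R]_n) (X : Type) (F : set_system X) {FF : Filter F}
    (u : X -> 'rV[R]_n -> 'M[R]_n) l p :
  smooth_cvg U (F := F) u l -> U p -> u x p @[x --> F] --> l p.
Proof.
move=> [_ _ ul] Up; have c := ul 0%N [::] p isT Up.
have cp : (fun=> p) @ F --> p by exact: cvg_cst.
exact: (cvg_comp _ _ (cvg_pair (cvg_id (F := F)) cp) c).
Qed.

(** Symmetry and the tensor law pass to pointwise limits, so convergence chart by
    chart gives a limit in [S2]. *)
Lemma S2_limit (X : Type) (F : set_system X) {FF : ProperFilter F} (u : X -> S2 M)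
    (l : chart_index M -> 'rV[R]_n -> 'M[R]_n) :
  (forall i p, ~ coords (atlas M i) p -> l i p = 0) ->
  (forall i, smooth_cvg (coords (atlas M i)) (F := F) (fun x => u x i) (l i)) ->
  exists2 L : S2 M, (forall i p, L i p = l i p) & u @ F --> L.
Proof.
move=> l0 ul; have lS : is_sym2 l.
  split=> //.
  - by move=> i; have [] := ul i.
  - move=> i p; have [ip|ip] := pselect (coords (atlas M i) p); last first.
      by rewrite l0// trmx0.
    have c : u x i p @[x --> F] --> l i p by exact: smooth_cvg_point (ul i) ip.
    have ct : (u x i p)^T @[x --> F] --> (l i p)^T.
      apply: cvg_mx => k m; under eq_fun do rewrite mxE; rewrite mxE.
      exact: cvg_coord c.
    apply: (norm_cvg_unique ct); apply: (cvg_rw c) => // x.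
    by rewrite (sym2_sym (S2_sym2 (u x))).
  - move=> i j p ijp; have [ip jp] := overlap_coords ijp.
    have ci : u x i p @[x --> F] --> l i p by exact: smooth_cvg_point (ul i) ip.
    have cj : u x j (transition (atlas M i) (atlas M j) p) @[x --> F] -->
        l j (transition (atlas M i) (atlas M j) p) by exact: smooth_cvg_point (ul j) jp.
    have cJ : jac i j p *m u x j (transition (atlas M i) (atlas M j) p) *m (jac i j p)^T
      @[x --> F] --> jac i j p *m l j (transition (atlas M i) (atlas M j) p) *m (jac i j p)^T.
      by apply: cvg_mulmx; [apply: cvg_mulmx => //; exact: cvg_cst|exact: cvg_cst].
    apply: (norm_cvg_unique ci); apply: (cvg_rw cJ) => // x.
    by rewrite -(sym2_tensor (S2_sym2 (u x)) ijp).
exists (MkS2 (asboolT lS)) => //; apply/S2_cvgP => i ks p0 ip0 /=.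
by have [_ _ /(_ (size ks) ks p0 (leqnn _) ip0)] := ul i.
Qed.

End LimitTensor.

Lemma dnbhs0_filter (R : realType) : Filter (0 : R)^'.
Proof. exact: dnbhs_filter. Qed.

Section FamilyDerivative.
Context {R : realType} {n : nat} (U : set 'rV[R]_n) (Uo : open U).
Let F0 := @dnbhs0_filter R.
Implicit Types (u v : R -> 'rV[R]_n -> 'M[R]_n) (f l : 'rV[R]_n -> 'M[R]_n).

Definition family_quotient u f : R -> 'rV[R]_n -> 'M[R]_n :=
  fun h p => h^-1 *: (u h p - f p).

(** As [h] tends to 0, the fields [u h] tend to [f] and their difference quotients
    to [l].  The property is stable under algebraic operations, so that a formula
    in the fields can be differentiated step by step. *)
Record family_derivative u f l : Prop := FamilyDerivative {
  family_cvg : smooth_cvg U (F := (0 : R)^') u f;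
  family_quotient_cvg : smooth_cvg U (F := (0 : R)^') (family_quotient u f) l
}.

Lemma family_derivative_ext u v f f' l l' :
  (forall h p, u h p = v h p) -> (forall p, f p = f' p) -> (forall p, l p = l' p) ->
  family_derivative u f l -> family_derivative v f' l'.
Proof.
move=> uv ff ll; have -> : u = v by apply/funext => h; apply/funext => p.
have <- : f = f' by exact/funext.
by have <- : l = l' by exact/funext.
Qed.

Lemma family_derivative_lin (c : R) u f l v f' l' :
  family_derivative u f l -> family_derivative v f' l' ->
  family_derivative (fun h p => c *: u h p + v h p) (fun p => c *: f p + f' p)
    (fun p => c *: l p + l' p).
Proof.
move=> [uf ul] [vf vl]; split; first exact: smooth_cvg_lin.
apply: (smooth_cvg_ext Uo _ (smooth_cvg_lin (FF := F0) Uo c ul vl)); apply: nearW => h p _.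
rewrite /family_quotient opprD addrACA -scalerBr [RHS]scalerDr; congr (_ + _).
by rewrite !scalerA mulrC.
Qed.

(** The derivative is in the form [c *: _ + _], so that sums of products are
    instances of [family_derivative_lin]. *)
Lemma family_derivative_mulmx u f l v f' l' :
  family_derivative u f l -> family_derivative v f' l' ->
  family_derivative (fun h p => u h p *m v h p) (fun p => f p *m f' p)
    (fun p => 1 *: (l p *m f' p) + f p *m l' p).
Proof.
move=> [uf ul] [vf vl]; split; first exact: smooth_cvg_mulmx.
have [_ fs _] := uf; have cf := smooth_cvg_cst (FF := F0) Uo fs.
have c := smooth_cvg_lin (FF := F0) Uo 1 (smooth_cvg_mulmx (FF := F0) Uo ul vf) (smooth_cvg_mulmx (FF := F0) Uo cf vl).
apply: (smooth_cvg_ext Uo _ c); apply: nearW => h p _.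
rewrite /family_quotient scale1r -scalemxAl -scalemxAr -scalerDr mulmxBl mulmxBr.
by rewrite addrA subrK.
Qed.

Lemma family_derivative_trace u f l : family_derivative u f l ->
  family_derivative (fun h p => trace_mx (u h p)) (fun p => trace_mx (f p))
    (fun p => trace_mx (l p)).
Proof.
move=> [uf ul]; split; first exact: smooth_cvg_trace.
apply: (smooth_cvg_ext Uo _ (smooth_cvg_trace Uo ul)); apply: nearW => h p _.
by rewrite /family_quotient linearZ (raddfB (@trace_mx R n)).
Qed.

Lemma family_derivative_invmx u f l :
  (\forall h \near (0 : R)^', forall p, U p -> u h p \in unitmx) ->
  (forall p, U p -> f p \in unitmx) -> family_derivative u f l ->
  family_derivative (fun h p => invmx (u h p)) (fun p => invmx (f p))
    (fun p => (-1) *: (invmx (f p) *m l p *m invmx (f p)) + 0).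
Proof.
move=> uU fU [uf ul]; have cV := smooth_cvg_invmx (FF := F0) Uo uU fU uf; split; first exact: cV.
have [_ fVs _] := cV; have cf := smooth_cvg_cst (FF := F0) Uo fVs.
have c0 := smooth_cvg_cst (FF := F0) Uo (smooth_cst U 0).
have c := smooth_cvg_lin (FF := F0) Uo (-1) (smooth_cvg_mulmx (FF := F0) Uo (smooth_cvg_mulmx (FF := F0) Uo cV ul) cf) c0.
apply: (smooth_cvg_ext Uo _ c); apply: filterS uU => h uU p Up.
rewrite /family_quotient -scalemxAr -scalemxAl mulmxBr mulmxBl.
rewrite mulVmx ?uU// mul1mx -mulmxA mulmxV ?fU// mulmx1 addr0.
by rewrite scalerA mulN1r scaleNr -scalerN opprB.
Qed.

End FamilyDerivative.

Section ChristoffelDerivative.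
Context {R : realType} {n : nat} {T : topologicalType} {M : manifold R n T}.
Hypothesis M_closed : closed_manifold M.

Lemma S2_quotient_cvg (G : R -> S2 M) (g a : S2 M) :
  h^-1 *: (G h - g) @[h --> (0 : R)^'] --> a -> G @ (0 : R)^' --> g.
Proof.
move=> Ga; rewrite -[g]add0r -(scale0r a).
have H : h *: (h^-1 *: (G h - g)) + g @[h --> (0 : R)^'] --> 0 *: a + g.
  by apply: cvg_add; [apply: cvg_scale => //; exact: (@cvg_dnbhs0 R)|exact: cvg_cst].
apply: cvg_trans H; apply: near_eq_cvg; apply: filterS (@near_dnbhs0 R) => h h0.
by rewrite scalerA mulfV// scale1r subrK.
Qed.

Lemma family_derivative_S2 (G : R -> S2 M) (g a : S2 M) i :
  h^-1 *: (G h - g) @[h --> (0 : R)^'] --> a ->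
  family_derivative (coords (atlas M i)) (fun h => G h i) (g i) (a i).
Proof.
move=> Ga; split; first exact: smooth_cvg_S2 (S2_quotient_cvg Ga).
exact: (@smooth_cvg_S2 _ _ _ _ _ _ _ _ _ i Ga).
Qed.

(** The derivative of [christoffel g b c] with respect to [g], in the direction [a]. *)
Definition christoffel_deriv (g a b c : S2 M) i p : 'M[R]_n :=
  let gi := invmx (g i p) in
  2^-1 *: (b i p *m gi *m a i p *m gi *m c i p + c i p *m gi *m a i p *m gi *m b i p)
  - 8^-1 *: (\tr (gi *m a i p *m gi *m b i p) *: c i p
           + \tr (gi *m a i p *m gi *m c i p) *: b i p).

(** Traces become matrices and every sum gets the form [c *: _ + _], to match the
    rules for [family_derivative]. *)
Lemma christoffel_comp_trace (g a b : S2 M) i p : christoffel_comp g a b i p =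
  - 2^-1 *: (1 *: (a i p *m raise g b i p) + b i p *m raise g a i p) +
  (8^-1 *: (1 *: (trace_mx (raise g a i p) *m b i p) + trace_mx (raise g b i p) *m a i p) + 0).
Proof. by rewrite /trace_mx !mul_scalar_mx !scale1r addr0. Qed.

Lemma trace_mxE q (A : 'M[R]_q) (c : 'M[R]_q) : trace_mx A *m c = \tr A *: c.
Proof. exact: mul_scalar_mx. Qed.

(** The rule for differentiating the Christoffel term along a curve in all its
    three arguments.  The metrics being open, the curve stays in the domain of
    [christoffel]. *)
Lemma christoffel_quotient_cvg (G b c : R -> S2 M) (g a b0 b' c0 c' : S2 M) :
  metrics g ->
  h^-1 *: (G h - g) @[h --> (0 : R)^'] --> a ->
  h^-1 *: (b h - b0) @[h --> (0 : R)^'] --> b' ->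
  h^-1 *: (c h - c0) @[h --> (0 : R)^'] --> c' ->
  exists2 L : S2 M, (forall i p, L i p = christoffel g b' c0 i p
      + christoffel g b0 c' i p + christoffel_deriv g a b0 c0 i p) &
    h^-1 *: (christoffel (G h) (b h) (c h) - christoffel g b0 c0) @[h --> (0 : R)^'] --> L.
Proof.
move=> gM Ga bb cc.
have GM : \forall h \near (0 : R)^', metrics (G h).
  exact: (S2_quotient_cvg Ga (metrics_nbhs M_closed gM)).
apply: S2_limit.
  move=> i p ip; rewrite !(sym2_off (S2_sym2 _) ip) /christoffel_deriv.
  by rewrite !(sym2_off (S2_sym2 _) ip) !mul0mx !addr0 !scaler0 addr0 scaler0 subr0 addr0.
move=> i; pose Ui := coords (atlas M i); have Uo : open Ui by exact: coords_openP.
have fG := family_derivative_S2 i Ga.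
have fb := family_derivative_S2 i bb.
have fc := family_derivative_S2 i cc.
have GU : \forall h \near (0 : R)^', forall p, Ui p -> G h i p \in unitmx.
  by apply: filterS GM => h hM p; exact: metrics_unitmx.
have gU p : Ui p -> g i p \in unitmx by exact: metrics_unitmx.
have fV := family_derivative_invmx Uo GU gU fG.
have fB := family_derivative_mulmx Uo fV fb.
have fC := family_derivative_mulmx Uo fV fc.
have z := smooth_cst Ui (0 : 'M[R]_n).
have f0 : family_derivative Ui (fun _ _ => 0) (fun _ => 0) (fun _ => 0).
  have c00 := smooth_cvg_cst (FF := @dnbhs0_filter R) Uo z; split => //.
  by apply: (smooth_cvg_ext Uo _ c00); apply: nearW => h p _; rewrite /family_quotient subrr scaler0.
have f1 := family_derivative_lin Uo (- 2^-1) (family_derivative_lin Uo 1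
  (family_derivative_mulmx Uo fb fC) (family_derivative_mulmx Uo fc fB))
  (family_derivative_lin Uo 8^-1 (family_derivative_lin Uo 1
    (family_derivative_mulmx Uo (family_derivative_trace Uo fB) fc)
    (family_derivative_mulmx Uo (family_derivative_trace Uo fC) fb)) f0).
apply: (smooth_cvg_ext Uo (u := family_quotient (fun h => christoffel_comp (G h) (b h) (c h) i)
   (christoffel_comp g b0 c0 i))).
  apply: filterS GM => h hM p Up; rewrite /family_quotient S2_scale S2_add S2_opp.
  by rewrite !christoffelE.
have [_ f1'] : family_derivative Ui
    (fun h => christoffel_comp (G h) (b h) (c h) i) (christoffel_comp g b0 c0 i)
    (fun p => christoffel g b' c0 i p
      + christoffel g b0 c' i p + christoffel_deriv g a b0 c0 i p).
  apply: (family_derivative_ext _ _ _ f1).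
  - by move=> h p; rewrite christoffel_comp_trace.
  - by move=> p; rewrite christoffel_comp_trace.
  - move=> p; rewrite !christoffelE// /christoffel_deriv /raise !trace_mxE.
    move: (g i p) (a i p) (b0 i p) (b' i p) (c0 i p) (c' i p).
    move=> X A B B' C C'; move: (invmx X) => Y; mx_algebra.
exact: f1'.
Qed.

End ChristoffelDerivative.

(** * The curvature *)

Section Curvature.
Context {R : realType} {n : nat} {T : topologicalType} {M : manifold R n T}.
Hypothesis M_closed : closed_manifold M.
Let U : set (S2 M) := metrics.
Let Uo : open U := metrics_open M_closed.

Record C1_field (c : S2 M -> S2 M) (dc : tangent (S2 M) -> S2 M) : Prop := C1Field {
  C1_quotient : forall x v, U x -> diff_quotient c x v @ 0^' --> dc (x, v);
  C1_continuous : forall z, U z.1 -> {for z, continuous dc}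
}.

Lemma C1_fieldP (c : S2 M -> S2 M) : smooth_field c -> exists dc, C1_field c dc.
Proof.
move=> /(_ 1%N) [_ [dc [cdc [dcc _]]]].
by exists dc; split => // z Uz; exact: dcc.
Qed.

Lemma C1_dderiv c dc g v : C1_field c dc -> U g -> dderiv c g v = dc (g, v).
Proof. by move=> [cdc _] Ug; apply: dderivE; exact: cdc. Qed.

Lemma C1_additive c dc g v w : C1_field c dc -> U g ->
  dc (g, v - w) = dc (g, v) - dc (g, w).
Proof.
move=> [cdc dcc] Ug; have H u : {for ((g, u) : tangent (S2 M)), continuous dc} by exact: dcc.
rewrite (derivativeD Uo cdc (- w) Ug (H v)) -scaleN1r (derivativeZ cdc)//.
by rewrite scaleN1r.
Qed.

Lemma C2_fieldP (c : S2 M -> S2 M) : smooth_field c -> exists dc ddc,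
  [/\ C1_field c dc,
      forall z w : tangent (S2 M), U z.1 -> diff_quotient dc z w @ 0^' --> ddc (z, w) &
      forall z : tangent (tangent (S2 M)), U z.1.1 -> {for z, continuous ddc}].
Proof.
move=> /(_ 2%N) [_ [dc [cdc dck]]]; have [dcc [ddc [dcddc [ddcc _]]]] := dck.
exists dc, ddc; split.
- by split => // z; exact: dcc.
- by move=> z w; exact: dcddc.
- by move=> z Uz; exact: ddcc.
Qed.

(** [ddc ((g, b), (a, e))] differentiates [dc (g, b)] while both [g] and [b] move;
    the motion of [b] contributes a first derivative, since [dc] is linear in its
    second argument. *)
Lemma second_derivative_split c dc ddc g b a e :
  C1_field c dc ->
  (forall z w : tangent (S2 M), U z.1 -> diff_quotient dc z w @ 0^' --> ddc (z, w)) ->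
  (forall z : tangent (tangent (S2 M)), U z.1.1 -> {for z, continuous ddc}) ->
  U g -> ddc ((g, b), (a, e)) = ddc ((g, b), (a, 0)) + dc (g, e).
Proof.
move=> cC dcddc ddcc Ug; have [cdc dcc] := cC.
have Uto := open_tangent Uo.
have -> : (a, e) = ((a, 0) : tangent (S2 M)) + (0, e) :> tangent (S2 M).
  by congr pair; rewrite /= ?addr0 ?add0r.
have H : {for (((g, b), (a, 0)) : tangent (tangent (S2 M))), continuous ddc} by exact: ddcc.
rewrite (@derivativeD _ _ _ _ _ _ _ _ Uto (fun z w Uz => dcddc z w Uz) (g, b) _ _ Ug H).
congr (_ + _).
have H2 : diff_quotient dc ((g, b) : tangent (S2 M)) (0, e) @ 0^' --> dc (g, e).
  apply: cvg_near_cst.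
  apply: filterS (@near_dnbhs0 R) => h h0; rewrite /diff_quotient.
  have -> : h *: ((0, e) : tangent (S2 M)) + (g, b) = (g, h *: e + b) :> tangent (S2 M).
    by congr pair; rewrite /= scaler0 add0r.
  have dcg : {for ((g, h *: e) : tangent (S2 M)), continuous dc} by exact: dcc.
  rewrite (derivativeD Uo cdc b Ug dcg) addrK (derivativeZ cdc)//.
  by rewrite scalerA mulVf// scale1r.
exact: (S2_lim_uniq (dcddc (g, b) (0, e) Ug) H2).
Qed.

(** The derivative of [x |-> dc (x, b x) + christoffel x (b x) (c x)].  The chain
    rule for the first summand is [C1_cvg_S2] with the moving direction
    [(a, diff_quotient b g a h)]. *)
Lemma nabla_quotient_cvg b db c dc ddc g a :
  C1_field b db -> C1_field c dc ->
  (forall z w : tangent (S2 M), U z.1 -> diff_quotient dc z w @ 0^' --> ddc (z, w)) ->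
  (forall z : tangent (tangent (S2 M)), U z.1.1 -> {for z, continuous ddc}) ->
  U g -> exists2 L : S2 M, (forall i p, L i p = christoffel g (db (g, a)) (c g) i p
      + christoffel g (b g) (dc (g, a)) i p + christoffel_deriv g a (b g) (c g) i p) &
    dderiv (nabla b c) g a = ddc ((g, b g), (a, 0)) + dc (g, db (g, a)) + L.
Proof.
move=> bC cC dcddc ddcc Ug; have [bdb dbc] := bC; have [cdc dcc] := cC.
have line0 : h^-1 *: ((h *: a + g) - g) @[h --> (0 : R)^'] --> a.
  apply: cvg_near_cst.
  by apply: filterS (@near_dnbhs0 R) => h h0; rewrite addrK scalerA mulVf// scale1r.
have [L LE Lcvg] := christoffel_quotient_cvg M_closed Ug line0 (@bdb g a Ug) (@cdc g a Ug).
exists L => //; apply: dderivE; rewrite -(second_derivative_split _ _ _ cC)//.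
have near_U : \forall h \near (0 : R)^', U (h *: a + g).
  exact: (@cvg_segment _ _ g a U (open_nbhs_nbhs (conj Uo Ug))).
have cy : (fun=> (g, b g)) @ (0 : R)^' --> ((g, b g) : tangent (S2 M)) by exact: cvg_cst.
have cw : (a, diff_quotient b g a h) @[h --> (0 : R)^'] --> ((a, db (g, a)) : tangent (S2 M)).
  have ca : (fun=> a) @ (0 : R)^' --> a by exact: cvg_cst.
  exact: (cvg_pair ca (@bdb g a Ug)).
have ddg : {for (((g, b g), (a, db (g, a))) : tangent (tangent (S2 M))), continuous ddc}.
  exact: ddcc.
have main : h^-1 *: (dc (h *: ((a, diff_quotient b g a h) : tangent (S2 M)) + (g, b g))
    - dc (g, b g)) @[h --> (0 : R)^'] --> ddc ((g, b g), (a, db (g, a))).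
  exact: (@C1_cvg_S2 R n T M (tangent (S2 M)) [set z : tangent (S2 M) | U z.1] dc ddc R 0^' _
    (fun=> (g, b g)) (fun h => (a, diff_quotient b g a h)) id (g, b g) (a, db (g, a))
    (open_tangent Uo) Ug dcddc ddg cy cw (@cvg_dnbhs0 R) (@near_dnbhs0 R)).
apply: cvg_trans (cvg_add main Lcvg); apply: near_eq_cvg.
near=> h; have h0 : h != 0 by near: h; exact: (@near_dnbhs0 R).
have Uh : U (h *: a + g) by near: h.
have E : h *: ((a, diff_quotient b g a h) : tangent (S2 M)) + (g, b g)
    = (h *: a + g, b (h *: a + g)) :> tangent (S2 M).
  by congr pair; rewrite /= /diff_quotient scalerA mulfV// scale1r subrK.
rewrite [RHS]/diff_quotient /nabla (C1_dderiv _ cC Uh) (C1_dderiv _ cC Ug) E -[LHS]scalerDr.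
congr (_ *: _).
by rewrite addrACA -opprD.
Unshelve. all: by end_near. Qed.

(** The Christoffel term read on endomorphisms, [Gamma] of the introduction. *)
Definition gamma_endo (A B : 'M[R]_n) : 'M[R]_n :=
  - 2^-1 *: (A *m B + B *m A) + 8^-1 *: (\tr A *: B + \tr B *: A).

Lemma gamma_endoDr A B C : gamma_endo A (B + C) = gamma_endo A B + gamma_endo A C.
Proof. by rewrite /gamma_endo mulmxDr mulmxDl mxtraceD; monomials; apply/matrixP => ? ?; rewrite !mxE; field. Qed.

Lemma gamma_endoBl A B C : gamma_endo (A - B) C = gamma_endo A C - gamma_endo B C.
Proof.
have tB : \tr (A - B) = \tr A - \tr B by exact: raddfB.
rewrite /gamma_endo mulmxBr mulmxBl tB.
by monomials; apply/matrixP => ? ?; rewrite !mxE; field.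
Qed.

(** [christoffel_deriv] read on endomorphisms: for fixed forms [b] and [c], the
    derivative of [g gamma_endo(g^-1 b, g^-1 c)] in the direction [a] is [g] times
    this. *)
Definition dgamma_endo (A B C : 'M[R]_n) : 'M[R]_n :=
  2^-1 *: (B *m A *m C + C *m A *m B) - 8^-1 *: (\tr (A *m B) *: C + \tr (A *m C) *: B).

(** The algebraic content of the curvature formula. *)
Lemma curvature_endo A B C :
  dgamma_endo A B C - dgamma_endo B A C
    + gamma_endo A (gamma_endo B C) - gamma_endo B (gamma_endo A C) =
  - 4^-1 *: commutator (commutator A B) C - 64^-1 *: (\tr C *: (\tr A *: B - \tr B *: A)).
Proof.
rewrite /gamma_endo /dgamma_endo /commutator.
rewrite !(mulmxDl, mulmxDr, mulNmx, mulmxN) -?scalemxAl -?scalemxAr.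
rewrite !(mulmxDl, mulmxDr, =^~ scalemxAl, =^~ scalemxAr, mulmxA, mxtraceD, mxtraceZ).
rewrite (mxtrace_mulC B A) (mxtrace_mulC C A) (mxtrace_mulC C B).
by monomials; apply/matrixP => ? ?; rewrite !mxE; field.
Qed.

Lemma christoffel_endo (g a b : S2 M) i p : metrics g -> coords (atlas M i) p ->
  christoffel g a b i p = g i p *m gamma_endo (raise g a i p) (raise g b i p).
Proof.
move=> gM ip; rewrite christoffelE// /gamma_endo /raise.
have GY : g i p *m invmx (g i p) = 1%:M by rewrite mulmxV// (metrics_unitmx gM ip).
move: (g i p) (invmx _) (a i p) (b i p) GY => G Y x y GY.
by rewrite !(mulmxDr, =^~ scalemxAr) !(mulmxA G) GY !mul1mx.
Qed.

Lemma christoffel_deriv_endo (g a b c : S2 M) i p : metrics g -> coords (atlas M i) p ->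
  christoffel_deriv g a b c i p =
    g i p *m dgamma_endo (raise g a i p) (raise g b i p) (raise g c i p).
Proof.
move=> gM ip; rewrite /christoffel_deriv /dgamma_endo /raise.
have GY : g i p *m invmx (g i p) = 1%:M by rewrite mulmxV// (metrics_unitmx gM ip).
move: (g i p) (invmx _) (a i p) (b i p) (c i p) GY => G Y x y z GY.
rewrite mulmxBr !(mulmxDr, =^~ scalemxAr) !mulmxA GY !mul1mx.
by [].
Qed.

Lemma raise_christoffel (g a b : S2 M) i p : metrics g -> coords (atlas M i) p ->
  raise g (christoffel g a b) i p = gamma_endo (raise g a i p) (raise g b i p).
Proof.
move=> gM ip; rewrite {1}/raise christoffel_endo// mulKmx//.
exact: metrics_unitmx ip.
Qed.

Lemma curvature_formula (a b c : S2 M -> S2 M) :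
  smooth_field a -> smooth_field b -> smooth_field c ->
  forall g : S2 M, metrics g -> forall (i : chart_index M) (p : 'rV[R]_n),
    let A := raise g (a g) i p in
    let B := raise g (b g) i p in
    let C := raise g (c g) i p in
    curvature a b c g i p =
      - 4^-1 *: (g i p *m commutator (commutator A B) C)
      - 64^-1 *: (\tr C *: (\tr A *: b g i p - \tr B *: a g i p)).
Proof.
move=> /C1_fieldP[da aC] /C1_fieldP[db bC] /C2_fieldP[dc [ddc [cC dcddc ddcc]]].
move=> g gM i p A B C.
have [ip|ip] := pselect (coords (atlas M i) p); last first.
  by rewrite !(sym2_off (S2_sym2 _) ip) mul0mx !scaler0 subrr !scaler0 subrr.
have [L1 L1E n1] := nabla_quotient_cvg (a g) bC cC dcddc ddcc gM.
have [L2 L2E n2] := nabla_quotient_cvg (b g) aC cC dcddc ddcc gM.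
have sym : ddc ((g, b g), (a g, 0)) = ddc ((g, a g), (b g, 0)).
  have [cdc _] := cC.
  by apply: (second_derivative_sym Uo cdc dcddc gM); exact: ddcc.
rewrite /curvature [nabla a (nabla b c) g]/(_ + _) [nabla b (nabla a c) g]/(_ + _).
rewrite [nabla (lie_bracket a b) c g]/(_ + _) n1 n2.
rewrite /lie_bracket !(C1_dderiv _ aC)// !(C1_dderiv _ bC)// !(C1_dderiv _ cC)//.
rewrite (C1_additive _ _ cC)// sym.
rewrite /nabla !(C1_dderiv _ cC)//.
rewrite !(S2_add, S2_opp) L1E L2E !christoffel_endo// !christoffel_deriv_endo//.
have raiseD (x y : S2 M) : raise g (x + y) i p = raise g x i p + raise g y i p.
  exact: mulmxDr.
have raiseB (x y : S2 M) : raise g (x - y) i p = raise g x i p - raise g y i p.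
  exact: mulmxBr.
have gx (x : S2 M) : x i p = g i p *m raise g x i p.
  by rewrite /raise mulKVmx// (metrics_unitmx gM ip).
rewrite raiseB !raiseD !raise_christoffel// 2!gamma_endoDr gamma_endoBl.
rewrite (gx (b g)) (gx (a g)) -/A -/B -/C.
transitivity (g i p *m (- 4^-1 *: commutator (commutator A B) C
    - 64^-1 *: (\tr C *: (\tr A *: B - \tr B *: A)))); last first.
  move: (commutator _ C) => K.
  by rewrite mulmxBr -!scalemxAr mulmxBr -!scalemxAr.
rewrite -curvature_endo !(mulmxBr, mulmxDr).
by monomials; apply/matrixP => ? ?; rewrite !mxE; ring.
Qed.

End Curvature.

(** * Smooth scalar functions and the time change of a geodesic *)

Section ScalarSmoothness.
Context {R : realType}.
Implicit Types E : topologicalLmodType R.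

Lemma diff_quotient_scale (E : lmodType R) (V : normedModType R) (f : E -> R^o) (g : E -> V) x v
    (df : R^o) (dg : V) :
  diff_quotient f x v @ 0^' --> df -> diff_quotient g x v @ 0^' --> dg ->
  diff_quotient (fun y => f y *: g y) x v @ 0^' --> df *: g x + f x *: dg.
Proof.
move=> fdf gdg.
have H : diff_quotient f x v h *: g (h *: v + x) + f x *: diff_quotient g x v h
    @[h --> 0^'] --> df *: g x + f x *: dg.
  apply: cvgD; apply: cvgZ; [exact: fdf| |exact: cvg_cst|exact: gdg].
  exact: cvg_line gdg.
apply: (cvg_rw H) => // h; rewrite /diff_quotient.
rewrite [h^-1 *: (f _ - f x)]/(h^-1 * _) -scalerA [f x *: (h^-1 *: _)]scalerA mulrC.
rewrite -scalerA -[LHS]scalerDr scalerBl scalerBr addrA subrK.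
by [].
Qed.

Lemma Ck_scale k E (V : normedModType R) (U : set E) (f : E -> R^o) (g : E -> V) :
  Ck k U f -> Ck k U g -> Ck k U (fun x => f x *: g x).
Proof.
elim: k E U f g => [|k IHk] E U f g fk gk.
  split; last exact: I.
  by move=> x Ux; apply: cvgZ; [exact: (Ck_continuous fk)|exact: (Ck_continuous gk)].
split; first by move=> x Ux; apply: cvgZ;
  [exact: (Ck_continuous fk)|exact: (Ck_continuous gk)].
have fst_f := Ck_fst (CkS fk); have fst_g := Ck_fst (CkS gk).
case: fk gk => fc [df [fdf dfk]] [gc [dg [gdg dgk]]].
exists ((fun z => df z *: g z.1) \+ (fun z => f z.1 *: dg z)); split; last first.
  by apply: CkD; apply: IHk.
by move=> x v Ux /=; apply: diff_quotient_scale; [exact: fdf|exact: gdg].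
Qed.

Lemma diff_quotient_inv (E : lmodType R) (f : E -> R^o) x v (df : R^o) : f x != 0 ->
  diff_quotient f x v @ 0^' --> df ->
  diff_quotient (fun y => (f y)^-1 : R^o) x v @ 0^' --> ((- 1) *: ((f x)^-1 *: (df *: ((f x)^-1 : R^o)))).
Proof.
move=> fx0 fdf; have fx := cvg_line fdf.
have H : (-1 : R) *: ((f (h *: v + x))^-1 *: (diff_quotient f x v h *: ((f x)^-1 : R^o)))
   @[h --> 0^'] --> ((- 1) *: ((f x)^-1 *: (df *: ((f x)^-1 : R^o)))).
  apply: cvgZl_tmp; apply: cvgZ; first exact: cvgV.
  by apply: cvgZ; [exact: fdf|exact: cvg_cst].
apply: cvg_trans H; apply: near_eq_cvg.
have nz : nbhs (f x) [set y : R^o | y != 0].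
  by apply: open_nbhs_nbhs; split => //; exact: (@open_neq R 0).
have : \forall h \near 0^', f (h *: v + x) != 0 by exact: (fx _ nz).
apply: filterS => h fh0; rewrite /diff_quotient /GRing.scale /=.
have : f x != 0 by []. move: (f (h *: v + x)) (f x) fh0 => a b a0 b0; move: (h^-1) => c.
by rewrite mulN1r mulrCA !mulrA; field; rewrite a0 b0.
Qed.

Lemma Ck_inv k E (U : set E) (f : E -> R^o) : (forall x, U x -> f x != 0) ->
  Ck k U f -> Ck k U (fun x => (f x)^-1 : R^o).
Proof.
have cont (E' : topologicalLmodType R) (U' : set E') (f' : E' -> R^o) j x : f' x != 0 ->
    Ck j U' f' -> U' x -> {for x, continuous (fun x => (f' x)^-1 : R^o)}.
  by move=> fx0 fj Ux; apply: cvgV => //; exact: (Ck_continuous fj).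
elim: k E U f => [|k IHk] E U f f0 fk.
  by split; [move=> x Ux; exact: cont (f0 x Ux) fk Ux|exact: I].
split; first by move=> x Ux; exact: cont (f0 x Ux) fk Ux.
have fst_f : Ck k [set z : tangent E | U z.1] (fun z => (f z.1)^-1 : R^o).
  exact: (Ck_fst (IHk _ _ _ f0 (CkS fk))).
case: fk => fc [df [fdf dfk]].
exists (fun z => (-1 : R) *: ((f z.1)^-1 *: (df z *: ((f z.1)^-1 : R^o)))); split.
  by move=> x v Ux /=; apply: diff_quotient_inv; [exact: f0|exact: fdf].
by apply: CkZ; apply: Ck_scale => //; exact: Ck_scale.
Qed.

(** Restricting to the line through [x] in the direction [v] reduces the claim to
    the chain rule for real functions. *)
Lemma diff_quotient_comp (E : lmodType R) (phi : R -> R) (f : E -> R^o) x v (df : R^o) (d : R) :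
  is_derive (f x) (1 : R) phi d -> diff_quotient f x v @ 0^' --> df ->
  diff_quotient (fun y => phi (f y) : R^o) x v @ 0^' --> (d *: df : R^o).
Proof.
move=> phid fdf.
have fl : is_derive (0 : R) (1 : R) (fun h : R => f (h *: v + x)) df.
  apply: is_derive_diff_quotient; apply: (cvg_rw fdf) => // h.
  by rewrite /diff_quotient scale0r add0r addr0 [h *: 1]mulr1.
have phid' : is_derive ((fun h : R => f (h *: v + x)) 0) (1 : R) phi d.
  by rewrite scale0r add0r.
have /diff_quotient_is_derive H := is_derive1_comp phid' fl.
apply: (cvg_rw H) => // h.
by rewrite /diff_quotient /= scale0r add0r addr0 [h *: 1]mulr1.
Qed.

Lemma Ck_expR k E (U : set E) (f : E -> R^o) :
  Ck k U f -> Ck k U (fun x => expR (f x) : R^o).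
Proof.
have cont (E' : topologicalLmodType R) (U' : set E') (f' : E' -> R^o) j x :
    Ck j U' f' -> U' x -> {for x, continuous (fun x => expR (f' x) : R^o)}.
  move=> fj Ux; have fc := Ck_continuous fj Ux.
  exact: (cvg_comp _ _ fc (@continuous_expR R (f' x))).
elim: k E U f => [|k IHk] E U f fk.
  by split; [move=> x Ux; exact: cont fk Ux|exact: I].
split; first by move=> x Ux; exact: cont fk Ux.
have fst_f := Ck_fst (IHk _ _ _ (CkS fk)).
case: fk => fc [df [fdf dfk]].
exists (fun z => expR (f z.1) *: df z); split; last exact: Ck_scale.
by move=> x v Ux /=; apply: diff_quotient_comp; exact: fdf.
Qed.

Lemma Ck_ln k E (U : set E) (f : E -> R^o) : (forall x, U x -> 0 < f x) ->
  Ck k U f -> Ck k U (fun x => ln (f x) : R^o).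
Proof.
move=> f0; have cont j x :
    Ck j U f -> U x -> {for x, continuous (fun x => ln (f x) : R^o)}.
  move=> fj Ux; have fc := Ck_continuous fj Ux.
  exact: (cvg_comp _ _ fc (continuous_ln (f0 x Ux))).
case: k => [|k] fk.
  by split; [move=> x Ux; exact: cont fk Ux|exact: I].
split; first by move=> x Ux; exact: cont fk Ux.
have fst_f := Ck_fst (CkS fk).
case: fk => fc [df [fdf dfk]].
exists (fun z => (f z.1)^-1 *: df z); split.
  move=> x v Ux /=; apply: diff_quotient_comp; last exact: fdf.
  by have := is_derive1_ln (f0 x Ux).
apply: Ck_scale => //; apply: Ck_inv => // z Uz.
by rewrite gt_eqF//; exact: f0.
Qed.

End ScalarSmoothness.

Section IntegralOfReciprocal.
Context {R : realType}.

Lemma mxexp_scalar1 (y : R) : mxexp (y%:M : 'M[R]_1) = (expR y)%:M.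
Proof.
apply: mxexp_uniq.
have H : (series (exp_coeff y) N)%:M @[N --> \oo] --> ((expR y)%:M : 'M[R]_1).
  apply: cvg_mx => i j; under eq_fun do rewrite mxE; rewrite mxE.
  by apply: cvgMn; exact: is_cvg_series_exp_coeff.
apply: (cvg_rw H) => // N; rewrite /series /= raddf_sum /=; apply: eq_bigr => k _.
rewrite /exp_term /exp_coeff /= -[in RHS]scalemx1.
have -> : (y *: 1%:M : 'M[R]_1) ^+ k = y ^+ k *: (1%:M : 'M[R]_1).
  elim: k => [|k IHk]; first by rewrite !expr0 scale1r.
  by rewrite expmxS IHk -scalemxAl mul1mx scalerA -exprS.
by rewrite scalerA -[LHS]scalemx1 mulrC.
Qed.

(** The entire function [(e^y - 1) / y], obtained as a divided difference of the
    exponential between [0] and [y]; so it is smooth through [y = 0] by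
    [Ck_mxexp]. *)
Definition expm1_quotient (y : R) : R :=
  ursubmx (mxexp (upper_block (0 : 'M[R]_1) 1%:M y%:M)) 0 0.

Lemma expm1_quotientE y : y * expm1_quotient y = expR y - 1.
Proof.
have hV : y *: (1%:M : 'M[R]_1) = y%:M - 0 by rewrite subr0 scalemx1.
have /matrixP/(_ 0 0) := ursubmx_mxexp_diff hV.
rewrite mxexp_scalar1 mxexp0 [LHS]mxE => E; rewrite [LHS]E !mxE eqxx.
by rewrite !mulr1n.
Qed.

Lemma expm1_quotient0 : expm1_quotient 0 = 1.
Proof.
rewrite /expm1_quotient (_ : 0%:M = 0); last by apply/matrixP => i j; rewrite !mxE mul0rn.
by rewrite ursubmx_mxexp_comm ?mulmx0 ?mul0mx// mxexp0 mulmx1 mxE eqxx.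
Qed.

Lemma expm1_quotient_neq0 y : expm1_quotient y != 0.
Proof.
have [->|y0] := eqVneq y 0; first by rewrite expm1_quotient0 oner_eq0.
apply/eqP => q0; have := expm1_quotientE y; rewrite q0 mulr0 => /esym/eqP.
rewrite subr_eq0 -[X in _ == X](expR0 R) => /eqP/expR_inj yE.
by rewrite yE eqxx in y0.
Qed.

Lemma Ck_expm1_quotient k (E : topologicalLmodType R) (U : set E) (f : E -> R^o) :
  Ck k U f -> Ck k U (fun x => expm1_quotient (f x) : R^o).
Proof.
move=> fk.
pose L (A : 'M[R]_1) : R^o := A 0 0.
have Llin : linear L by move=> c A B; rewrite /L !mxE.
pose Lb := GRing.isLinear.Build R 'M[R]_1 R^o _ L Llin.
pose LL : {linear 'M[R]_1 -> R^o} := HB.pack L Lb.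
apply: (Ck_postcomp (L := LL)); first exact: coord_continuous.
rewrite (_ : (fun z => _) = (fun z => ur_incl 1 *m
    mxexp (upper_block 0 1%:M (f z)%:M) *m ur_proj 1)); last first.
  by apply/funext => z; rewrite ursubmxE.
apply: Ck_mulmx; last exact: Ck_cst.
apply: Ck_mulmx; first exact: Ck_cst.
apply: Ck_mxexp; rewrite (_ : (fun z => _) =
    (fun=> upper_block 0 1%:M (0 : 'M[R]_1))
  \+ (fun z => f z *: upper_block 0 0 (1%:M : 'M[R]_1))); last first.
  apply/funext => z; rewrite /= /upper_block scale_block_mx add_block_mx.
  by rewrite !scaler0 !addr0 scalemx1 add0r.
by apply: CkD; [exact: Ck_cst|apply: Ck_scale => //; exact: Ck_cst].
Qed.

(** The integral of [1 / (1 + b * s)] over [0 <= s <= t]. *)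
Definition log_time (b t : R) : R := t / expm1_quotient (ln (b * t + 1)).

Lemma log_timeE b t : 0 < b * t + 1 ->
  log_time b t = if b == 0 then t else b^-1 * ln (b * t + 1).
Proof.
move=> bt; rewrite /log_time; case: eqVneq => [->|b0].
  by rewrite mul0r add0r ln1 expm1_quotient0 divr1.
have := expm1_quotientE (ln (b * t + 1)); rewrite lnK ?posrE// addrK.
have := expm1_quotient_neq0 (ln (b * t + 1)).
move: (expm1_quotient (ln (b * t + 1))) (ln (b * t + 1)) => q l q0 lq.
by apply: (mulfI b0); rewrite mulVKf// mulrA -lq mulfK.
Qed.

(** Joint smoothness in [b] and [t], including [b = 0]. *)
Lemma Ck_log_time k (E : topologicalLmodType R) (U : set E) (b t : E -> R^o) :
  (forall x, U x -> 0 < b x * t x + 1) -> Ck k U b -> Ck k U t ->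
  Ck k U (fun x => log_time (b x) (t x) : R^o).
Proof.
move=> bt0 bk tk; apply: (Ck_scale (f := t)) => //; apply: Ck_inv.
  by move=> x Ux; exact: expm1_quotient_neq0.
apply: Ck_expm1_quotient; apply: Ck_ln => //.
apply: (CkD (f := fun x => b x *: t x) (g := fun=> 1)); first exact: Ck_scale.
exact: Ck_cst.
Qed.

End IntegralOfReciprocal.

(** * Smooth maps into the symmetric 2-forms from jointly smooth components *)

Section DirectionalDerivatives.
Context {R : realType} {E : topologicalLmodType R} {m n : nat}.
Variables (W : set E) (F : E -> 'M[R]_(m, n)).
Hypothesis Wo : open W.
Hypothesis Fs : smooth_on W F.

Lemma smooth_dird v : smooth_on W (dird F v).
Proof. by move=> k; exact: Ck_dird (Fs k.+1). Qed.

Lemma dird_cvg x v : W x -> diff_quotient F x v @ 0^' --> dird F v x.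
Proof. exact: Ck_dird_cvg (Fs 1%N). Qed.

Lemma smooth_dird_tangent :
  smooth_on [set z : tangent E | W z.1] (fun z => dird F z.2 z.1).
Proof.
move=> k; have [_ [df [Fdf dfk]]] := Fs k.+1.
apply: (Ck_ext (f := df)) dfk; first exact: open_tangent.
by move=> [x v] Wx /=; apply/esym/dirdE; exact: Fdf.
Qed.

End DirectionalDerivatives.

Lemma dirdC (R : realType) (E : topologicalLmodType R) m n (W : set E)
    (F : E -> 'M[R]_(m, n)) z v w :
  open W -> smooth_on W F -> W z -> dird (dird F v) w z = dird (dird F w) v z.
Proof.
move=> Wo Fs Wz; pose dF (zw : tangent E) := dird F zw.2 zw.1.
have dFs : smooth_on [set z : tangent E | W z.1] dF by exact: smooth_dird_tangent.
pose ddF (zw : tangent (tangent E)) := dird dF zw.2 zw.1.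
have ddFs := smooth_dird_tangent (open_tangent Wo) dFs.
have ddFE a b : dird (dird F a) b z = ddF ((z, a), (b, 0)).
  apply: dirdE.
  have H := @dird_cvg _ _ _ _ _ _ dFs ((z, a) : tangent E) (b, 0) Wz.
  have dFE h : h *: ((b, 0) : tangent E) + (z, a) = (h *: b + z, a) :> tangent E.
    by congr pair; rewrite /= scaler0 add0r.
  have qE h : diff_quotient dF ((z, a) : tangent E) (b, 0) h = diff_quotient (dird F a) z b h.
    by rewrite {1}/diff_quotient dFE.
  exact: (cvg_rw H qE (erefl _)).
rewrite !ddFE; apply/matrixP => i j.
have Fq x u : W x -> diff_quotient F x u @ 0^' --> dF (x, u) by exact: dird_cvg.
have dFq (x u : tangent E) : W x.1 -> diff_quotient dF x u @ 0^' --> ddF (x, u).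
  by exact: (dird_cvg dFs).
have c a b : {for (((z, a), (b, 0)) : tangent (tangent E)), continuous ddF}.
  exact: (Ck_continuous (ddFs 0%N)).
exact: (functional_second_derivative_sym Wo Fq dFq (entry_functional i j) Wz (c v w) (c w v)).
Qed.

Section JointSmoothness.
Context {R : realType} {E : topologicalLmodType R} {n : nat}.
Local Notation P := (space_prod E 'rV[R]_n).
Variables (U : set E) (V : set 'rV[R]_n).
Hypothesis Uo : open U.
Hypothesis Vo : open V.

Definition product_domain : set P := [set z | U z.1 /\ V z.2].
Let W := product_domain.

Lemma product_domain_open : open W.
Proof.
apply: openI.
  by apply: (@open_comp _ _ (fst : P -> E)) => // z _; exact: cvg_fst.
by apply: (@open_comp _ _ (snd : P -> 'rV[R]_n)) => // z _; exact: cvg_snd.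
Qed.

(** Iterated derivatives in the second factor. *)
Definition joint_partials (ks : seq 'I_n) (F : P -> 'M[R]_n) : P -> 'M[R]_n :=
  foldr (fun k G => dird G ((0, delta_mx 0 k) : P)) F ks.

Lemma smooth_joint_partials ks F : smooth_on W F -> smooth_on W (joint_partials ks F).
Proof.
move=> Fs; elim: ks => [//|k ks IHks]; apply: smooth_dird => //.
exact: product_domain_open.
Qed.

(** The partial derivatives of a section are values of a smooth function of both
    variables. *)
Lemma partials_section ks F (f : 'rV[R]_n -> 'M[R]_n) x p :
  smooth_on W F -> U x -> (forall p, V p -> f p = F (x, p)) -> V p ->
  partials ks f p = joint_partials ks F (x, p).
Proof.
move=> Fs Ux fF; elim: ks p => [|k ks IHks] p Vp /=; first exact: fF.
apply: diff_quotient_derive.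
have Wxp : W (x, p) by split.
have H := dird_cvg (v := (0, delta_mx 0 k) : P) (smooth_joint_partials ks Fs) Wxp.
apply: cvg_trans H; apply: near_eq_cvg.
have Vh : \forall h \near 0^', V (h *: delta_mx 0 k + p).
  exact: (@cvg_segment _ _ p (delta_mx 0 k) V (open_nbhs_nbhs (conj Vo Vp))).
apply: filterS Vh => h Vh; rewrite /diff_quotient !IHks//; congr (_ *: (_ - _)).
by congr (joint_partials ks F _); congr pair; rewrite /= scaler0 add0r.
Qed.

(** Derivatives in the parameter commute with those along the chart. *)
Lemma joint_partials_dird ks F w z : smooth_on W F -> W z ->
  joint_partials ks (dird F w) z = dird (joint_partials ks F) w z.
Proof.
move=> Fs; elim: ks z => [//|k ks IHks] z Wz /=.
have Wo := product_domain_open.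
rewrite (dird_ext _ Wo IHks Wz); apply: (dirdC _ _ Wo _ Wz).
exact: smooth_joint_partials.
Qed.

Lemma smooth_section (F : P -> 'M[R]_n) x : smooth_on W F -> U x -> smooth_on V (fun p => F (x, p)).
Proof.
move=> Fs Ux k; apply: (Ck_precomp_affine (L := fun p => (x, p) : P)
  (L0 := fun p => (0, p) : P)) (Fs k).
- move=> p; have c : (fun=> x) @ nbhs p --> x by exact: cvg_cst.
  exact: (cvg_pair c (cvg_id (F := nbhs p))).
- move=> p; have c : (fun=> 0 : E) @ nbhs p --> (0 : E) by exact: cvg_cst.
  exact: (cvg_pair c (cvg_id (F := nbhs p))).
- by move=> h v p; congr pair; rewrite /= ?scaler0 ?add0r.
- by move=> h v p; congr pair; rewrite /= ?scaler0 ?add0r.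
- by move=> p Vp; split.
Qed.

End JointSmoothness.

Section JointFields.
Context {R : realType} {n : nat} {T : topologicalType} {M : manifold R n T}.

(** A map [u] into [S2] whose components in each chart are given by a smooth
    function of the parameter and the point together. *)
Definition joint_field (E : topologicalLmodType R) (U : set E) (u : E -> S2 M)
    (F : chart_index M -> space_prod E 'rV[R]_n -> 'M[R]_n) : Prop :=
  (forall i, smooth_on (product_domain U (coords (atlas M i))) (F i)) /\
  (forall x i p, U x -> coords (atlas M i) p -> u x i p = F i (x, p)).

Section OneField.
Context {E : topologicalLmodType R} {U : set E} (Uo : open U).
Variables (u : E -> S2 M) (F : chart_index M -> space_prod E 'rV[R]_n -> 'M[R]_n).
Hypothesis uF : joint_field U u F.

Let Wo i := product_domain_open Uo (@coords_openP R n T M i).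

Lemma partials_joint_field ks x i p : U x -> coords (atlas M i) p ->
  partials ks (u x i) p = joint_partials ks (F i) (x, p).
Proof.
case: uF => Fs uE Ux ip.
by apply: (partials_section Uo (@coords_openP R n T M i) ks (Fs i) Ux _ ip) => q iq; exact: uE.
Qed.

Lemma joint_field_continuous x : U x -> {for x, continuous u}.
Proof.
move=> Ux; have [Fs _] := uF; apply/S2_cvgP => i ks p0 ip0.
have Gs := smooth_joint_partials Uo (@coords_openP R n T M i) ks (Fs i).
have Wx : product_domain U (coords (atlas M i)) (x, p0) by split.
have Gc : joint_partials ks (F i) z @[z --> nbhs ((x, p0) : space_prod E 'rV[R]_n)]
    --> joint_partials ks (F i) (x, p0).
  exact: (Ck_continuous (Gs 0%N) Wx).
rewrite partials_joint_field//; apply: cvg_trans Gc; apply: near_eq_cvg.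
have Wz := @Wo i; rewrite openE in Wz.
by apply: filterS (Wz _ Wx) => -[y q] [/= Uy iq]; rewrite partials_joint_field.
Qed.

(** The derivative of the components in the parameter is again a 2-form, by
    [S2_limit]. *)
Lemma joint_field_deriv x v : U x -> exists2 L : S2 M,
  diff_quotient u x v @ 0^' --> L &
  forall i p, coords (atlas M i) p -> L i p = dird (F i) ((v, 0) : space_prod E 'rV[R]_n) (x, p).
Proof.
move=> Ux; have [Fs uE] := uF.
pose w : space_prod E 'rV[R]_n := (v, 0).
pose l i p := if pselect (coords (atlas M i) p) is left _ then dird (F i) w (x, p) else 0.
have lE i p : coords (atlas M i) p -> l i p = dird (F i) w (x, p).
  by move=> ip; rewrite /l; case: pselect.
have l0 i p : ~ coords (atlas M i) p -> l i p = 0.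
  by move=> ip; rewrite /l; case: pselect.
have near_U : \forall h \near (0 : R)^', U (h *: v + x).
  exact: (@cvg_segment _ _ x v U (open_nbhs_nbhs (conj Uo Ux))).
have [i|L LE Lc] := S2_limit (FF := @Proper_dnbhs_numFieldType R 0) (u := diff_quotient u x v) l0.
  have dFs := smooth_dird (@Wo i) (Fs i) w.
  split.
  - by apply: nearW => h; exact: (sym2_smooth (S2_sym2 _)).
  - move=> k; apply: (Ck_ext (f := fun p => dird (F i) w (x, p))).
    + exact: coords_openP.
    + by move=> p ip; rewrite lE.
    + exact: (smooth_section dFs Ux k).
  move=> m ks p0 _ ip0; set G := joint_partials ks (F i).
  have Gs := smooth_joint_partials Uo (@coords_openP R n T M i) ks (Fs i).
  have Wx : product_domain U (coords (atlas M i)) (x, p0) by split.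
  have -> : partials ks (l i) p0 = dird G w (x, p0).
    rewrite -(joint_partials_dird Uo (@coords_openP R n T M i) ks w (Fs i) Wx).
    exact: (partials_section Uo (@coords_openP R n T M i) ks dFs Ux (lE i) ip0).
  have cy : (x, z.2) @[z --> filter_prod (0 : R)^' (nbhs p0)] --> ((x, p0) : space_prod E 'rV[R]_n).
    have c : (fun=> x) @ filter_prod (0 : R)^' (nbhs p0) --> x by exact: cvg_cst.
    have c' : z.2 @[z --> filter_prod (0 : R)^' (nbhs p0)] --> p0 by exact: cvg_snd.
    exact: (cvg_pair c c').
  have cw : (fun=> w) @ filter_prod (0 : R)^' (nbhs p0) --> w by exact: cvg_cst.
  have ch : z.1 @[z --> filter_prod (0 : R)^' (nbhs p0)] --> 0.
    exact: (cvg_comp _ _ cvg_fst (@cvg_dnbhs0 R)).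
  have cn : \forall z \near filter_prod (0 : R)^' (nbhs p0), z.1 != 0.
    exact: near_fst (@near_dnbhs0 R).
  have Gq (y b : space_prod E 'rV[R]_n) : product_domain U (coords (atlas M i)) y ->
      diff_quotient G y b @ 0^' --> (fun zw : tangent _ => dird G zw.2 zw.1) (y, b).
    by exact: (dird_cvg Gs).
  have Gc : {for (((x, p0), w) : tangent (space_prod E 'rV[R]_n)),
      continuous (fun zw => dird G zw.2 zw.1)}.
    exact: (Ck_continuous (smooth_dird_tangent (@Wo i) Gs 0%N)).
  have H := C1_cvg_mx (FF := _) (@Wo i) Wx Gq Gc cy cw ch cn.
  apply: cvg_trans (H _); apply: near_eq_cvg.
  have near_U' : \forall z \near filter_prod (0 : R)^' (nbhs p0), U (z.1 *: v + x).
    exact: near_fst near_U.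
  have ips := @near_coords R n T M R (0 : R)^' (@dnbhs0_filter R) i p0 ip0.
  near=> z; have Uz : U (z.1 *: v + x) by near: z.
  have iz : coords (atlas M i) z.2 by near: z.
  have E1 : z.1 *: w + (x, z.2) = (z.1 *: v + x, z.2) :> space_prod E 'rV[R]_n.
    by congr pair; rewrite /= scaler0 add0r.
  have subE (a b : S2 M) : partials ks ((a - b) i) z.2 =
      partials ks (a i) z.2 - partials ks (b i) z.2.
    by rewrite -scaleN1r addrC partials_S2_lin// scaleN1r addrC.
  by rewrite E1 /diff_quotient partials_S2_scale// subE !partials_joint_field.
by exists L => // i p ip; rewrite LE lE.
Unshelve. all: by end_near. Qed.

Lemma joint_field_tangent :
  joint_field [set xv : tangent E | U xv.1] (fun xv => dderiv u xv.1 xv.2)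
    (fun i z => dird (F i) ((z.1.2, 0) : space_prod E 'rV[R]_n) (z.1.1, z.2)).
Proof.
have [Fs uE] := uF; split=> [i|[x v] i p /= Ux ip]; last first.
  have [L Lc LE] := joint_field_deriv v Ux.
  by rewrite (dderivE Lc) LE.
move=> k; have := smooth_dird_tangent (@Wo i) (Fs i) k.
apply: (Ck_precomp (L := fun z : space_prod (tangent E) 'rV[R]_n =>
    ((z.1.1, z.2), (z.1.2, 0)) : tangent (space_prod E 'rV[R]_n))).
- move=> z.
  have c1 : y.1.1 @[y --> z] --> z.1.1.
    by apply: (cvg_comp _ _ (@cvg_fst _ _ (nbhs z.1) (nbhs z.2) _)); exact: cvg_fst.
  have c2 : y.1.2 @[y --> z] --> z.1.2.
    by apply: (cvg_comp _ _ (@cvg_fst _ _ (nbhs z.1) (nbhs z.2) _)); exact: cvg_snd.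
  have c3 : y.2 @[y --> z] --> z.2 by exact: cvg_snd.
  have c0 : (fun=> 0 : 'rV[R]_n) @ z --> (0 : 'rV[R]_n) by exact: cvg_cst.
  exact: cvg_pair (cvg_pair c1 c3) (cvg_pair c2 c0).
- by move=> h v x; congr (_, (_, _)); rewrite /= scaler0 addr0.
- by move=> [[x v] p] [/= Ux ip]; split.
Qed.

End OneField.

(** The derivative of a joint field is a joint field on the tangent space of the
    parameters ([joint_field_tangent]), and joint fields are continuous; this is one
    half of the exponential law for smooth maps. *)
Lemma joint_field_smooth k (E : topologicalLmodType R) (U : set E) (u : E -> S2 M) F :
  open U -> joint_field U u F -> Ck k U u.
Proof.
elim: k E U u F => [|k IHk] E U u F Uo uF.
  by split=> // x Ux; exact: joint_field_continuous uF x Ux.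
split; first by move=> x Ux; exact: (joint_field_continuous Uo uF).
exists (fun xv => dderiv u xv.1 xv.2); split.
  move=> x v Ux; have [L Lc _] := joint_field_deriv Uo uF v Ux.
  by rewrite /= (dderivE Lc).
exact: IHk _ _ _ _ (open_tangent Uo) (joint_field_tangent Uo uF).
Qed.

End JointFields.

(** * The geodesic at a point of the manifold *)

Lemma diff_quotient_cst_cvg (R : realType) (E : lmodType R) (V : normedModType R) (c : V) (x v : E) :
  diff_quotient (fun=> c) x v @ 0^' --> (0 : V).
Proof. by rewrite diff_quotient_cst; exact: cvg_cst. Qed.

Section LinearMaps.
Context {R : realType}.

Lemma Ck_linear_map k (E : topologicalLmodType R) (V : normedModType R) (U : set E) (L : E -> V) :
  continuous L -> (forall h v x, L (h *: v + x) = h *: L v + L x) -> Ck k U L.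
Proof.
elim: k E U L => [|k IHk] E U L Lc Ll.
  by split; [move=> x _; exact: Lc|exact: I].
split; first by move=> x _; exact: Lc.
exists (fun z => L z.2); split.
  move=> x v _; apply: cvg_near_cst; apply: filterS (@near_dnbhs0 R) => h h0.
  by rewrite /diff_quotient Ll addrK scalerA mulVf// scale1r.
apply: IHk; last by move=> h v x; rewrite /= Ll.
by move=> z; apply: continuous_comp; [exact: cvg_snd|exact: Lc].
Qed.

End LinearMaps.

Section MatrixFlow.
Context {R : realType} {n : nat}.
Hypothesis n_gt0 : (0 < n)%N.
Variables (b : R) (G B : 'M[R]_n).

(** The endomorphism [A_0] at a point, [b] being the value of [beta] there. *)
Definition flow_direction : 'M[R]_n := (4 * b / n%:R)%:M + B.

(** The geodesic at a point.  The real power is written with [ln] and the time of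
    the exponential is [log_time], so that no case distinction on [b] is left. *)
Definition flow (t : R^o) : 'M[R]_n :=
  expR (4 / n%:R * ln (b * t + 1)) *: (G *m mxexp (log_time b t *: B)).

Lemma affine_deriv t : diff_quotient (fun s : R^o => b * s + 1 : R^o) t 1 @ 0^' --> (b : R^o).
Proof.
apply: (cvg_rw (@diff_quotient_lin R b t)) => // h.
by rewrite /diff_quotient opprD addrACA subrr addr0.
Qed.

Lemma near_flow_domain t : 0 < b * t + 1 -> \forall h \near 0^', 0 < b * (h *: 1 + t) + 1.
Proof.
move=> bt; have c := cvg_line (@affine_deriv t).
exact: (c _ (open_nbhs_nbhs (conj (@open_gt R 0) bt))).
Qed.

Lemma ln_affine_deriv t : 0 < b * t + 1 ->
  diff_quotient (fun s : R^o => ln (b * s + 1) : R^o) t 1 @ 0^' --> ((b * t + 1)^-1 *: (b : R^o)).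
Proof.
move=> bt; apply: diff_quotient_comp (@affine_deriv t).
exact: is_derive1_ln.
Qed.

Lemma log_time_deriv t : 0 < b * t + 1 ->
  diff_quotient (log_time b : R^o -> R^o) t 1 @ 0^' --> ((b * t + 1)^-1 : R^o).
Proof.
move=> bt; have near_dom := near_flow_domain bt.
have [b0|b0] := eqVneq b 0.
  apply: cvg_near_cst; near=> h; have h0 : h != 0 by near: h; exact: (@near_dnbhs0 R).
  rewrite /diff_quotient !log_timeE//; last by near: h.
  rewrite b0 eqxx mul0r add0r invr1 addrK scalerA mulVf//.
  by rewrite [1 *: 1]mulr1.
have H := cvgZl_tmp (k := b^-1) (ln_affine_deriv bt).
have -> : (b * t + 1)^-1 = b^-1 *: ((b * t + 1)^-1 *: (b : R^o)).
  by rewrite /GRing.scale /= mulrCA mulVf// mulr1.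
apply: cvg_trans (H _); apply: near_eq_cvg; near=> h.
have bh : 0 < b * (h *: 1 + t) + 1 by near: h.
rewrite /diff_quotient !log_timeE// (negbTE b0) -mulrBr.
by rewrite /GRing.scale /= mulrCA.
Unshelve. all: by end_near. Qed.

Lemma expR_ln_deriv t : 0 < b * t + 1 ->
  diff_quotient (fun s : R^o => expR (4 / n%:R * ln (b * s + 1)) : R^o) t 1 @ 0^' -->
   (expR (4 / n%:R * ln (b * t + 1)) *: (4 / n%:R *: ((b * t + 1)^-1 *: (b : R^o))) : R^o).
Proof.
move=> bt; apply: (@diff_quotient_comp R R^o expR (fun s => 4 / n%:R *: (ln (b * s + 1) : R^o))).
have H := cvgZl_tmp (k := 4 / n%:R) (ln_affine_deriv bt).
apply: (cvg_rw (H _)) => // h; rewrite /diff_quotient -scalerBr.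
by rewrite /GRing.scale /= mulrCA.
Qed.

(** [flow] is [G exp (l (4 b / n + B))] for a time change [l] with
    [l' = 1 / (b t + 1)], whence a velocity proportional to [flow t *m A_0]. *)
Lemma flow_deriv t : 0 < b * t + 1 ->
  diff_quotient flow t 1 @ 0^' --> (b * t + 1)^-1 *: (flow t *m flow_direction).
Proof.
move=> bt.
have H := diff_quotient_scale (expR_ln_deriv bt)
  (diff_quotient_mulmx (diff_quotient_cst_cvg G (t : R^o) 1) (mxexp_line_diff (A := B) (log_time_deriv bt))).
apply: (cvg_rw H) => //; rewrite mul0mx add0r /flow /flow_direction.
have eB : mxexp (log_time b t *: B) *m B = B *m mxexp (log_time b t *: B).
  by apply/esym/mxexp_intertwine; rewrite -scalemxAr -scalemxAl.
rewrite mulmxDr mul_mx_scalar -scalemxAl -(mulmxA G) eB.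
move: (mxexp _) (expR _) ((b * t + 1)^-1) => X e c.
rewrite -!scalemxAr -/(_ * _) scalerDr !scalerA; congr (_ *: _ + _ *: _).
  by rewrite /GRing.scale /=; ring.
by rewrite mulrC.
Qed.

Lemma flow_velocity_deriv t : 0 < b * t + 1 ->
  diff_quotient (fun s : R^o => (b * s + 1)^-1 *: (flow s *m flow_direction)) t 1 @ 0^' -->
   (b * t + 1)^-1 ^+ 2 *: (flow t *m flow_direction *m flow_direction
      - b *: (flow t *m flow_direction)).
Proof.
move=> bt.
have bt0 : b * t + 1 != 0 by rewrite gt_eqF.
have H := diff_quotient_scale (diff_quotient_inv (f := fun s : R^o => b * s + 1 : R^o) (x := t) bt0 (@affine_deriv t))
  (diff_quotient_mulmx (flow_deriv bt) (diff_quotient_cst_cvg flow_direction (t : R^o) 1)).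
apply: (cvg_rw H) => //; rewrite mulmx0 addr0.
move: (flow t) ((b * t + 1)^-1) => F c; rewrite -scalemxAl !scalerA.
move: (F *m flow_direction) => X.
rewrite scalerBr scalerA addrC -expr2; congr (_ *: _ + _).
by rewrite -scaleNr; congr (_ *: _); rewrite /GRing.scale /=; ring.
Qed.

Lemma flow0 : flow 0 = G.
Proof.
rewrite /flow mulr0 add0r ln1 mulr0 expR0 scale1r log_timeE; last by rewrite mulr0 add0r.
by rewrite mulr0 add0r ln1 mulr0; case: ifP => _; rewrite scale0r mxexp0 mulmx1.
Qed.

Lemma flow_unitmx t : G \in unitmx -> flow t \in unitmx.
Proof.
move=> Gu; rewrite /flow -mul_scalar_mx !unitmx_mul Gu mxexp_unit !andbT.
by rewrite unitmxE det_scalar unitfE expf_eq0 expR_eq0 andbF.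
Qed.

Lemma flow_direction_trace : \tr B = 0 -> \tr flow_direction = 4 * b.
Proof.
move=> B0; rewrite /flow_direction mxtraceD B0 addr0 mxtrace_scalar -[LHS]mulr_natr.
by rewrite divfK// pnatr_eq0 -lt0n.
Qed.

(** The equation [x'' - x' x^-1 x' + 4^-1 tr (x^-1 x') x' = 0] of the geodesics
    at one point of the manifold. *)
Lemma flow_geodesic t : G \in unitmx -> \tr B = 0 -> 0 < b * t + 1 ->
  let x := flow t in
  let v := (b * t + 1)^-1 *: (flow t *m flow_direction) in
  let W := invmx x *m v in
  (b * t + 1)^-1 ^+ 2 *: (flow t *m flow_direction *m flow_direction
      - b *: (flow t *m flow_direction)) +
  (- 2^-1 *: (v *m W + v *m W) + 8^-1 *: (\tr W *: v + \tr W *: v)) = 0.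
Proof.
move=> Gu B0 bt x v W; have xu : x \in unitmx by exact: flow_unitmx.
have WE : W = (b * t + 1)^-1 *: flow_direction.
  by rewrite /W /v -scalemxAr mulKmx.
rewrite WE mxtraceZ flow_direction_trace// /v -scalemxAl -scalemxAr.
move: (flow t *m flow_direction *m flow_direction) (flow t *m flow_direction) => X Y.
move: ((b * t + 1)^-1) => c.
by apply/matrixP => i j; rewrite !mxE; field.
Qed.

Hypothesis G_sym : G^T = G.
Hypothesis GB_sym : (G *m B)^T = G *m B.

Lemma BT_G : B^T *m G = G *m B.
Proof. by rewrite -[in LHS]G_sym -trmx_mul. Qed.

(** [B] is selfadjoint with respect to [G], hence so is every function of it. *)
Lemma sym_mxexp (c : R) : G *m mxexp (c *: B) = (mxexp (c *: B))^T *m G.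
Proof.
rewrite mxexp_tr; apply: mxexp_intertwine.
by rewrite [(_ *: B)^T]linearZ /= -scalemxAr -scalemxAl BT_G.
Qed.

Lemma flow_sym t : (flow t)^T = flow t.
Proof. by rewrite /flow linearZ /= trmx_mul G_sym sym_mxexp. Qed.

(** With [E] the exponential of half the argument, [G E E = E^T G E] is congruent
    to [G]. *)
Lemma flow_posdef t : posdef G -> posdef (flow t).
Proof.
move=> Gp; set E := mxexp (2^-1 *: (log_time b t *: B)).
have dE : mxexp (log_time b t *: B) = E *m E.
  by rewrite -mxexp_double scalerA mulfV ?scale1r// pnatr_eq0.
have Ep : posdef (E^T *m G *m E^T^T).
  by apply: posdef_congr => //; rewrite unitmx_tr mxexp_unit.
have -> : flow t = expR (4 / n%:R * ln (b * t + 1)) *: (E^T *m G *m E^T^T).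
  rewrite /flow dE trmxK mulmxA; congr (_ *: (_ *m _)).
  by rewrite /E scalerA sym_mxexp.
move=> v v0; rewrite -scalemxAr -scalemxAl mxE mulr_gt0 ?expR_gt0//.
exact: Ep.
Qed.

End MatrixFlow.

(** * Existence of the geodesic *)

Section CurveVelocity.
Context {R : realType} {n : nat} {T : topologicalType} {M : manifold R n T}.
Variables (J : set R^o) (gamma : R^o -> S2 M).
Hypotheses (Jo : open J) (gamma_smooth : smooth_on J gamma).

Lemma curve_velocity t : J t -> diff_quotient gamma t 1 @ 0^' --> velocity gamma t.
Proof.
move=> Jt; have [_ [d [gd _]]] := gamma_smooth 1%N.
by rewrite /velocity (dderivE (gd t 1 Jt)); exact: gd.
Qed.

Lemma curve_acceleration t : J t ->
  diff_quotient (velocity gamma) t 1 @ 0^' --> velocity (velocity gamma) t.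
Proof.
move=> Jt; have [_ [d [gd [_ [dd [gdd _]]]]]] := gamma_smooth 2%N.
have dE s : J s -> d (s, 1) = velocity gamma s.
  by move=> Js; rewrite /velocity (dderivE (gd s 1 Js)).
have H : diff_quotient d ((t, 1) : tangent R^o) (1, 0) @ 0^' --> dd ((t, 1), (1, 0)).
  exact: gdd.
suff c : diff_quotient (velocity gamma) t 1 @ 0^' --> dd ((t, 1), (1, 0)).
  by rewrite {2}/velocity (dderivE c).
apply: cvg_trans H; apply: near_eq_cvg.
have Jh : \forall h \near (0 : R)^', J (h *: 1 + t).
  exact: (@cvg_segment _ _ t 1 J (open_nbhs_nbhs (conj Jo Jt))).
apply: filterS Jh => h Jh; rewrite /diff_quotient -!dE//.
by congr (_ *: (d _ - _)); congr pair; rewrite /= scaler0 add0r.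
Qed.

Lemma curve_point_velocity i p t : J t ->
  diff_quotient (fun s => gamma s i p) t 1 @ 0^' --> velocity gamma t i p.
Proof. by move=> /curve_velocity/S2_point_cvg; exact. Qed.

Lemma curve_point_acceleration i p t : J t ->
  diff_quotient (fun s => velocity gamma s i p) t 1 @ 0^' --> velocity (velocity gamma) t i p.
Proof. by move=> /curve_acceleration/S2_point_cvg; exact. Qed.

End CurveVelocity.

Section GeodesicDomain.
Context {R : realType} {n : nat} {T : topologicalType} {M : manifold R n T}.
Variable beta : T -> R.

Lemma smooth_function_continuous : smooth_function M beta -> continuous (beta : T -> R^o).
Proof.
move=> bs x; have [i ix] := atlas_cover M x.
have ip : coords (atlas M i) (cmap (atlas M i) x) by exists x.
have c := Ck_continuous (bs i 0%N) ip.
have := cvg_comp _ _ (cmap_continuous ix) c.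
rewrite /= cmapK//; apply: cvg_trans; apply: near_eq_cvg.
have : nbhs x (dom (atlas M i)) by apply: open_nbhs_nbhs; split=> //; exact: dom_open.
by apply: filterS => y iy /=; rewrite cmapK.
Qed.

(** Near each point of the manifold the condition is open in the point and the time
    jointly; the manifold is compact. *)
Lemma geodesic_domain_open : closed_manifold M -> smooth_function M beta ->
  open (geodesic_domain beta).
Proof.
move=> [_ Tc] /smooth_function_continuous bc.
have cov := iffLR (compact_near_coveringP _) Tc.
rewrite openE => t tD.
suff : \forall s \near t, forall x : T, [set: T] x -> 0 < beta x * s + 1.
  by apply: filterS => s H x; exact: H.
apply: (cov R (nbhs t) (fun s x => 0 < beta x * s + 1) _) => x _.
have cb : beta z.1 @[z --> filter_prod (nbhs x) (nbhs t)] --> beta x.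
  exact: (cvg_comp fst (beta : T -> R) cvg_fst (bc x)).
have ct : z.2 @[z --> filter_prod (nbhs x) (nbhs t)] --> (t : R) by exact: cvg_snd.
have c : beta z.1 * z.2 + 1 @[z --> filter_prod (nbhs x) (nbhs t)] --> beta x * t + 1.
  apply: cvgD; last exact: cvg_cst.
  exact: cvgM.
exact: (c _ (open_nbhs_nbhs (conj (@open_gt R 0) (tD x)))).
Qed.

Lemma geodesic_domain0 : geodesic_domain beta 0.
Proof. by move=> x; rewrite mulr0 add0r. Qed.

End GeodesicDomain.

Lemma diff_quotient_ext_cvg (R : realType) m n (J : set R^o) (f f' : R^o -> 'M[R]_(m, n)) t
    (l : 'M[R]_(m, n)) :
  open J -> (forall s, J s -> f s = f' s) -> J t ->
  diff_quotient f t 1 @ 0^' --> l -> diff_quotient f' t 1 @ 0^' --> l.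
Proof.
move=> Jo ff' Jt; apply: cvg_trans; apply: near_eq_cvg.
have Jh : \forall h \near (0 : R)^', J (h *: 1 + t).
  exact: (@cvg_segment _ _ t 1 J (open_nbhs_nbhs (conj Jo Jt))).
by apply: filterS Jh => h Jh; rewrite /diff_quotient !ff'.
Qed.

Lemma diff_quotient_unique (R : realType) (E : lmodType R) (V : normedModType R) (f : E -> V) x v (l l' : V) :
  diff_quotient f x v @ 0^' --> l -> diff_quotient f x v @ 0^' --> l' -> l = l'.
Proof. exact: norm_cvg_unique. Qed.

Section Geodesic.
Context {R : realType} {n : nat} {T : topologicalType} {M : manifold R n T}.
Variables (g : S2 M) (beta : T -> R) (B : chart_index M -> 'rV[R]_n -> 'M[R]_n).
Hypotheses (n_gt0 : (0 < n)%N) (M_closed : closed_manifold M).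
Hypotheses (g_metric : metrics g) (beta_smooth : smooth_function M beta).
Hypothesis (B_endo : is_endomorphism B).
Hypothesis B_trace : forall i p, \tr (B i p) = 0.
Hypothesis B_sym : forall i p, (g i p *m B i p)^T = g i p *m B i p.
Local Notation D := (geodesic_domain beta).
Local Notation b i p := (beta (cinv (atlas M i) p)).

Lemma geodesic_formulaE t i p : D t ->
  geodesic_formula g beta B t i p = flow (b i p) (g i p) (B i p) t.
Proof.
move=> /(_ (cinv (atlas M i) p)) bt; rewrite /geodesic_formula /flow log_timeE//.
case: eqVneq => [->|b0]; first by rewrite mul0r add0r ln1 mulr0 expR0 scale1r.
by rewrite /powR gt_eqF.
Qed.

Lemma flow_joint_smooth i : smooth_on (product_domain (D : set R^o) (coords (atlas M i)))
  (fun z => flow (b i z.2) (g i z.2) (B i z.2) z.1).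
Proof.
move=> k; set W := product_domain _ _.
have sndP (V : preTopologicalLmodType R) (f : 'rV[R]_n -> V) : Ck k (coords (atlas M i)) f ->
    Ck k W (fun z => f z.2).
  apply: (Ck_precomp (L := fun z : space_prod R^o 'rV[R]_n => z.2)) => //.
    by move=> z; exact: cvg_snd.
  by move=> z [].
have bk : Ck k W (fun z => b i z.2 : R^o) by exact: sndP (beta_smooth i k).
have tk : Ck k W (fun z => z.1 : R^o).
  by apply: Ck_linear_map => // z; exact: cvg_fst.
have pos (z : space_prod R^o 'rV[R]_n) : W z -> 0 < b i z.2 * z.1 + 1 by case=> /(_ _).
apply: (Ck_scale (f := fun z : space_prod R^o 'rV[R]_n =>
  expR (4 / n%:R * ln (b i z.2 * z.1 + 1)) : R^o)).
  apply: Ck_expR; apply: (CkZ (4 / n%:R) (f := fun z : space_prod R^o 'rV[R]_n => ln (b i z.2 * z.1 + 1) : R^o)).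
  apply: Ck_ln => //.
  apply: (CkD (f := fun z : space_prod R^o 'rV[R]_n => b i z.2 *: (z.1 : R^o)) (g := fun=> 1)); last exact: Ck_cst.
  exact: (Ck_scale (f := fun z : space_prod R^o 'rV[R]_n => b i z.2)).
apply: Ck_mulmx; first exact: sndP (sym2_smooth (S2_sym2 g) i k).
apply: Ck_mxexp; apply: (Ck_scale (f := fun z : space_prod R^o 'rV[R]_n => log_time (b i z.2) z.1 : R^o)).
  exact: Ck_log_time.
exact: sndP (endo_smooth B_endo i k).
Qed.

Lemma geodesic_formula_sym2 t : D t -> is_sym2 (geodesic_formula g beta B t).
Proof.
move=> Dt; have Do := geodesic_domain_open M_closed beta_smooth.
have [gs gy gt go] := S2_sym2 g; split.
- move=> i k; apply: (Ck_ext (f := fun p => flow (b i p) (g i p) (B i p) t)).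
  + exact: coords_openP.
  + by move=> p ip; rewrite geodesic_formulaE.
  + exact: (smooth_section (@flow_joint_smooth i) Dt k).
- by move=> i p; rewrite geodesic_formulaE// flow_sym.
- move=> i j p ijp; rewrite !geodesic_formulaE// /flow.
  have -> : b j (transition (atlas M i) (atlas M j) p) = b i p.
    by case: ijp => x [ix jx] <-; rewrite /transition /= !cmapK.
  rewrite (gt _ _ _ ijp) -scalemxAr -scalemxAl; congr (_ *: _).
  rewrite -!mulmxA; congr (_ *m (_ *m _)); apply: mxexp_intertwine.
  by rewrite -scalemxAr -scalemxAl (endo_tensor B_endo ijp).
- by move=> i p ip; rewrite geodesic_formulaE// /flow go// mul0mx scaler0.
Qed.

Definition geodesic (t : R^o) : S2 M :=
  if pselect (D t) is left Dt then MkS2 (asboolT (geodesic_formula_sym2 Dt)) else 0.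

Lemma geodesicE t i p : D t -> geodesic t i p = flow (b i p) (g i p) (B i p) t.
Proof. by move=> Dt; rewrite /geodesic; case: pselect => // ?; exact: geodesic_formulaE. Qed.

Lemma geodesic_smooth : smooth_on (D : set R^o) geodesic.
Proof.
move=> k; have Do : open (D : set R^o) by exact: geodesic_domain_open M_closed beta_smooth.
apply: (joint_field_smooth k (F := fun i z => flow (b i z.2) (g i z.2) (B i z.2) z.1)) => //.
split; first exact: flow_joint_smooth.
by move=> t i p Dt _; rewrite geodesicE.
Qed.

Let Do : open (D : set R^o) := geodesic_domain_open M_closed beta_smooth.

Lemma geodesic_velocity t i p : D t ->
  velocity geodesic t i p = (b i p * t + 1)^-1 *:
    (flow (b i p) (g i p) (B i p) t *m flow_direction (b i p) (B i p)).
Proof.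
move=> Dt.
have H := curve_point_velocity (i := i) (p := p) geodesic_smooth Dt.
have H' := diff_quotient_ext_cvg Do (fun s => @geodesicE s i p) Dt H.
exact: (diff_quotient_unique H' (flow_deriv (G := g i p) (B := B i p) (Dt (cinv (atlas M i) p)))).
Qed.

Lemma geodesic_acceleration t i p : D t ->
  velocity (velocity geodesic) t i p = (b i p * t + 1)^-1 ^+ 2 *:
    (flow (b i p) (g i p) (B i p) t *m flow_direction (b i p) (B i p)
        *m flow_direction (b i p) (B i p)
     - b i p *: (flow (b i p) (g i p) (B i p) t *m flow_direction (b i p) (B i p))).
Proof.
move=> Dt.
have H := curve_point_acceleration (i := i) (p := p) Do geodesic_smooth Dt.
have H' := diff_quotient_ext_cvg Do (fun s => @geodesic_velocity s i p) Dt H.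
exact: (diff_quotient_unique H' (flow_velocity_deriv (G := g i p) (B := B i p) (Dt (cinv (atlas M i) p)))).
Qed.

Lemma geodesic_metric t : D t -> metrics (geodesic t).
Proof.
move=> Dt i p ip; rewrite geodesicE//; apply: flow_posdef => //; last exact: g_metric.
exact: (sym2_sym (S2_sym2 g)).
Qed.

Lemma geodesic_is_geodesic : geodesic_from g beta B D geodesic.
Proof.
have D0 := @geodesic_domain0 R T beta.
split; first split.
- exact: geodesic_smooth.
- exact: geodesic_metric.
- move=> t Dt; apply: S2_ext => i p.
  have [ip|ip] := pselect (coords (atlas M i) p); last first.
    by rewrite !(sym2_off (S2_sym2 _)).
  rewrite S2_add S2_0 christoffelE; last exact: geodesic_metric.
  rewrite /raise geodesic_acceleration// geodesic_velocity// geodesicE//.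
  by apply: flow_geodesic => //; exact: metrics_unitmx.
- by apply: S2_ext => i p; rewrite geodesicE// flow0.
- move=> i p; rewrite geodesic_velocity// flow0 mulr0 add0r invr1 scale1r.
  by [].
Qed.

Lemma geodesic_exists : exists gamma : R^o -> S2 M,
  geodesic_from g beta B D gamma /\
  forall t, D t -> forall i p, gamma t i p = geodesic_formula g beta B t i p.
Proof.
exists geodesic; split; first exact: geodesic_is_geodesic.
by move=> t Dt i p; rewrite geodesicE// geodesic_formulaE.
Qed.

End Geodesic.

(** * Uniqueness of the geodesic *)

Section Riccati.
Context {R : realType}.
Variables (J : set R) (b : R) (tau : R^o -> R^o).
Hypotheses (J_interval : is_interval J) (J0 : J 0).
Hypothesis tau_deriv : forall t, J t ->
  diff_quotient tau t 1 @ 0^' --> (- (4^-1 * tau t ^+ 2) : R^o).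

Lemma riccati_decreasing s t : J s -> J t -> s <= t -> tau t <= tau s.
Proof.
move=> Js Jt st; have [c _] := mean_value_interval J_interval Js Jt tau_deriv.
rewrite -subr_le0 => ->; rewrite mulNr oppr_le0 mulr_ge0 ?subr_ge0//.
by rewrite mulr_ge0 ?sqr_ge0.
Qed.

(** [tau] is nonincreasing, hence bounded by its values at both ends. *)
Lemma riccati_bound t c : J t -> (0 <= c <= t) || (t <= c <= 0) ->
  `|tau c| <= `|tau 0| + `|tau t|.
Proof.
move=> Jt cP; have Jc : J c.
  by case/orP: cP => cP; [exact: (J_interval J0 Jt)|exact: (J_interval Jt J0)].
have l0 : `|tau 0| <= `|tau 0| + `|tau t| by rewrite lerDl.
have lt : `|tau t| <= `|tau 0| + `|tau t| by rewrite lerDr.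
move: l0 lt; rewrite !ler_norml => /andP[a1 a2] /andP[b1 b2].
case/orP: cP => /andP[c1 c2].
  by rewrite (le_trans b1 (riccati_decreasing Jc Jt c2)) (le_trans (riccati_decreasing J0 Jc c1) a2).
by rewrite (le_trans a1 (riccati_decreasing Jc J0 c2)) (le_trans (riccati_decreasing Jt Jc c1) b2).
Qed.

(** [z = (b t + 1) tau - 4 b] solves the linear equation [z' = - tau z / 4] with
    [z 0 = 0].  As [tau] is bounded between [0] and [t], [z^2] times a suitable
    exponential does not grow away from [0]. *)
Lemma riccati_uniq t : J t -> tau 0 = 4 * b -> (b * t + 1) * tau t = 4 * b.
Proof.
move=> Jt tau0; set C := `|tau 0| + `|tau t|.
pose z (s : R^o) : R^o := (b * s + 1) *: tau s - 4 * b.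
have zd s : J s -> diff_quotient z s 1 @ 0^' --> (- (4^-1 * tau s * z s) : R^o).
  move=> Js; have H := diff_quotient_scale (@affine_deriv R b s) (tau_deriv Js).
  apply: (cvg_rw H) => [h|]; first by rewrite /diff_quotient /z opprB addrA subrK.
  by rewrite /z /GRing.scale /=; field.
(* The sign of [k] is the one for which the derivative of [f] has the opposite
   sign of [t]; then [f t <= f 0 = 0]. *)
pose k : R := if 0 <= t then - C else C.
pose f (s : R^o) : R^o := expR (k * s) *: (z s *: z s).
pose df (s : R^o) : R^o := (k - 2^-1 * tau s) * (expR (k * s) * z s ^+ 2).
have fd s : J s -> diff_quotient f s 1 @ 0^' --> df s.
  move=> Js; have H := diff_quotient_scale
    (diff_quotient_comp (is_derive_expR _) (@diff_quotient_lin R k s))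
    (diff_quotient_scale (zd s Js) (zd s Js)).
  apply: (cvg_rw H) => //.
  by rewrite /df /GRing.scale /=; field.
have [c cP] := mean_value_interval J_interval J0 Jt fd.
have f0 : f 0 = 0.
  by rewrite /f /z mulr0 [b * 0]mulr0 add0r scale1r tau0 subrr !scaler0.
rewrite f0 !subr0 => E.
have f_le0 : f t <= 0.
  rewrite E /df; have := riccati_bound Jt cP; rewrite -/C ler_norml => /andP[c1 c2].
  have C0 : 0 <= C by rewrite addr_ge0.
  have p : 0 <= expR (k * c) * z c ^+ 2 by rewrite mulr_ge0 ?expR_ge0 ?sqr_ge0.
  rewrite -mulrA mulrCA; apply: mulr_ge0_le0 => //.
  have [t0|t0] := leP 0 t.
    have k0 : k - 2^-1 * tau c <= 0 by rewrite /k t0; lra.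
    exact: (@mulr_le0_ge0 R _ _ k0 t0).
  have kC : k = C by rewrite /k ifF//; apply/negbTE; rewrite -ltNge.
  have k0 : 0 <= k - 2^-1 * tau c by rewrite kC; lra.
  exact: (@mulr_ge0_le0 R _ _ k0 (ltW t0)).
have : z t ^+ 2 = 0.
  apply/eqP; rewrite eq_le sqr_ge0 andbT -(pmulr_rle0 _ (expR_gt0 (k * t))).
  exact: f_le0.
by move=> /eqP; rewrite sqrf_eq0 subr_eq0 => /eqP.
Qed.

End Riccati.

Section MatrixUniqueness.
Context {R : realType} {n : nat}.
Variables (b : R) (G B : 'M[R]_n) (J : set R) (x v a : R^o -> 'M[R]_n).
Hypotheses (n_gt0 : (0 < n)%N) (J_interval : is_interval J) (J0 : J 0).
Hypothesis J_domain : forall t, J t -> 0 < b * t + 1.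
Hypothesis x_unit : forall t, J t -> x t \in unitmx.
Hypothesis x_deriv : forall t, J t -> diff_quotient x t 1 @ 0^' --> v t.
Hypothesis v_deriv : forall t, J t -> diff_quotient v t 1 @ 0^' --> a t.
Let W t := invmx (x t) *m v t.
Hypothesis geodesic_eq : forall t, J t ->
  a t + (- 2^-1 *: (v t *m W t + v t *m W t) + 8^-1 *: (\tr (W t) *: v t + \tr (W t) *: v t)) = 0.
Hypothesis x0 : x 0 = G.
Hypothesis v0 : v 0 = G *m flow_direction b B.
Hypothesis B_trace : \tr B = 0.

Let G_unit : G \in unitmx. Proof. by rewrite -x0; exact: x_unit. Qed.

Lemma log_velocity_deriv t : J t ->
  diff_quotient W t 1 @ 0^' --> - (4^-1 * \tr (W t)) *: W t.
Proof.
move=> Jt; have xu := x_unit Jt.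
have H := diff_quotient_mulmx (diff_quotient_invmx xu (x_deriv Jt)) (v_deriv Jt).
apply: (cvg_rw H) => //.
have aE : a t = v t *m W t - (4^-1 * \tr (W t)) *: v t.
  apply/eqP; rewrite -subr_eq0 -[X in _ == X](geodesic_eq Jt); apply/eqP.
  by move: (v t *m W t) => X; apply/matrixP => i j; rewrite !mxE; field.
rewrite aE mulmxBr -scalemxAr -/(W t) scaleN1r mulNmx -mulmxA -/(W t).
by rewrite (mulmxA (invmx _)) -/(W t) addKr scaleNr.
Qed.

Lemma log_velocity0 : W 0 = flow_direction b B.
Proof. by rewrite /W x0 v0 mulKmx. Qed.

Lemma trace_deriv (f : R^o -> 'M[R]_n) t l :
  diff_quotient f t 1 @ 0^' --> (l : 'M[R]_n) ->
  diff_quotient (fun s => \tr (f s) : R^o) t 1 @ 0^' --> (\tr l : R^o).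
Proof.
move=> fl.
have c : \sum_i diff_quotient f t 1 h i i @[h --> 0^'] --> \sum_i l i i.
  apply: cvg_big => [|k _]; first exact: add_continuous.
  exact: cvg_coord.
apply: (cvg_rw c) => // h.
by rewrite -[LHS]/(\tr _) /diff_quotient mxtraceZ raddfB.
Qed.

(** The trace of [W] is known by [riccati_uniq], which makes [(b t + 1) W]
    constant. *)
Lemma log_velocityE t : J t -> W t = (b * t + 1)^-1 *: flow_direction b B.
Proof.
move=> Jt.
have tauE s : J s -> (b * s + 1) * \tr (W s) = 4 * b.
  move=> Js; apply: (riccati_uniq J_interval J0 (tau := fun s => \tr (W s)) _ Js).
    move=> r Jr; apply: (cvg_rw (trace_deriv (log_velocity_deriv Jr))) => //.
    by rewrite mxtraceZ mulNr expr2 mulrA.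
  by rewrite log_velocity0 flow_direction_trace.
have E : (b * 0 + 1) *: W 0 = (b * t + 1) *: W t.
  apply: (derive0_cst (f := fun s => (b * s + 1) *: W s) J_interval J0 Jt) => s Js.
  apply: (cvg_rw (diff_quotient_scale (@affine_deriv R b s) (log_velocity_deriv Js))) => //.
  rewrite scalerA -scalerDl mulrN mulrCA tauE// mulrA mulVf ?mul1r ?subrr ?scale0r//.
by move: E; rewrite mulr0 add0r scale1r log_velocity0 => ->; rewrite scalerA mulVf ?scale1r// gt_eqF// J_domain.
Qed.

(** [x] and [flow] solve the same linear equation [y' = (b t + 1)^-1 y A_0], so
    that [x flow^-1] is constant. *)
Lemma flow_uniq t : J t -> x t = flow b G B t.
Proof.
move=> Jt; pose phi := flow b G B.
have phiu s : phi s \in unitmx by exact: flow_unitmx.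
have E : x 0 *m invmx (phi 0) = x t *m invmx (phi t).
  apply: (derive0_cst (f := fun s => x s *m invmx (phi s)) J_interval J0 Jt) => s Js.
  have H := diff_quotient_mulmx (x_deriv Js) (diff_quotient_invmx (phiu s) (flow_deriv (G := G) (B := B) (J_domain Js))).
  apply: (cvg_rw H) => //.
  have vE : v s = (b * s + 1)^-1 *: (x s *m flow_direction b B).
    by rewrite -[LHS](mulKVmx (x_unit Js)) -/(W s) log_velocityE// -scalemxAr.
  rewrite vE -/phi -scalemxAl -(scalemxAr (_^-1)) (mulmxA (invmx _)) (mulVmx (phiu s)).
  by rewrite mul1mx -scalemxAl scaleN1r mulmxN -scalemxAr mulmxA subrr.
have phi0 : phi 0 = G by exact: flow0.
rewrite x0 phi0 (mulmxV G_unit) in E.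
by rewrite -[LHS](mulmxKV (phiu t)) -E mul1mx.
Qed.

End MatrixUniqueness.

Section GeodesicUniqueness.
Context {R : realType} {n : nat} {T : topologicalType} {M : manifold R n T}.
Variables (g : S2 M) (beta : T -> R) (B : chart_index M -> 'rV[R]_n -> 'M[R]_n).

Lemma geodesic_uniq (J : set R) (gamma : R^o -> S2 M) : (0 < n)%N -> metrics g ->
  (forall i p, \tr (B i p) = 0) ->
  open J -> is_interval J -> J 0 -> J `<=` geodesic_domain beta ->
  geodesic_from g beta B J gamma ->
  forall t, J t -> forall i p, gamma t i p = geodesic_formula g beta B t i p.
Proof.
move=> n_gt0 gM B0 Jo Jint J0 JD [[gs gammaM geq] gamma0 v0] t Jt i p.
rewrite (geodesic_formulaE g B i p (JD _ Jt)).
have [ip|ip] := pselect (coords (atlas M i) p); last first.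
  by rewrite /flow !(sym2_off (S2_sym2 _) ip) mul0mx scaler0.
apply: (flow_uniq (J := J) (x := fun t => gamma t i p) (v := fun t => velocity gamma t i p)
  (a := fun t => velocity (velocity gamma) t i p)) => //.
- by move=> s Js; exact: JD.
- by move=> s Js; apply: metrics_unitmx => //; exact: gammaM.
- by move=> s Js; exact: curve_point_velocity.
- by move=> s Js; exact: (curve_point_acceleration Jo gs).
- move=> s Js; have := geq s Js; move/(congr1 (fun u : S2 M => u i p)).
  by rewrite S2_add S2_0 christoffelE//; exact: gammaM.
- by rewrite gamma0.
Qed.

End GeodesicUniqueness.

Theorem theorem2p4 (R : realType) (n : nat) (T : topologicalType)
    (M : manifold R n T) (n_gt0 : (0 < n)%N)
    (M_closed : closed_manifold M) (M_orientable : orientable M) :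
  (forall a b c : S2 M -> S2 M,
     smooth_field a -> smooth_field b -> smooth_field c ->
   forall g : S2 M, metrics g ->
   forall (i : chart_index M) (p : 'rV[R]_n),
     let A := raise g (a g) i p in
     let B := raise g (b g) i p in
     let C := raise g (c g) i p in
     curvature a b c g i p =
       - 4^-1 *: (g i p *m commutator (commutator A B) C)
       - 64^-1 *: (\tr C *: (\tr A *: b g i p - \tr B *: a g i p)))
  /\
  (forall (g : S2 M) (beta : T -> R)
     (B : chart_index M -> 'rV[R]_n -> 'M[R]_n),
     metrics g -> smooth_function M beta -> is_endomorphism B ->
     (forall i p, \tr (B i p) = 0) ->
     (forall i p, (g i p *m B i p)^T = g i p *m B i p) ->
   (exists gamma : R^o -> S2 M,
      geodesic_from g beta B (geodesic_domain beta) gamma /\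
      forall t, geodesic_domain beta t ->
        forall i p, gamma t i p = geodesic_formula g beta B t i p)
   /\
   (forall (J : set R) (gamma : R^o -> S2 M),
      open J -> is_interval J -> J 0 -> J `<=` geodesic_domain beta ->
      geodesic_from g beta B J gamma ->
      forall t, J t ->
        forall i p, gamma t i p = geodesic_formula g beta B t i p)).
Proof.
split.
  by move=> a b c ? ? ? g gM i p; exact: curvature_formula.
move=> g beta B gM beta_smooth B_endo B_trace B_sym; split.
  exact: geodesic_exists.
by move=> J gamma; exact: geodesic_uniq.
Qed.
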